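(* Let $u,v,w$ be words of the same length $N$ with $|u|_0=|v|_0=|w|_0$ and $\mathrm{d}(w)=\mathrm{d}(u)+\mathrm{d}(v)$. Then the number of oriented TFPLs of size $N$ with boundary $(u,v;w)$ equals the Littlewood--Richardson coefficient $c_{\lambda(u),\lambda(v)}^{\lambda(w)}$.
   Context: Let $N\ge 1$. $G^N$ is the induced subgraph of the square lattice $\mathbb{Z}^2$ formed by $N$ consecutive, horizontally centred rows having $3,5,\dots,2N+1$ vertices from top to bottom. It is bipartite; vertices of the same colour as the leftmost vertex of each row are called odd, the others even. Let $B_1,\dots,B_N$ be the even vertices of the bottom row, $L_1,\dots,L_N$ the leftmost vertices of the rows, and $R_1,\dots,R_N$ the rightmost vertices of the rows, each family numbered from left to right (so $L_1$ is the leftmost vertex of the bottom row and $R_1$ the rightmost vertex of the top row). A TFPL of size $N$ is a subgraph $f$ of $G^N$ (a set of edges) such that each $L_i$ and each $R_i$ has degree $0$ or $1$, each $B_i$ has degree $1$, every other vertex has degree $2$, and no path of $f$ joins two vertices $L_i,L_j$ or two vertices $R_i,R_j$. An oriented TFPL is a TFPL together with an orientation of each of its edges such that every vertex of degree $2$ has one incoming and one outgoing edge, the edges at the $L_i$ are oriented away from $L_i$, and the edges at the $R_i$ are oriented into $R_i$. For words $u,v,w\in\{0,1\}^N$, an oriented TFPL has boundary $(u,v;w)$ if for all $i$: $u_i=1$ iff $L_i$ has degree $1$; $v_i=0$ iff $R_i$ has degree $1$; $w_i=1$ if $B_i$ has in-degree $1$ and $w_i=0$ if $B_i$ has out-degree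 $1$. $|u|_0$ is the number of $0$s in $u$; $\mathrm{d}(u)$ is the number of pairs $i<j$ with $u_i=1,u_j=0$. $\lambda(u)$ is the integer partition whose parts are the nonzero numbers among $\{|u_1\cdots u_{j-1}|_1 : u_j=0\}$ (for each $0$ of $u$, the number of $1$s preceding it), so $|\lambda(u)|=\mathrm{d}(u)$. The Littlewood--Richardson coefficients $c^{\lambda}_{\mu,\nu}$ are defined by $s_\mu s_\nu=\sum_\lambda c^\lambda_{\mu,\nu}s_\lambda$ in the ring of symmetric functions, $s_\lambda$ denoting Schur functions. *)

(* Defs.v *)
From HB Require Import structures.
From mathcomp Require Import all_boot all_order all_algebra.
From mathcomp Require Import mpoly.
Set Implicit Arguments. Unset Strict Implicit. Unset Printing Implicit Defensive.
Import GRing.Theory.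

(* Words in {0,1}^N are bool tuples, true = 1, false = 0; position i   *)
(* (0-indexed) corresponds to the letter with index i+1 of the paper.  *)

Definition nzeros (s : seq bool) : nat := count negb s.

Definition dinv (s : seq bool) : nat :=
  \sum_(i < size s) \sum_(j < size s)
     [&& i < j, nth false s i & ~~ nth false s j].

Definition lam (s : seq bool) : seq nat :=
  rev [seq k <- [seq count id (take j s) | j <- iota 0 (size s)
                                         & ~~ nth false s j] | 0 < k].

Definition is_part (la : seq nat) : bool := sorted geq la && all (fun k => 0 < k) la.

Definition in_shape (la : seq nat) (i j : nat) : bool :=
  (i < size la) && (j < nth 0 la i).

Definition filling (n : nat) (la : seq nat) :=
  {ffun 'I_(size la) * 'I_(head 0 la) -> option 'I_n}.

(* entry (shifted by one, 0 = empty / outside the box) *)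
Definition fentry n la (T : filling n la) (i j : nat) : nat :=
  match insub i, insub j with
  | Some i', Some j' => match T (i', j') with Some k => (val k).+1 | None => 0 end
  | _, _ => 0
  end.

Definition is_ssyt n la (T : filling n la) : bool :=
  [forall i : 'I_(size la), forall j : 'I_(head 0 la),
     [&& (T (i, j) != None) == in_shape la i j,
         in_shape la i j.+1 ==> (fentry T i j <= fentry T i j.+1)
       & in_shape la i.+1 j ==> (fentry T i j < fentry T i.+1 j)]].

Definition content n la (T : filling n la) : 'X_{1..n} :=
  [multinom #|[set c | T c == Some k]| | k < n].

Definition schur (n : nat) (la : seq nat) : {mpoly int[n]} :=
  \sum_(T : filling n la | is_ssyt T) 'X_[content T].

(* c is the Littlewood-Richardson coefficient c^la_{mu,nu}, computed in
   n variables: s_mu s_nu admits an expansion in the Schur polynomials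
   s_ka (ka partitions with at most n parts), and in every such expansion
   the coefficient of s_la is c.  (For n >= length la this is the
   coefficient of s_la in s_mu s_nu in the ring of symmetric functions.) *)
Definition schur_expansion (n : nat) (mu nu : seq nat)
    (ks : seq (seq nat)) (d : seq nat -> int) : Prop :=
  [/\ uniq ks, all (fun ka => is_part ka && (size ka <= n)) ks &
      (schur n mu * schur n nu = \sum_(ka <- ks) d ka *: schur n ka)%R].

Definition is_LR_coeff (n : nat) (la mu nu : seq nat) (c : int) : Prop :=
  (exists ks d, schur_expansion n mu nu ks d) /\
  (forall ks d, schur_expansion n mu nu ks d ->
     c = if la \in ks then d la else 0).

(* The graph G^N.  A vertex is (k, c): row k (0 = top row, which has 3  *)
(* vertices; row k has 2k+3 vertices) and column c, where the lattice   *)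
(* abscissa is x = c - N.  Row k consists of the columns c with         *)
(* N - (k+1) <= c <= N + (k+1).  The carrier type is a bit larger and   *)
(* in_G selects the actual vertices.                                   *)

Definition Vtx (N : nat) := ('I_N.+1 * 'I_(N.*2).+1)%type.

Definition in_G N (p : Vtx N) : bool :=
  [&& val p.1 < N, N - (val p.1).+1 <= val p.2 & val p.2 <= N + (val p.1).+1].

Definition adjG N (p q : Vtx N) : bool :=
  [&& in_G p, in_G q &
   ((val p.1 == val q.1) && (((val p.2).+1 == val q.2) || ((val q.2).+1 == val p.2)))
   || ((val p.2 == val q.2) && (((val p.1).+1 == val q.1) || ((val q.1).+1 == val p.1)))].

(* L_{i+1}: leftmost vertex of row N-1-i (L_1 = leftmost of bottom row) *)
Definition Lv N (i : 'I_N) : Vtx N := (inord (N - i.+1), inord i).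
(* R_{i+1}: rightmost vertex of row i (R_1 = rightmost of top row) *)
Definition Rv N (i : 'I_N) : Vtx N := (inord i, inord (N + i.+1)).
(* B_{i+1}: the (i+1)-th even vertex of the bottom row, x = -N + 2i + 1 *)
Definition Bv N (i : 'I_N) : Vtx N := (inord N.-1, inord (i.*2.+1)).

Definition is_boundary N (p : Vtx N) : bool :=
  [exists i : 'I_N, (p == Lv i) || (p == Rv i) || (p == Bv i)].

(* An oriented subgraph is a set of arcs (ordered pairs of adjacent     *)
(* vertices) containing no edge in both directions: it is a set of     *)
(* edges f together with an orientation of each edge of f.             *)
Definition arcs N := {set Vtx N * Vtx N}.

Definition indeg N (A : arcs N) (p : Vtx N) : nat := #|[set a in A | a.2 == p]|.
Definition outdeg N (A : arcs N) (p : Vtx N) : nat := #|[set a in A | a.1 == p]|.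
Definition deg N (A : arcs N) (p : Vtx N) : nat := indeg A p + outdeg A p.

Definition und N (A : arcs N) : rel (Vtx N) :=
  fun p q => ((p, q) \in A) || ((q, p) \in A).

Definition is_oTFPL N (A : arcs N) : bool :=
  [&& [forall a in A, adjG a.1 a.2],
      [forall a in A, (a.2, a.1) \notin A],
      [forall i : 'I_N, [&& deg A (Lv i) <= 1, deg A (Rv i) <= 1 & deg A (Bv i) == 1]],
      [forall p, (in_G p && ~~ is_boundary p) ==> (deg A p == 2)],
      [forall i : 'I_N, forall j : 'I_N, (i != j) ==>
          ~~ connect (und A) (Lv i) (Lv j) && ~~ connect (und A) (Rv i) (Rv j)],
      [forall p, (deg A p == 2) ==> (indeg A p == 1) && (outdeg A p == 1)] &
      [forall i : 'I_N, (indeg A (Lv i) == 0) && (outdeg A (Rv i) == 0)]].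

Definition has_boundary N (A : arcs N) (u v w : N.-tuple bool) : bool :=
  [forall i : 'I_N,
     [&& tnth u i == (deg A (Lv i) == 1),
         ~~ tnth v i == (deg A (Rv i) == 1) &
         (tnth w i == (indeg A (Bv i) == 1))]].

Definition num_oTFPL N (u v w : N.-tuple bool) : nat :=
  #|[set A : arcs N | is_oTFPL A && has_boundary A u v w]|.

(* Main.v *)
(* An oriented TFPL splits into two disjoint partial matchings, according to the
   colour of the origin of each arc. Reading G^N row by row and labelling each
   edge by its matching (or by None when unused), the words u, v, w satisfy an
   identity d(w) = d(u) + d(v) + (number of certain local patterns). If
   d(w) = d(u) + d(v), none of these patterns occurs, and what remains is a puzzle
   made of two families of tiles. The condition that no path joins two L's or two
   R's is automatic, because a path starting at a vertex without incoming arc is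
   directed. A Yang-Baxter equation lets a line be pulled through a puzzle; as a
   result the puzzle numbers P(u,v,w) intertwine the addition of vertical strips
   to lambda(v) with their removal from lambda(w). The Schur polynomials,
   as sums over Gelfand-Tsetlin patterns, obey the corresponding Pieri rule, so an
   induction on lambda(v) yields s_lambda(u) s_lambda(v) = sum_w P(u,v,w) s_lambda(w)
   up to Schur polynomials of partitions outside the box. Linear independence of
   Schur polynomials identifies P(u,v,w) with the Littlewood-Richardson coefficient. *)
Require Import Defs.
From HB Require Import structures.
From mathcomp Require Import all_boot all_order all_algebra.
From mathcomp Require Import mpoly.
From mathcomp Require Import zify ring.
Set Implicit Arguments. Unset Strict Implicit. Unset Printing Implicit Defensive.
Import GRing.Theory Num.Theory.

(** * Puzzles and the Yang-Baxter equation *)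

(** Puzzles are never matched with tableaux. Both sides obey one recursion instead: [e_k s_nu'] is
    [s_nu] plus smaller terms for a suitable smaller [nu'], so multiplication by [s_lambda(u)] is
    determined by its commutation with the [e_k] and by the empty partition. Pulling the line is
    this commutation for puzzle numbers, and [z] marks the size of the vertical strip. The obstacle
    is the box: words of length [N] with [a] zeros encode the partitions with at most [a] parts, all
    at most [N - a], whereas products of Schur polynomials leave this set. Coefficients outside the
    box are left unspecified throughout. This is consistent because removing a vertical strip from a
    partition in the box stays in the box, so the box coefficients of [e_k f] involve only box
    coefficients of [f]. Partitions are mostly kept as lists of exactly [N] parts, zeros included:
    removing the last variable then shortens the list by one. *)

Notation lab := (option bool).
Notation N_ := (@None bool).
Notation F_ := (Some false).
Notation T_ := (Some true).

(* [N_] is an unused edge; [F_] and [T_] are edges oriented from an odd to an even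
   vertex and from an even to an odd vertex *)
Definition labs : seq lab := [:: N_; F_; T_].

(* the tiles at an even vertex (left, right, lower edge; the upper edge is unused)
   and at an odd vertex (right, upper, left edge; the lower edge is unused) *)
Definition up (l r d : lab) : bool :=
  (l, r, d) \in [:: (N_, T_, F_); (F_, N_, T_); (F_, T_, N_); (N_, F_, T_); (T_, N_, F_)].

Definition dn (r t l : lab) : bool :=
  (r, t, l) \in [:: (T_, F_, N_); (N_, T_, F_); (F_, T_, N_); (N_, F_, T_); (T_, N_, F_)].

(** An odd vertex followed by the even vertex on its right. [r] and [l] are the edges to the left
    and to the right of the odd vertex; their names come from the even vertices next to it, whose
    right and left edges they are. *)
Definition cell (r t d r2 : lab) : nat := count (fun l => dn r t l && up l r2 d) labs.

Definition lookup4 (s : seq ((lab * lab * lab * lab) * nat)) c x y c' : option nat :=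
  ohead [seq p.2 | p <- s & p.1 == (c, x, y, c')].

(* weights [z ^ k] of the two kinds of vertices of the line, found by solving the
   Yang-Baxter equation [exchange_cell]; absent entries have weight 0 *)
Definition degR := lookup4
  [:: ((N_, T_, T_, N_), 0); ((N_, T_, N_, F_), 1); ((N_, T_, F_, T_), 1);
      ((N_, N_, N_, N_), 0); ((N_, F_, F_, N_), 0); ((F_, T_, T_, F_), 1);
      ((F_, N_, T_, N_), 0); ((T_, T_, T_, T_), 1); ((T_, N_, N_, T_), 0);
      ((T_, F_, T_, N_), 0)].

Definition degB := lookup4
  [:: ((N_, F_, F_, N_), 0); ((N_, F_, T_, T_), 1); ((N_, T_, T_, N_), 0);
      ((N_, N_, T_, F_), 1); ((N_, N_, N_, N_), 0); ((F_, F_, F_, F_), 0);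
      ((F_, F_, N_, T_), 1); ((F_, T_, N_, N_), 0); ((F_, N_, N_, F_), 1);
      ((T_, F_, F_, T_), 1); ((T_, T_, F_, N_), 0); ((T_, N_, F_, F_), 1)].

(** Monomials in [z] are encoded by their exponents and the weight 0 by [None], so this is
    multiplication. *)
Definition oadd (o1 o2 : option nat) : option nat :=
  if o1 is Some a then if o2 is Some b then Some (a + b) else None else None.
Definition onat (b : bool) : option nat := if b then Some 0 else None.

Definition all_labs (P : lab -> bool) : bool := all P labs.

Lemma all_labsP (P : lab -> bool) : all_labs P -> forall x, P x.
Proof. by move=> /allP h [[|]|]; apply: h. Qed.

Definition triples : seq (lab * (lab * lab)) :=
  [seq (x, q) | x <- labs, q <- [seq (y, z) | y <- labs, z <- labs]].

Definition exch_degL c r t d x c2 : seq (option nat) :=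
  [seq oadd (oadd (degB c t p.1 p.2.2) (onat (cell r p.1 d p.2.1 == 1))) (degR p.2.2 x p.2.1 c2)
     | p <- triples].
Definition exch_degR c r t d x c2 : seq (option nat) :=
  [seq oadd (oadd (degR c p.1 r p.2.2) (onat (cell p.1 t p.2.1 x == 1))) (degB p.2.2 p.2.1 d c2)
     | p <- triples].

Definition degs (s : seq (option nat)) : seq nat := pmap id s.

(** Equal multisets of exponents give equal polynomials in [z] over every ring, so the Yang-Baxter
    equation becomes a finite check over the 3^6 boundary conditions. *)
Definition exch_ok c r t d x c2 :=
  perm_eq (degs (exch_degL c r t d x c2)) (degs (exch_degR c r t d x c2)).

Lemma exch_okP c r t d x c2 : exch_ok c r t d x c2.
Proof.
suff: all_labs (fun c => all_labs (fun r => all_labs (fun t => all_labs (fun d =>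
  all_labs (fun x => all_labs (fun c2 => exch_ok c r t d x c2)))))).
  move=> h; have h1 := all_labsP h c; have h2 := all_labsP h1 r; have h3 := all_labsP h2 t.
  by have h4 := all_labsP h3 d; have h5 := all_labsP h4 x; apply: (all_labsP h5 c2).
by vm_compute.
Qed.

Definition left_degL c r0 d u c1 : seq (option nat) :=
  [seq oadd (onat (up u r d)) (degR c r0 r c1) | r <- labs].
Definition left_degR c r0 d u c1 : seq (option nat) :=
  [seq oadd (onat (up u r0 d')) (degB c d' d c1) | d' <- labs].

Definition exchange_left_ok u r0 d c1 :=
  perm_eq (degs (left_degL N_ r0 d u c1)) (degs (left_degR N_ r0 d u c1)).

(** This handles the even vertex at the left end of a row, where the line enters in state [N_]. A
    left boundary edge leaves an odd vertex and never carries [T_], a label for which the identity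
    fails. *)
Lemma exchange_left_okP u r0 d c1 : u != T_ -> exchange_left_ok u r0 d c1.
Proof.
suff: all_labs (fun r0 => all_labs (fun d => all_labs (fun c1 =>
         exchange_left_ok N_ r0 d c1 && exchange_left_ok F_ r0 d c1))).
  move=> h; have h1 := all_labsP h r0; have h2 := all_labsP h1 d.
  by have /andP[] := all_labsP h2 c1; case: u => [[]|].
by vm_compute.
Qed.

Section Line.
Variables (R : comNzRingType) (z : R).
Local Open Scope ring_scope.

Definition wt (o : option nat) : R := if o is Some e then z ^+ e else 0.
Definition wR c x y c' := wt (degR c x y c').
Definition wB c x y c' := wt (degB c x y c').

Lemma sum_wt (s : seq (option nat)) : \sum_(o <- s) wt o = \sum_(e <- degs s) z ^+ e.
Proof.
elim: s => [|[e|] s IH]; first by rewrite !big_nil.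
  by rewrite /degs /= !big_cons IH.
by rewrite /degs /= big_cons IH add0r.
Qed.

Lemma wt_oadd o1 o2 : wt (oadd o1 o2) = wt o1 * wt o2.
Proof. by case: o1 o2 => [a|] [b|] //=; rewrite ?mul0r ?mulr0 // exprD. Qed.

Lemma wt_onat (b : bool) : wt (onat b) = b%:R.
Proof. by case: b. Qed.

Lemma sum_wt_perm (T : Type) (f1 f2 : T -> option nat) (s : seq T) :
  perm_eq (degs (map f1 s)) (degs (map f2 s)) ->
  \sum_(x <- s) wt (f1 x) = \sum_(x <- s) wt (f2 x).
Proof. by move=> h; rewrite -(big_map f1 xpredT wt) -(big_map f2 xpredT wt) !sum_wt (perm_big _ h). Qed.

(** At most one middle edge completes a cell, so its count is a weight of the form [onat]. *)
Lemma cell_eq1 r t d r2 : (cell r t d r2)%:R = (cell r t d r2 == 1%N)%:R :> R.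
Proof.
suff: cell r t d r2 \in [:: 0; 1]%N by rewrite !inE => /orP[]/eqP->.
by move: r t d r2; do 4![case=> [[|]|]].
Qed.

Lemma sum_triples (F : lab * (lab * lab) -> R) :
  \sum_(p <- triples) F p = \sum_(x <- labs) \sum_(y <- labs) \sum_(w <- labs) F (x, (y, w)).
Proof. by rewrite big_allpairs_dep; apply: eq_bigr => x _; rewrite big_allpairs_dep. Qed.

(** The Yang-Baxter equation: the line passes above and to the right of the cell in the first sum,
    to the left and below in the second. *)
Lemma exchange_cell c r t d x c2 :
  \sum_(t' <- labs) \sum_(r2 <- labs) \sum_(c1 <- labs)
     wB c t t' c1 * (cell r t' d r2)%:R * wR c1 x r2 c2 =
  \sum_(r0 <- labs) \sum_(d' <- labs) \sum_(c1 <- labs)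
     wR c r0 r c1 * (cell r0 t d' x)%:R * wB c1 d' d c2.
Proof.
have h := sum_wt_perm (exch_okP c r t d x c2).
rewrite !sum_triples in h.
under eq_bigr do under eq_bigr do under eq_bigr do rewrite cell_eq1 -wt_onat -!wt_oadd.
under [RHS]eq_bigr do under eq_bigr do under eq_bigr do rewrite cell_eq1 -wt_onat -!wt_oadd.
exact: h.
Qed.

Lemma exchange_left u r0 d c1 : u != T_ ->
  \sum_(r <- labs) (up u r d)%:R * wR N_ r0 r c1 =
  \sum_(d' <- labs) (up u r0 d')%:R * wB N_ d' d c1.
Proof.
move=> hu; have h := sum_wt_perm (exchange_left_okP r0 d c1 hu).
transitivity (\sum_(r <- labs) wt (oadd (onat (up u r d)) (degR N_ r0 r c1))).
  by apply: eq_bigr => r _; rewrite wt_oadd wt_onat.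
by rewrite h; apply: eq_bigr => r _; rewrite wt_oadd wt_onat.
Qed.

End Line.

(** * Puzzles row by row, and the line pulled through them *)

Fixpoint words (T : Type) (A : seq T) (n : nat) : seq (seq T) :=
  if n is n'.+1 then [seq x :: s | x <- A, s <- words A n'] else [:: [::]].

Lemma mem_words (T : eqType) (A : seq T) n (s : seq T) :
  (s \in words A n) = (size s == n) && all (mem A) s.
Proof.
elim: n s => [|n IH] [|x s] //=; first by apply/negP => /allpairsP[[y t] []].
apply/allpairsP/idP => [[[y t] /= [hy ht [-> ->]]]|].
  by move: ht; rewrite IH eqSS hy => /andP[-> ->].
by rewrite eqSS => /and3P[hs hx ha]; exists (x, s); split=> //=; rewrite IH hs.
Qed.

Lemma words_uniq (T : eqType) (A : seq T) n : uniq A -> uniq (words A n).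
Proof.
move=> hA; elim: n => //= n IH; apply: allpairs_uniq => //.
by move=> [x s] [y t] _ _ /= [-> ->].
Qed.

Arguments words : simpl never.

Fixpoint cells (r : lab) (ts ds : seq lab) (v : lab) : nat :=
  match ts, ds with
  | [::], [::] => r == v
  | t :: ts', d :: ds' => \sum_(r2 <- labs) cell r t d r2 * cells r2 ts' ds' v
  | _, _ => 0
  end.

Definition row (u : lab) (ts ds : seq lab) (v : lab) : nat :=
  if ds is d :: ds' then \sum_(r <- labs) up u r d * cells r ts ds' v else 0.

(* labels on the left and right boundary are listed from bottom to top *)
Fixpoint puzzles (us vs ds : seq lab) : nat :=
  match us, vs with
  | [::], [::] => ds == [::]
  | u :: us', v :: vs' => \sum_(ts <- words labs (size us')) puzzles us' vs' ts * row u ts ds v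
  | _, _ => 0
  end.

Section Exchange.
Variables (R : comNzRingType) (z : R).
Local Open Scope ring_scope.

Fixpoint line (W : lab -> lab -> lab -> lab -> R) (c : lab) (xs ys : seq lab) (c' : lab) : R :=
  match xs, ys with
  | [::], [::] => (c == c')%:R
  | x :: xs', y :: ys' => \sum_(c1 <- labs) W c x y c1 * line W c1 xs' ys' c'
  | _, _ => 0
  end.

Lemma sum_labs_at (F : lab -> R) (a : lab) :
  (forall x, x != a -> F x = 0) -> \sum_(x <- labs) F x = F a.
Proof.
move=> h; rewrite !big_cons big_nil addr0.
case: a h => [[|]|] h; first by rewrite (h N_) // (h F_) // !add0r.
  by rewrite (h N_) // (h T_) // add0r addr0.
by rewrite (h F_) // (h T_) // !addr0.
Qed.

Lemma line_rcons W c xs x ys y c' : size xs = size ys ->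
  line W c (rcons xs x) (rcons ys y) c' =
  \sum_(c1 <- labs) line W c xs ys c1 * W c1 x y c'.
Proof.
elim: xs ys c => [|x0 xs IH] [|y0 ys] c //=.
  move=> _; rewrite (sum_labs_at (a := c')) => [|c1 /negPf->]; last by rewrite mulr0.
  rewrite (sum_labs_at (a := c)) ?eqxx ?mulr1 ?mul1r // => c1.
  by rewrite eq_sym => /negPf->; rewrite mul0r.
move=> [hs]; under eq_bigr do rewrite IH // mulr_sumr.
rewrite exchange_big; apply: eq_bigr => c1 _; rewrite mulr_suml.
by apply: eq_bigr => c2 _; rewrite mulrA.
Qed.

Lemma sum_words0 (F : seq lab -> R) : \sum_(s <- words labs 0) F s = F [::].
Proof. exact: big_seq1. Qed.

Lemma exchange_big32 (I1 I2 I3 J1 J2 : Type) (r1 : seq I1) (r2 : seq I2) (r3 : seq I3)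
    (s1 : seq J1) (s2 : seq J2) (F : I1 -> I2 -> I3 -> J1 -> J2 -> R) :
  \sum_(a <- r1) \sum_(b <- r2) \sum_(c <- r3) \sum_(i <- s1) \sum_(j <- s2) F a b c i j =
  \sum_(i <- s1) \sum_(j <- s2) \sum_(a <- r1) \sum_(b <- r2) \sum_(c <- r3) F a b c i j.
Proof.
under eq_bigr do under eq_bigr do rewrite exchange_big /=.
under eq_bigr do rewrite exchange_big /=.
rewrite exchange_big /=; apply: eq_bigr => i _.
under eq_bigr do under eq_bigr do rewrite exchange_big /=.
under eq_bigr do rewrite exchange_big /=.
by rewrite exchange_big.
Qed.

Lemma exchange_big33 (I1 I2 I3 J1 J2 J3 : Type) (r1 : seq I1) (r2 : seq I2) (r3 : seq I3)
    (s1 : seq J1) (s2 : seq J2) (s3 : seq J3) (F : I1 -> I2 -> I3 -> J1 -> J2 -> J3 -> R) :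
  \sum_(a <- r1) \sum_(b <- r2) \sum_(c <- r3) \sum_(i <- s1) \sum_(j <- s2) \sum_(k <- s3) F a b c i j k =
  \sum_(i <- s1) \sum_(j <- s2) \sum_(k <- s3) \sum_(a <- r1) \sum_(b <- r2) \sum_(c <- r3) F a b c i j k.
Proof.
rewrite exchange_big32; apply: eq_bigr => i _; apply: eq_bigr => j _.
under eq_bigr do under eq_bigr do rewrite exchange_big /=.
under eq_bigr do rewrite exchange_big /=.
by rewrite exchange_big.
Qed.

Lemma sum_words_cons (n : nat) (F : seq lab -> R) :
  \sum_(s <- words labs n.+1) F s = \sum_(x <- labs) \sum_(s <- words labs n) F (x :: s).
Proof. exact: big_allpairs_dep. Qed.

Notation wR := (wR z). Notation wB := (wB z).

Lemma exchange_cells c r ts ds v c' : size ts = size ds ->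
  \sum_(ts' <- words labs (size ts)) \sum_(v' <- labs) \sum_(c1 <- labs)
     line wB c ts ts' c1 * (cells r ts' ds v')%:R * wR c1 v v' c' =
  \sum_(r0 <- labs) \sum_(ds' <- words labs (size ds)) \sum_(c1 <- labs)
     wR c r0 r c1 * (cells r0 ts ds' v)%:R * line wB c1 ds' ds c'.
Proof.
elim: ts ds c r => [|t ts IH] [|d ds] c r //=.
  move=> _; rewrite sum_words0 (sum_labs_at (a := r)) => [|x]; last first.
    rewrite /=; by rewrite eq_sym => /negPf h; rewrite big1 // => c1 _; rewrite h mulr0 mul0r.
  rewrite (sum_labs_at (a := c)) => [|c1]; last by rewrite eq_sym => /negPf->; rewrite !mul0r.
  rewrite (sum_labs_at (a := v)) => [|x /negPf h]; last first.
    by rewrite sum_words0 big1 // => c1 _; rewrite /= h mulr0 mul0r.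
  rewrite sum_words0 (sum_labs_at (a := c')) => [|c1 /negPf h]; last by rewrite /= h mulr0.
  by rewrite /= !eqxx !mulr1 !mul1r.
move=> [hs]; rewrite !sum_words_cons.
transitivity (\sum_(t' <- labs) \sum_(r2 <- labs) \sum_(c2 <- labs) wB c t t' c2 * (cell r t' d r2)%:R *
   \sum_(ts' <- words labs (size ts)) \sum_(v' <- labs) \sum_(c1 <- labs)
     line wB c2 ts ts' c1 * (cells r2 ts' ds v')%:R * wR c1 v v' c').
  apply: eq_bigr => t' _.
  under [RHS]eq_bigr do under eq_bigr do rewrite mulr_sumr;
  under [RHS]eq_bigr do under eq_bigr do under eq_bigr do rewrite mulr_sumr;
  under [RHS]eq_bigr do under eq_bigr do under eq_bigr do under eq_bigr do rewrite mulr_sumr.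
  rewrite -exchange_big32; apply: eq_bigr => ts' _; apply: eq_bigr => v' _.
  apply: eq_bigr => c1 _; rewrite natr_sum mulr_sumr mulr_suml; apply: eq_bigr => r2 _.
  rewrite !mulr_suml; apply: eq_bigr => c2 _; rewrite natrM; ring.
(* The cells further right are exchanged first; the line then crosses the right edge of the first
   cell, the situation of [exchange_cell]. *)
under [LHS]eq_bigr => t' _ do under eq_bigr => r2 _ do under eq_bigr => c2 _ do rewrite IH //.
transitivity (\sum_(x <- labs) \sum_(ds' <- words labs (size ds)) \sum_(c3 <- labs)
   (\sum_(t' <- labs) \sum_(r2 <- labs) \sum_(c2 <- labs)
      wB c t t' c2 * (cell r t' d r2)%:R * wR c2 x r2 c3) *
   ((cells x ts ds' v)%:R * line wB c3 ds' ds c')).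
  under [LHS]eq_bigr do under eq_bigr do under eq_bigr do rewrite mulr_sumr.
  under [LHS]eq_bigr do under eq_bigr do under eq_bigr do under eq_bigr do rewrite mulr_sumr.
  under [LHS]eq_bigr do under eq_bigr do under eq_bigr do under eq_bigr do
    under eq_bigr do rewrite mulr_sumr.
  rewrite exchange_big33; apply: eq_bigr => x _; apply: eq_bigr => ds' _.
  apply: eq_bigr => c3 _; rewrite mulr_suml; apply: eq_bigr => t' _.
  rewrite mulr_suml; apply: eq_bigr => r2 _; rewrite mulr_suml; apply: eq_bigr => c2 _.
  by rewrite !mulrA.
under [LHS]eq_bigr do under eq_bigr do under eq_bigr do rewrite exchange_cell.
under [RHS]eq_bigr do rewrite sum_words_cons.
transitivity (\sum_(r0 <- labs) \sum_(d' <- labs) \sum_(c1 <- labs)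
  \sum_(x <- labs) \sum_(ds' <- words labs (size ds)) \sum_(c3 <- labs)
    wR c r0 r c1 * (cell r0 t d' x)%:R * wB c1 d' d c3 *
      ((cells x ts ds' v)%:R * line wB c3 ds' ds c')).
  rewrite exchange_big33; apply: eq_bigr => x _; apply: eq_bigr => ds' _.
  apply: eq_bigr => c3 _; rewrite mulr_suml; apply: eq_bigr => t' _.
  by rewrite mulr_suml; apply: eq_bigr => r2 _; rewrite mulr_suml.
apply: eq_bigr => r0 _; apply: eq_bigr => d' _.
rewrite [RHS]exchange_big; apply: eq_bigr => c1 _.
rewrite exchange_big; apply: eq_bigr => ds' _.
rewrite natr_sum [wR _ _ _ _ * _]mulr_sumr mulr_suml; apply: eq_bigr => x _.
by rewrite /= mulr_sumr; apply: eq_bigr => c3 _; rewrite natrM; ring.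
Qed.

Lemma exchange_row u ts ds v c' : u != T_ -> size ds = (size ts).+1 ->
  \sum_(ts' <- words labs (size ts)) \sum_(v' <- labs) \sum_(c1 <- labs)
     line wB N_ ts ts' c1 * (row u ts' ds v')%:R * wR c1 v v' c' =
  \sum_(ds' <- words labs (size ds)) (row u ts ds' v)%:R * line wB N_ ds' ds c'.
Proof.
move=> hu; case: ds => //= d ds [hs]; rewrite sum_words_cons.
transitivity (\sum_(r <- labs) (up u r d)%:R *
   \sum_(ts' <- words labs (size ts)) \sum_(v' <- labs) \sum_(c1 <- labs)
     line wB N_ ts ts' c1 * (cells r ts' ds v')%:R * wR c1 v v' c').
  under [RHS]eq_bigr do rewrite mulr_sumr.
  rewrite [RHS]exchange_big; apply: eq_bigr => ts' _.
  under [RHS]eq_bigr do rewrite mulr_sumr.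
  rewrite [RHS]exchange_big; apply: eq_bigr => v' _.
  under [RHS]eq_bigr do rewrite mulr_sumr.
  rewrite [RHS]exchange_big; apply: eq_bigr => c1 _.
  rewrite natr_sum mulr_sumr mulr_suml; apply: eq_bigr => r _.
  by rewrite natrM; ring.
under [LHS]eq_bigr => r _ do rewrite exchange_cells //.
transitivity (\sum_(r0 <- labs) \sum_(ds' <- words labs (size ds)) \sum_(c1 <- labs)
   (\sum_(r <- labs) (up u r d)%:R * wR N_ r0 r c1) *
   ((cells r0 ts ds' v)%:R * line wB c1 ds' ds c')).
  under [LHS]eq_bigr do rewrite mulr_sumr.
  rewrite [LHS]exchange_big; apply: eq_bigr => r0 _.
  under [LHS]eq_bigr do rewrite mulr_sumr.
  rewrite [LHS]exchange_big; apply: eq_bigr => ds' _.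
  under [LHS]eq_bigr do rewrite mulr_sumr.
  rewrite [LHS]exchange_big; apply: eq_bigr => c1 _.
  by rewrite mulr_suml; apply: eq_bigr => r _; ring.
under [LHS]eq_bigr => r0 _ do under eq_bigr => ds' _ do under eq_bigr => c1 _ do
  rewrite exchange_left //.
transitivity (\sum_(d' <- labs) \sum_(ds' <- words labs (size ds)) \sum_(r0 <- labs)
   \sum_(c1 <- labs) (up u r0 d')%:R * wB N_ d' d c1 *
   ((cells r0 ts ds' v)%:R * line wB c1 ds' ds c')).
  rewrite [RHS]exchange_big /=; under [RHS]eq_bigr do rewrite exchange_big /=.
  rewrite [RHS]exchange_big /=; apply: eq_bigr => r0 _; apply: eq_bigr => ds' _.
  rewrite [RHS]exchange_big /=; apply: eq_bigr => c1 _.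
  by rewrite mulr_suml.
apply: eq_bigr => d' _; apply: eq_bigr => ds' _.
rewrite natr_sum mulr_suml; apply: eq_bigr => r0 _.
by rewrite /= mulr_sumr; apply: eq_bigr => c1 _; rewrite natrM; ring.
Qed.

(** The line moves from the right side of the puzzle to below it. Induction takes it past the upper
    rows, which leaves it just above the bottom row, and [exchange_row] does the rest. It runs from
    top to bottom, hence the reversals. *)
Theorem exchange_puzzle us vs ds c : all (fun u => u != T_) us ->
  size vs = size us -> size ds = size us ->
  \sum_(vs' <- words labs (size us)) line wR N_ (rev vs) (rev vs') c * (puzzles us vs' ds)%:R =
  \sum_(ds' <- words labs (size us)) (puzzles us vs ds')%:R * line wB N_ ds' ds c.
Proof.
elim: us vs ds c => [|u us IH] [|v vs] [|d ds] c //=.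
  by move=> _ _ _; rewrite !sum_words0 /= mulr1 mul1r.
move=> /andP[hu hus] [hvs] [hds]; rewrite [LHS]sum_words_cons.
transitivity (\sum_(ts' <- words labs (size us)) \sum_(v' <- labs) \sum_(c1 <- labs)
   (\sum_(vs' <- words labs (size us)) line wR N_ (rev vs) (rev vs') c1 * (puzzles us vs' ts')%:R) *
   ((row u ts' (d :: ds) v')%:R * wR c1 v v' c)).
  rewrite [RHS]exchange_big; apply: eq_bigr => v' _.
  under [RHS]eq_bigr do under eq_bigr do rewrite mulr_suml.
  under [RHS]eq_bigr do rewrite exchange_big /=.
  rewrite [RHS]exchange_big; rewrite big_seq [RHS]big_seq; apply: eq_bigr => vs' hvs'.
  rewrite mem_words in hvs'; have /eqP hs : size vs' == size us by case/andP: hvs'.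
  rewrite !rev_cons line_rcons; last by rewrite !size_rev hs.
  rewrite natr_sum mulr_sumr; apply: eq_bigr => ts' _.
  by rewrite mulr_suml; apply: eq_bigr => c1 _; rewrite natrM; ring.
have size_words ts : ts \in words labs (size us) -> size ts = size us.
  by rewrite mem_words => /andP[/eqP].
rewrite [LHS]big_seq; under [LHS]eq_bigr => ts' hts'.
  have hs := size_words _ hts'; under eq_bigr => v' _ do under eq_bigr => c1 _ do rewrite IH //.
  over.
rewrite -big_seq.
transitivity (\sum_(ts <- words labs (size us)) (puzzles us vs ts)%:R *
  \sum_(ts' <- words labs (size ts)) \sum_(v' <- labs) \sum_(c1 <- labs)
     line wB N_ ts ts' c1 * (row u ts' (d :: ds) v')%:R * wR c1 v v' c).
  rewrite [RHS]big_seq; under [RHS]eq_bigr => ts hts.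
    rewrite (size_words _ hts).
    over.
  rewrite -big_seq; under [RHS]eq_bigr do rewrite mulr_sumr.
  rewrite [RHS]exchange_big; apply: eq_bigr => ts' _.
  under [RHS]eq_bigr do rewrite mulr_sumr.
  rewrite [RHS]exchange_big; apply: eq_bigr => v' _.
  under [RHS]eq_bigr do rewrite mulr_sumr.
  rewrite [RHS]exchange_big; apply: eq_bigr => c1 _.
  by rewrite mulr_suml; apply: eq_bigr => ts _; ring.
rewrite [LHS]big_seq; under [LHS]eq_bigr => ts hts.
  have hs := size_words _ hts.
  rewrite exchange_row //; last by rewrite /= hds hs.
  over.
rewrite -big_seq [size (d :: ds)]/= hds.
under [LHS]eq_bigr do rewrite mulr_sumr.
rewrite exchange_big; apply: eq_bigr => ds' _.
rewrite natr_sum mulr_suml; apply: eq_bigr => ts _.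
by rewrite natrM; ring.
Qed.
End Exchange.

(** * Boundary words: the line becomes a vertical strip *)

Definition left_lab (b : bool) : lab := if b then F_ else N_.
Definition right_lab (b : bool) : lab := if b then N_ else T_.

Definition bools : seq bool := [:: false; true].

Definition puz (u v w : seq bool) : nat :=
  puzzles (map left_lab u) (rev (map right_lab v)) (map Some w).

Fixpoint parts (k : nat) (w : seq bool) : seq nat :=
  if w is b :: w' then if b then parts k.+1 w' else k :: parts k w' else [::].

Lemma parts_ge k w : all (leq k) (parts k w).
Proof.
elim: w k => //= -[] w IH k; last by rewrite /= leqnn IH.
by apply: sub_all (IH k.+1) => i; apply: ltnW.
Qed.

Section Strip.
Variables (R : comNzRingType) (z : R).
Local Open Scope ring_scope.

(** The line restricted to binary words. In state [true] the word [y] is one 1 ahead of [x]. Every 0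
    of [x] read from the opening of such a gap to its closing has one more 1 before its counterpart
    in [y], and contributes [z]. *)
Fixpoint eline (c : bool) (x y : seq bool) : R :=
  match x, y with
  | [::], [::] => (~~ c)%:R
  | a :: x', b :: y' =>
    match c, a, b with
    | false, false, false => eline false x' y'
    | false, true, true => eline false x' y'
    | false, false, true => z * eline true x' y'
    | true, false, false => z * eline true x' y'
    | true, true, false => eline false x' y'
    | _, _, _ => 0
    end
  | _, _ => 0
  end.

Definition vstep (p q : nat) : R := if q == p then 1 else if q == p.+1 then z else 0.

Fixpoint vstrip (p q : seq nat) : R :=
  match p, q with
  | [::], [::] => 1
  | a :: p', b :: q' => vstep a b * vstrip p' q'
  | _, _ => 0
  end.

Arguments vstrip !p !q.

Lemma vstrip_size p q : size p != size q -> vstrip p q = 0.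
Proof. by elim: p q => [|a p IH] [|b q] //= h; rewrite IH ?mulr0. Qed.

Lemma vstep_neq p q : q != p -> q != p.+1 -> vstep p q = 0.
Proof. by rewrite /vstep => /negPf-> /negPf->. Qed.

Lemma vstrip_lt k p q : all (leq k.+1) p -> has (fun j => j <= k)%N q -> vstrip p q = 0.
Proof.
elim: p q => [|a p IH] [|b q] //= /andP[ha hp] /orP[hb|h]; last by rewrite IH ?mulr0.
by rewrite vstep_neq ?mul0r //; lia.
Qed.

Lemma vstrip_gt k p q : all (leq k.+2) q -> has (fun j => j <= k)%N p -> vstrip p q = 0.
Proof.
elim: p q => [|a p IH] [|b q] //= /andP[hb hq] /orP[ha|h]; last by rewrite IH ?mulr0.
by rewrite vstep_neq ?mul0r //; lia.
Qed.

(** The second identity strengthens the induction: in state [true] a 0 of [x] with [k] ones before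
    it still awaits its counterpart in [y]. Its weight was paid when it was read, hence the factor
    [z]. *)
Lemma eline_vstrip x y k : size x = size y ->
  eline false x y = vstrip (parts k x) (parts k y) /\
  z * eline true x y = vstrip (k :: parts k x) (parts k.+1 y).
Proof.
elim: x y k => [|a x IH] [|b y] //= k; first by rewrite mulr0.
move=> [hs]; have [h0 _] := IH y k hs; have [h1 h1'] := IH y k.+1 hs; have [_ h2] := IH y k hs.
have ge j w : all (leq j) (parts j w) := parts_ge j w.
have e1 : vstep k.+1 k.+1 = 1 by rewrite /vstep eqxx.
have e2 j : vstep j j = 1 by rewrite /vstep eqxx.
have e3 j : vstep j j.+1 = z by rewrite /vstep -[j.+1 == j]negbK neq_ltn ltnSn orbT eqxx.
case: a b => [] [] /=; split; rewrite ?e2 ?e3 ?mul1r ?mulr0 //.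
- by rewrite (@vstrip_gt k) //= leqnn.
- by rewrite (@vstrip_lt k) //= leqnn.
- by rewrite h1.
- by rewrite (@vstrip_gt k) //= leqnn.
- by rewrite h2.
Qed.

Lemma sum_bools_cons n (F : seq bool -> R) :
  \sum_(s <- words bools n.+1) F s =
  \sum_(s <- words bools n) F (false :: s) + \sum_(s <- words bools n) F (true :: s).
Proof.
rewrite (_ : \sum_(s <- words bools n.+1) F s = \sum_(x <- bools) \sum_(s <- words bools n) F (x :: s)).
  by rewrite !big_cons big_nil addr0.
exact: big_allpairs_dep.
Qed.

Lemma sum_labs3 (F : lab -> R) : \sum_(x <- labs) F x = F N_ + F F_ + F T_.
Proof. by rewrite !big_cons big_nil addr0 addrA. Qed.

Lemma line_cons W c x xs y ys c' :
  line W c (x :: xs) (y :: ys) c' = \sum_(c1 <- labs) W c x y c1 * line W c1 xs ys c' :> R.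
Proof. by []. Qed.

Section Lines.
(* abstract names for the weights, so that unification does not evaluate them *)
Variables WR WB : lab -> lab -> lab -> lab -> R.
Hypothesis WRE : forall c x y c', WR c x y c' = wR z c x y c'.
Hypothesis WBE : forall c x y c', WB c x y c' = wB z c x y c'.

(** State [T_] is left only across a label [F_] in [x], and [right_lab] never produces one. *)
Lemma lineR_dead v y : line WR T_ (map right_lab v) y N_ = 0.
Proof.
elim: v y => [|b v IH] [|y0 y] //=.
by rewrite sum_labs3 IH; case: b y0 => [] [[|]|]; rewrite !WRE /wR /= ?mul0r ?mulr0 ?addr0.
Qed.

(** States [N_] and [F_] are the states [false] and [true] of [eline]; they lead to each other, so
    both are treated at once. [F] is arbitrary in order to absorb the first letter in the
    induction. *)
Lemma lineR_bool v (F : seq lab -> R) :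
  (\sum_(y <- words labs (size v)) line WR N_ (map right_lab v) y N_ * F y =
   \sum_(v' <- words bools (size v)) eline false v v' * F (map right_lab v')) /\
  (\sum_(y <- words labs (size v)) line WR F_ (map right_lab v) y N_ * F y =
   \sum_(v' <- words bools (size v)) eline true v v' * F (map right_lab v')).
Proof.
elim: v F => [|b v IH] F; first by split; rewrite /words !big_seq1.
have step c y0 y : line WR c (map right_lab (b :: v)) (y0 :: y) N_ =
   WR c (right_lab b) y0 N_ * line WR N_ (map right_lab v) y N_ +
   WR c (right_lab b) y0 F_ * line WR F_ (map right_lab v) y N_.
  by rewrite line_cons sum_labs3 (lineR_dead v y) mulr0 addr0.
have scale (G : seq lab -> R) (L : seq lab -> R) a :
    \sum_(y <- words labs (size v)) a * L y * G y =
    a * \sum_(y <- words labs (size v)) L y * G y.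
  by rewrite mulr_sumr; apply: eq_bigr => y _; rewrite mulrA.
have scaleb (G : seq bool -> R) (L : seq bool -> R) a :
    \sum_(y <- words bools (size v)) a * L y * G y =
    a * \sum_(y <- words bools (size v)) L y * G y.
  by rewrite mulr_sumr; apply: eq_bigr => y _; rewrite mulrA.
have tail c : \sum_(y <- words labs (size (b :: v))) line WR c (map right_lab (b :: v)) y N_ * F y =
   \sum_(y0 <- labs)
     (WR c (right_lab b) y0 N_ * \sum_(v' <- words bools (size v)) eline false v v' * F (y0 :: map right_lab v') +
      WR c (right_lab b) y0 F_ * \sum_(v' <- words bools (size v)) eline true v v' * F (y0 :: map right_lab v')).
  rewrite sum_words_cons; apply: eq_bigr => y0 _.
  have [<- <-] := IH (fun y => F (y0 :: y)).
  rewrite -!scale -big_split; apply: eq_bigr => y _.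
  by rewrite step mulrDl.
have zs (s : seq (seq bool)) (G : seq bool -> R) : \sum_(y <- s) 0 * G y = 0.
  by rewrite big1 // => y _; rewrite mul0r.
rewrite !tail [size (b :: v)]/=.
split; rewrite sum_bools_cons sum_labs3; case: b {step tail} => /=;
 rewrite !WRE /wR /= ?expr0 ?expr1 ?mul0r ?add0r ?addr0 ?mul1r ?scaleb //;
 rewrite ?zs ?add0r ?addr0 //; exact: addrC.
Qed.

(** Below the puzzle the dead state is [F_]: it is left only when the label under the line is [N_],
    which no letter of [w] gives. *)
Lemma lineB_dead x w : line WB F_ x (map Some w) N_ = 0.
Proof.
elim: x w => [|x0 x IH] [|b w] //=.
by rewrite sum_labs3 IH; case: b x0 => [] [[|]|]; rewrite !WBE /wB /= ?mul0r ?mulr0 ?addr0.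
Qed.

Lemma lineB_bool w (F : seq lab -> R) :
  (\sum_(x <- words labs (size w)) F x * line WB N_ x (map Some w) N_ =
   \sum_(w' <- words bools (size w)) F (map Some w') * eline false w' w) /\
  (\sum_(x <- words labs (size w)) F x * line WB T_ x (map Some w) N_ =
   \sum_(w' <- words bools (size w)) F (map Some w') * eline true w' w).
Proof.
elim: w F => [|b w IH] F; first by split; rewrite /words !big_seq1.
have step c x0 x : line WB c (x0 :: x) (map Some (b :: w)) N_ =
   WB c x0 (Some b) N_ * line WB N_ x (map Some w) N_ +
   WB c x0 (Some b) T_ * line WB T_ x (map Some w) N_.
  by rewrite line_cons sum_labs3 (lineB_dead x w) mulr0 addr0.
have scale (G : seq lab -> R) (L : seq lab -> R) a :
    \sum_(y <- words labs (size w)) G y * (a * L y) =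
    a * \sum_(y <- words labs (size w)) G y * L y.
  by rewrite mulr_sumr; apply: eq_bigr => y _; rewrite mulrCA.
have scaleb (G : seq bool -> R) (L : seq bool -> R) a :
    \sum_(y <- words bools (size w)) G y * (a * L y) =
    a * \sum_(y <- words bools (size w)) G y * L y.
  by rewrite mulr_sumr; apply: eq_bigr => y _; rewrite mulrCA.
have tail c : \sum_(x <- words labs (size (b :: w))) F x * line WB c x (map Some (b :: w)) N_ =
   \sum_(x0 <- labs)
     (WB c x0 (Some b) N_ * \sum_(w' <- words bools (size w)) F (x0 :: map Some w') * eline false w' w +
      WB c x0 (Some b) T_ * \sum_(w' <- words bools (size w)) F (x0 :: map Some w') * eline true w' w).
  rewrite sum_words_cons; apply: eq_bigr => x0 _.
  have [<- <-] := IH (fun x => F (x0 :: x)).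
  rewrite -!scale -big_split; apply: eq_bigr => y _.
  by rewrite step mulrDr.
have zs (s : seq (seq bool)) (G : seq bool -> R) : \sum_(y <- s) G y * 0 = 0.
  by rewrite big1 // => y _; rewrite mulr0.
rewrite !tail [size (b :: w)]/=.
split; rewrite sum_bools_cons sum_labs3; case: b {step tail} => /=;
 rewrite !WBE /wB /= ?expr0 ?expr1 ?mul0r ?add0r ?addr0 ?mul1r ?scaleb //;
 rewrite ?zs ?add0r ?addr0 //; exact: addrC.
Qed.

End Lines.

Lemma sum_words_rev (n : nat) (F : seq lab -> R) :
  \sum_(s <- words labs n) F (rev s) = \sum_(s <- words labs n) F s.
Proof.
rewrite -(big_map rev xpredT); apply: perm_big; apply: uniq_perm.
- by rewrite (map_inj_uniq (can_inj revK)); apply: words_uniq.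
- exact: words_uniq.
move=> s; rewrite -{1}[s]revK (mem_map (can_inj revK)) !mem_words size_rev.
by rewrite all_rev.
Qed.

Theorem exchange_puz u v w : size v = size u -> size w = size u ->
  \sum_(v' <- words bools (size u)) eline false v v' * (puz u v' w)%:R =
  \sum_(w' <- words bools (size u)) (puz u v w')%:R * eline false w' w.
Proof.
move=> hv hw; rewrite -{1}hv -hw.
have [<- _] := lineR_bool (fun _ _ _ _ => erefl) v (fun y => (puzzles (map left_lab u) (rev y) (map Some w))%:R).
have [<- _] := lineB_bool (fun _ _ _ _ => erefl) w (fun x => (puzzles (map left_lab u) (rev (map right_lab v)) x)%:R).
have := @exchange_puzzle R z (map left_lab u) (rev (map right_lab v)) (map Some w) N_.
rewrite size_rev !size_map hw hv => <- //; last by apply/allP => x /mapP[[] _ ->].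
by rewrite -sum_words_rev; apply: eq_bigr => y _; rewrite !revK.
Qed.
End Strip.

(** * Puzzles whose right boundary encodes the empty partition *)

Notation ones := (count id).

Lemma sumn_labs3 (F : lab -> nat) : \sum_(x <- labs) F x = F N_ + F F_ + F T_.
Proof. by rewrite !big_cons big_nil addn0 addnA. Qed.

(* the word above the lowest j rows labelled 1 on the right boundary: the last
   j ones of u have already appeared, the other ones are still labelled N_ *)
Fixpoint partial_word (j : nat) (u : seq bool) : seq lab :=
  if u is b :: u' then
    (if b then (if ones u' < j then T_ else N_) else F_) :: partial_word j u'
  else [::].

Lemma size_partial_word j u : size (partial_word j u) = size u.
Proof. by elim: u => //= b u ->. Qed.

(** With only [N_] and [F_] above and [T_] at the right end, every even vertex is forced to have
    [T_] on its right, so the row is rigid. *)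
Lemma cells_zero x ds :
  [/\ cells T_ (partial_word 0 x) ds T_ = (ds == partial_word 0 x),
      cells N_ (partial_word 0 x) ds T_ = 0 & cells F_ (partial_word 0 x) ds T_ = 0].
Proof.
elim: x ds => [|b x IH] [|d ds] //=.
have [h1 h2 h3] := IH ds; rewrite !sumn_labs3 h1 h2 h3 eqseq_cons.
by case: b d => [] [[|]|] /=; rewrite /cell /= ?muln0 ?mul0n ?addn0 ?add0n ?mul1n.
Qed.

Lemma row_zero b x ds : row (left_lab b) (partial_word 0 x) ds T_ = (ds == partial_word 0 (b :: x)).
Proof.
case: ds => [|d ds] //=; have [h1 h2 h3] := cells_zero x ds.
rewrite sumn_labs3 h1 h2 h3 eqseq_cons.
by case: b d => [] [[|]|] /=; rewrite ?muln0 ?mul0n ?addn0 ?add0n ?mul1n.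
Qed.

(** Rigid as well: the edge to the right of an even vertex is [T_] while more than [j] ones lie
    further right and [N_] afterwards. The switch occurs at the 1 that becomes visible in
    [partial_word j.+1]. *)
Lemma cells_one j x ds :
  [/\ cells N_ (partial_word j x) ds N_ = (ones x <= j) && (ds == partial_word j.+1 x),
      cells T_ (partial_word j x) ds N_ = (j < ones x) && (ds == partial_word j.+1 x) &
      cells F_ (partial_word j x) ds N_ = 0].
Proof.
elim: x ds => [|b x IH] [|d ds] //=; rewrite ?andbF //.
have [h1 h2 h3] := IH ds; rewrite !sumn_labs3 h1 h2 h3 eqseq_cons.
case: b => /=; rewrite ?add1n ?add0n; last first.
  by case: d => [[|]|] /=; rewrite /cell /= ?muln0 ?mul0n ?addn0 ?add0n ?mul1n ?andbF.
rewrite !ltnS; case: (ltngtP (ones x) j) => hj;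
  by case: d => [[|]|] /=; rewrite /cell /= ?muln0 ?mul0n ?addn0 ?add0n ?mul1n ?andbF.
Qed.

Lemma row_one b j x ds : j < ones (b :: x) ->
  row (left_lab b) (partial_word j x) ds N_ = (ds == partial_word j.+1 (b :: x)).
Proof.
case: ds => [|d ds] //=; have [h1 h2 h3] := cells_one j x ds.
rewrite sumn_labs3 h1 h2 h3 eqseq_cons.
case: b => /=; rewrite ?add1n ?add0n => hj; last first.
  by rewrite hj; case: d => [[|]|] /=; rewrite ?muln0 ?mul0n ?addn0 ?add0n ?mul1n.
rewrite !ltnS; case: (leqP (ones x) j) => h;
  by case: d => [[|]|] /=; rewrite ?muln0 ?mul0n ?addn0 ?add0n ?mul1n.
Qed.

Lemma sum_delta_words n (a : seq lab) (F : seq lab -> nat) : size a = n ->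
  \sum_(s <- words labs n) (s == a) * F s = F a.
Proof.
move=> ha; rewrite (bigD1_seq a) /=; last by apply: words_uniq.
  rewrite eqxx mul1n big1 ?addn0 // => s /negPf->; exact: mul0n.
rewrite mem_words ha eqxx; apply/allP => -[[|]|] //.
Qed.

(** The [a] upper rows assemble [u] with all its ones hidden; each of the [j] lower rows reveals one
    more 1, starting from the right. *)
Lemma puzzles_zero_one j a u d : size u = j + a -> j <= ones u ->
  puzzles (map left_lab u) (nseq j N_ ++ nseq a T_) d = (d == partial_word j u).
Proof.
elim: j u d => [|j IH] u d.
  elim: a u d => [|a IHa] [|b u] d //= [hs] _.
  rewrite size_map; under eq_bigr do rewrite IHa //.
  by rewrite sum_delta_words ?size_partial_word // row_zero.
case: u => [|b u] //= [hs] hj.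
have hj' : j <= ones u by move: hj; case: b => //=; rewrite add0n; apply: ltnW.
rewrite size_map; under eq_bigr do rewrite IH //.
by rewrite sum_delta_words ?size_partial_word ?row_one.
Qed.

Lemma partial_word_all u j : ones u <= j -> partial_word j u = map Some u.
Proof.
elim: u => //= b u IH h; rewrite IH; last by apply: leq_trans h; apply: leq_addl.
by case: b h => //=; rewrite add1n => ->.
Qed.

(** The puzzle analogue of multiplying a Schur polynomial by 1. *)
Lemma puz_base u w a b : size u = a + b -> ones u = b ->
  puz u (nseq a false ++ nseq b true) w = (w == u).
Proof.
move=> hs hb; rewrite /puz map_cat !map_nseq rev_cat !rev_nseq.
rewrite puzzles_zero_one ?hb // 1?addnC // partial_word_all ?hb //.
by rewrite (inj_eq (inj_map (@Some_inj _))).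
Qed.

(** * Schur polynomials *)

Local Open Scope ring_scope.

Definition nlists (n B : nat) : seq (seq nat) := words (iota 0 B.+1) n.

Lemma mem_nlists n B s : (s \in nlists n B) = (size s == n) && all (leq^~ B) s.
Proof.
rewrite mem_words; congr andb; apply: eq_all => i.
by rewrite [mem _ _]mem_iota add0n ltnS.
Qed.

Lemma nlists_uniq n B : uniq (nlists n B).
Proof. exact/words_uniq/iota_uniq. Qed.

Section Schur.
Variable R : comNzRingType.
Implicit Types (z x : R) (X : nat -> R).

Lemma sum_nlists_cons n B (F : seq nat -> R) :
  \sum_(s <- nlists n.+1 B) F s = \sum_(0 <= h < B.+1) \sum_(s <- nlists n B) F (h :: s).
Proof. by rewrite /index_iota subn0; exact: big_allpairs_dep. Qed.

Lemma sum_nlists0 B (F : seq nat -> R) : \sum_(s <- nlists 0 B) F s = F [::].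
Proof. exact: big_seq1. Qed.

(* Gelfand-Tsetlin interlacing la_1 >= ka_1 >= la_2 >= ... >= ka_n >= la_(n+1) *)
Fixpoint hstrip x (la ka : seq nat) : R :=
  if la is l :: la' then
    if ka is k :: ka' then
      ((head 0%N la' <= k <= l)%N)%:R * x ^+ (l - k) * hstrip x la' ka'
    else (la' == [::])%:R * x ^+ l
  else 0.

Fixpoint gt_schur X (n : nat) (la : seq nat) : R :=
  match n with
  | 0 => (la == [::])%:R
  | n'.+1 => \sum_(ka <- nlists n' (head 0%N la)) hstrip (X n') la ka * gt_schur X n' ka
  end.

Lemma hstrip_sorted x la ka : ~~ sorted geq la -> hstrip x la ka = 0.
Proof.
elim: la ka => [|l la IH] [|k ka] //=; first by case: la {IH} => // *; rewrite mul0r.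
move=> h; case: (boolP (_ <= k <= l)%N) => [/andP[h1 h2]|]; last by rewrite !mul0r.
rewrite IH ?mulr0 //; apply: contra h; case: la h1 {IH} => //= m la h1 ->.
by rewrite andbT; apply: leq_trans h2.
Qed.

Lemma hstrip_le x la ka B : hstrip x la ka != 0 -> (head 0 la <= B)%N -> all (leq^~ B) ka.
Proof.
elim: la ka => [|l la IH] [|k ka] //=; first by rewrite eqxx.
case: (boolP (_ <= k <= l)%N) => [/andP[h1 h2]|]; last first.
  by rewrite !mul0r eqxx.
rewrite mul1r => h hl; rewrite (leq_trans h2 hl) /=; apply: IH; last exact: leq_trans (leq_trans h1 h2) hl.
by apply: contraNneq h => ->; rewrite mulr0.
Qed.

Lemma hstrip_ka_sorted x la ka : hstrip x la ka != 0 -> sorted geq ka.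
Proof.
elim: la ka => [|l la IH] [|k ka] //=; first by rewrite eqxx.
case: (boolP (_ <= k <= l)%N) => [/andP[h1 h2]|]; last first.
  by rewrite !mul0r eqxx.
rewrite mul1r => h; have h3 : hstrip x la ka != 0 by apply: contraNneq h => ->; rewrite mulr0.
have := IH _ h3; case: ka la h1 h3 {IH h} => [|k2 ka] [|l2 la] //= h1; first by rewrite eqxx.
case: (boolP (_ <= k2 <= l2)%N) => [/andP[_ h4]|]; last by rewrite !mul0r eqxx.
by move=> _ ->; rewrite andbT; apply: leq_trans h4 h1.
Qed.

Lemma gt_schur_sorted X n la : ~~ sorted geq la -> gt_schur X n la = 0.
Proof.
case: n => [|n] h /=; first by case: la h.
by rewrite big1 // => ka _; rewrite hstrip_sorted ?mul0r.
Qed.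

(** A bound [B] independent of the shape allows sums over shapes to be interchanged. *)
Lemma gt_schurS X n la B : (head 0 la <= B)%N ->
  gt_schur X n.+1 la = \sum_(ka <- nlists n B) hstrip (X n) la ka * gt_schur X n ka.
Proof.
move=> hB /=; rewrite [RHS](bigID (mem (nlists n (head 0%N la)))) /= addrC.
rewrite [X in X + _]big1_seq => [|ka /andP[]]; last first.
  rewrite !mem_nlists => h /andP[hs _]; rewrite hs /= in h.
  have [->|h0] := eqVneq (hstrip (X n) la ka) 0; first by rewrite mul0r.
  by rewrite (hstrip_le h0) in h.
rewrite add0r -[RHS]big_filter; apply: perm_big; apply: uniq_perm.
- exact: nlists_uniq.
- exact/filter_uniq/nlists_uniq.
move=> ka; rewrite mem_filter; apply/idP/idP => [h|/andP[] //].
apply/andP; split=> //; move: h; rewrite !mem_nlists => /andP[-> h] /=.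
by apply: sub_all h => i hi; exact: leq_trans hi hB.
Qed.

(* the two orders of composing a vertical and a horizontal strip; [k0] bounds the
   first part of [la] so that [pieri_step] can be proved by induction on [mu] *)
Definition lsum z x B k0 mu ka : R :=
  \sum_(la <- nlists (size mu) B) ((head 0 la <= k0)%N)%:R * vstrip z mu la * hstrip x la ka.
Definition csum z x B mu ka : R :=
  \sum_(rh <- nlists (size ka) B) hstrip x mu rh * vstrip z rh ka.

Lemma sum_nat_at B (F : nat -> R) (a : nat) : (a <= B)%N ->
  (forall h, h != a -> F h = 0) -> \sum_(0 <= h < B.+1) F h = F a.
Proof.
move=> ha h; rewrite (bigD1_seq a) ?iota_uniq ?mem_index_iota ?ltnS //= big1 ?addr0 //.
Qed.

Lemma vstepE z a h : vstep z a h = (h == a)%:R + (h == a.+1)%:R * z.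
Proof.
rewrite /vstep; have [->|] := eqVneq h a; last by move=> _ /=; case: (h == _); rewrite ?mul1r ?mul0r ?add0r.
by rewrite (_ : (a == a.+1) = false) ?mul0r ?addr0 //; lia.
Qed.

Lemma vstep_suml z B (F : nat -> R) (a : nat) : (a < B)%N ->
  \sum_(0 <= h < B.+1) vstep z a h * F h = F a + z * F a.+1.
Proof.
move=> ha; under eq_bigr do rewrite vstepE mulrDl.
rewrite big_split /= (@sum_nat_at _ _ a (ltnW ha)) => [|h /negPf->]; last by rewrite mul0r.
rewrite (@sum_nat_at _ _ a.+1) // => [|h /negPf->]; last by rewrite !mul0r.
by rewrite !eqxx !mul1r.
Qed.

Lemma vstep_sumr z B (F : nat -> R) (a : nat) : (a <= B)%N ->
  \sum_(0 <= h < B.+1) F h * vstep z h a = F a + (0 < a)%N%:R * (z * F a.-1).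
Proof.
move=> ha; under eq_bigr do rewrite vstepE mulrDr.
rewrite big_split /= (@sum_nat_at _ _ a) // => [|h]; last by rewrite eq_sym => /negPf->; rewrite mulr0.
rewrite eqxx mulr1; congr (_ + _); case: a ha => [|a] ha.
  by rewrite big1 ?mul0r // => h _; rewrite mul0r mulr0.
rewrite (@sum_nat_at _ _ a (ltnW ha)) => [|h]; last first.
  by rewrite eqSS eq_sym => /negPf->; rewrite mul0r mulr0.
by rewrite eqxx !mul1r mulrC.
Qed.

(** The share of one row in [pieri_step]: the factor [1 + x * z] travels from the rows below, where
    it is guarded by [m2 < k1], to the present row, where the guard is [m1 < k0]. *)
Lemma pieri_scalar z x k0 m1 m2 k1 : (m2 <= k1 <= k0)%N -> (m2 <= m1 <= k0)%N ->
  (((m1 <= k0)%N && (k1 <= m1)%N)%:R * x ^+ (m1 - k1) +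
     z * (((m1.+1 <= k0)%N && (k1 <= m1.+1)%N)%:R * x ^+ (m1.+1 - k1))) *
    (1 + (m2 < k1)%N%:R * (x * z)) =
  (1 + (m1 < k0)%N%:R * (x * z)) *
  ((m2 <= k1 <= m1)%N%:R * x ^+ (m1 - k1) +
     (0 < k1)%N%:R * (z * ((m2 <= k1.-1 <= m1)%N%:R * x ^+ (m1 - k1.-1)))).
Proof.
move=> /andP[h1 h2] /andP[h3 h4]; rewrite h4 h1 /=.
have [h5|h5|h5] := ltngtP m1.+1 k1.
- have -> : (k1 <= m1)%N = false by lia.
  have -> : (k1.-1 <= m1)%N = false by lia.
  by rewrite !andbF !mul0r !mulr0 !addr0 !mul0r mulr0.
- rewrite ltnS in h5; have e : (m1.+1 - k1 = (m1 - k1).+1)%N by lia.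
  rewrite ?h5 ?(leq_trans h5 (leqnSn _)) ?andbT e exprS.
  case: k1 h1 h2 h5 e => [|k1] h1 h2 h5 e.
    by rewrite ltn0 /= !mul0r !addr0 !mul1r; ring.
  rewrite ltnS /= (ltnW h5) andbT.
  have -> : (m1 - k1 = (m1 - k1.+1).+1)%N by lia.
  by rewrite exprS; ring.
rewrite -h5 /= leqnn subnn h3 ltnS h3 /= expr0.
have -> : (m1 < m1)%N = false by lia.
have h6 : (m1 < k0)%N by rewrite h5.
by rewrite h6 /= subnn expr0; ring.
Qed.

(** Adding a vertical strip and removing a horizontal one commute up to [1 + x * z], the
    contribution of one variable to the Pieri rule. The strict bound on [head 0 mu] leaves room to
    lengthen the first row. *)
Lemma pieri_step z x B k0 mu ka : (head 0 mu <= k0)%N -> (head 0 ka <= k0)%N ->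
  (head 0 mu < B)%N -> (head 0 ka <= B)%N -> (k0 <= B)%N ->
  sorted geq mu -> sorted geq ka -> size mu = (size ka).+1 ->
  lsum z x B k0 mu ka = (1 + (head 0 mu < k0)%N%:R * (x * z)) * csum z x B mu ka.
Proof.
rewrite /lsum /csum; elim: ka mu k0 => [|k1 ka IH] [|m1 mu] //= k0 h1 h2 h3 h4 h5 smu ska [hs].
  move: hs => /size0nil-> {mu smu}; rewrite sum_nlists0 /= mul1r mulr1.
  rewrite sum_nlists_cons; under eq_bigr do rewrite sum_nlists0 /= mul1r mulr1 mulrAC.
  under eq_bigr do rewrite mulrC.
  rewrite vstep_suml // h1 !mul1r; case: ltnP => h6; rewrite exprS; ring.
case: mu hs smu => [|m2 mu] //= [hs] /andP[h6 smu].
have -> : \sum_(la <- nlists (size mu).+2 B) ((head 0 la <= k0)%N)%:R *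
    vstrip z [:: m1, m2 & mu] la * hstrip x la (k1 :: ka) =
  (\sum_(0 <= h < B.+1) vstep z m1 h * (((h <= k0)%N && (k1 <= h)%N)%:R * x ^+ (h - k1))) *
  \sum_(la <- nlists (size (m2 :: mu)) B)
     ((head 0 la <= k1)%N)%:R * vstrip z (m2 :: mu) la * hstrip x la ka.
  rewrite sum_nlists_cons mulr_suml; apply: eq_bigr => h _.
  rewrite mulr_sumr; apply: eq_bigr => la _ /=.
  by rewrite -!mulnb !natrM; ring.
have -> : \sum_(rh <- nlists (size ka).+1 B) hstrip x [:: m1, m2 & mu] rh * vstrip z rh (k1 :: ka) =
  (\sum_(0 <= h < B.+1) (((m2 <= h <= m1)%N)%:R * x ^+ (m1 - h)) * vstep z h k1) *
  \sum_(rh <- nlists (size ka) B) hstrip x (m2 :: mu) rh * vstrip z rh ka.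
  rewrite sum_nlists_cons mulr_suml; apply: eq_bigr => h _.
  rewrite mulr_sumr; apply: eq_bigr => la _ /=; ring.
rewrite vstep_suml // vstep_sumr //.
(* If [k1 < m2] both sides vanish: the second part of [la] and the first part of [rh] would have to
   be at least [m2] and at most [k1]. *)
case: (leqP m2 k1) => h7; last first.
  rewrite [X in _ * X = _]big1 => [|la _]; last first.
    case: la => [|l la] /=; first by rewrite !mulr0.
    have [h8|h8] := leqP l k1; last by rewrite /= !mul0r.
    by rewrite vstep_neq ?mul0r ?mulr0 ?mul0r //; lia.
  have -> : (m2 <= k1.-1)%N = false by lia.
  by rewrite !mul0r !mulr0 !addr0 mul0r mulr0.
have ska' : (head 0 ka <= k1)%N by case: ka ska {IH hs} => //= k2 ka /andP[].
have ska2 : sorted geq ka by apply: path_sorted ska.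
rewrite IH //=; try lia.
by rewrite [LHS]mulrA pieri_scalar ?h2 ?h7 ?h6 ?mulrA.
Qed.

(** The Pieri rules for all [e_k] in one generating function, by induction on the number of
    variables: [pieri_step] splits off the factor of the last one. *)
Theorem pieri X z n mu B : size mu = n -> sorted geq mu -> (head 0 mu < B)%N ->
  \sum_(la <- nlists n B) vstrip z mu la * gt_schur X n la =
  \prod_(i < n) (1 + X i * z) * gt_schur X n mu.
Proof.
elim: n mu B => [|n IH] mu B hs smu hB.
  by rewrite sum_nlists0 big_ord0 mul1r; move: hs => /size0nil->; rewrite /= mul1r.
transitivity (\sum_(ka <- nlists n B) lsum z (X n) B B mu ka * gt_schur X n ka).
  rewrite /lsum hs; under [RHS]eq_bigr do rewrite mulr_suml.
  rewrite exchange_big /= big_seq [RHS]big_seq; apply: eq_bigr => la.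
  rewrite mem_nlists => /andP[/eqP hla ala].
  have hl : (head 0 la <= B)%N by case: la hla ala => //= l la _ /andP[].
  rewrite -/(gt_schur X n.+1 la) (gt_schurS _ _ hl) mulr_sumr; apply: eq_bigr => ka _.
  by rewrite hl mul1r mulrA.
transitivity (\sum_(ka <- nlists n B) (1 + X n * z) * (csum z (X n) B mu ka * gt_schur X n ka)).
  rewrite big_seq [RHS]big_seq; apply: eq_bigr => ka.
  rewrite mem_nlists => /andP[/eqP hka aka].
  have [ska|/(gt_schur_sorted X n)->] := boolP (sorted geq ka); last by rewrite !mulr0.
  have hk : (head 0 ka <= B)%N by case: ka hka aka {ska} => //= k ka _ /andP[].
  by rewrite pieri_step ?hka ?(ltnW hB) // hB mul1r mulrA.
rewrite -mulr_sumr big_ord_recr /= -mulrA mulrCA; congr (_ * _).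
rewrite -/(gt_schur X n.+1 mu) (gt_schurS _ _ (ltnW hB)).
transitivity (\sum_(rh <- nlists n B) hstrip (X n) mu rh *
    \sum_(ka <- nlists n B) vstrip z rh ka * gt_schur X n ka).
  under [RHS]eq_bigr do rewrite mulr_sumr.
  rewrite [RHS]exchange_big /= big_seq [RHS]big_seq; apply: eq_bigr => ka.
  rewrite mem_nlists => /andP[/eqP hka _].
  rewrite /csum hka mulr_suml; apply: eq_bigr => rh _; by rewrite mulrA.
rewrite mulr_sumr big_seq [RHS]big_seq; apply: eq_bigr => rh.
rewrite mem_nlists => /andP[/eqP hrh arh].
have [->|h0] := eqVneq (hstrip (X n) mu rh) 0; first by rewrite !mul0r mulr0.
rewrite IH //; first by rewrite mulrCA.
  exact: hstrip_ka_sorted h0.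
apply: leq_ltn_trans hB; have := hstrip_le h0 (leqnn _).
by case: (rh) => //= r rh' /andP[].
Qed.

End Schur.

(** * Linear independence of Schur polynomials *)

Lemma gt_schur_morph (R S : comNzRingType) (f : {rmorphism R -> S}) X n la :
  f (gt_schur X n la) = gt_schur (f \o X) n la.
Proof.
have hst x la' ka : f (hstrip x la' ka) = hstrip (f x) la' ka.
  elim: la' ka => [|l la' IH] [|k ka] /=; rewrite ?rmorph0 //.
    by rewrite rmorphM rmorphXn /= rmorph_nat.
  by rewrite !rmorphM rmorph_nat rmorphXn IH.
elim: n la => [|n IH] la /=; first by case: (la == _); rewrite ?rmorph1 ?rmorph0.
by rewrite rmorph_sum; apply: eq_bigr => ka _; rewrite rmorphM hst IH.
Qed.

(* exponent of the lowest-degree term of a Schur polynomial after the Kronecker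
   substitution [X_i := T ^ (B ^ i)]; it determines [la] *)
Fixpoint low_deg (B : nat) (la : seq nat) (i : nat) : nat :=
  if la is l :: la' then (l * B ^ i + low_deg B la' i.+1)%N else 0%N.

Lemma low_deg_rcons B la l i : low_deg B (rcons la l) i = (low_deg B la i + l * B ^ (i + size la))%N.
Proof.
elim: la i => [|a la IH] i /=; first by rewrite !addn0.
by rewrite IH addSnnS addnA.
Qed.

Lemma low_deg_le B la i : all (ltn^~ B) la ->
  (low_deg B la i + B ^ i <= B ^ (i + size la))%N.
Proof.
elim: la i => [|a la IH] i /=; first by rewrite addn0.
move=> /andP[ha hla]; have := IH i.+1 hla; rewrite addSnnS; apply: leq_trans.
have h2 : (a * B ^ i + B ^ i <= B * B ^ i)%N by rewrite -mulSnr leq_mul2r ha orbT.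
by rewrite expnS addnAC addnC leq_add2l.
Qed.

Lemma low_degS B la i : low_deg B la i.+1 = (B * low_deg B la i)%N.
Proof.
elim: la i => [|a la IH] i /=; first by rewrite muln0.
by rewrite IH expnS mulnDr mulnCA.
Qed.

(** [low_deg B la 0] is the integer whose base-[B] digits are the parts of [la]. *)
Lemma low_deg_inj B la mu : size la = size mu -> all (ltn^~ B) la -> all (ltn^~ B) mu ->
  low_deg B la 0 = low_deg B mu 0 -> la = mu.
Proof.
elim: la mu => [|a la IH] [|b mu] //= [hs] /andP[ha hla] /andP[hb hmu].
rewrite !low_degS !expn0 !muln1 => h.
have B0 : (0 < B)%N by apply: leq_ltn_trans ha.
have e : a = b.
  by have := congr1 (modn^~ B) h; rewrite !(addnC _ (B * _)%N) !(mulnC B) !modnMDl !modn_small.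
congr (_ :: _) => //; apply: IH => //; move/eqP: h; rewrite e eqn_add2l eqn_pmul2l //.
by move=> /eqP.
Qed.

(** A strip leading to a shape with one row fewer contains the whole last row, and nothing else only
    if [ka = la]. So the last variable attains its least exponent in a single way. *)
Lemma hstrip_rcons (R : comNzRingType) (x : R) la l ka :
  [\/ hstrip x (rcons la l) ka = 0,
      ka = la /\ hstrip x (rcons la l) ka = x ^+ l |
      exists2 e, (l < e)%N & hstrip x (rcons la l) ka = x ^+ e].
Proof.
elim: la ka => [|a la IH] [|k ka] /=.
- by apply: Or32; rewrite mul1r.
- by apply: Or31; rewrite mulr0.
- by apply: Or31; rewrite -size_eq0 size_rcons mul0r.
case: (boolP (_ <= k <= a)%N) => [/andP[_ hk]|_]; last by apply: Or31; rewrite !mul0r.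
rewrite mul1r; case: (IH ka) => [->|[-> ->]|[e he ->]]; first by apply: Or31; rewrite mulr0.
  have [->|h] := eqVneq k a; first by apply: Or32; rewrite subnn mul1r.
  by apply: Or33; exists (a - k + l)%N; rewrite ?exprD //; lia.
by apply: Or33; exists (a - k + e)%N; rewrite ?exprD //; lia.
Qed.

Definition kron (B i : nat) : {poly int} := 'X^(B ^ i).

Lemma hstrip_self (R : comNzRingType) (x : R) la l : sorted geq (rcons la l) ->
  hstrip x (rcons la l) la = x ^+ l.
Proof.
elim: la => [|a la IH] /=; first by rewrite mul1r.
move=> h; have h1 : (head 0 (rcons la l) <= a)%N by case: la h {IH} => [|b la] /= /andP[].
by rewrite h1 leqnn subnn !mul1r IH //; apply: path_sorted h.
Qed.

Lemma gt_schur_low_coef B n la m : size la = n -> sorted geq la -> all (ltn^~ B) la ->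
  (m <= low_deg B la 0)%N -> (gt_schur (kron B) n la)`_m = (m == low_deg B la 0)%:R.
Proof.
elim: n la m => [|n IH] la m; first by move=> /size0nil-> /= _ _; rewrite leqn0 => /eqP->; rewrite coefC.
case/lastP: la => [|la l]; rewrite ?size_rcons // => -[hs] hsort.
rewrite all_rcons low_deg_rcons add0n hs => /andP[hl hla] hm; rewrite /= in hl.
have sla : sorted geq la by apply: subseq_sorted hsort; [exact: rev_trans leq_trans | exact: subseq_rcons].
have hlow := low_deg_le 0 hla; rewrite add0n hs expn0 addn1 in hlow.
have hhd : (head 0 (rcons la l) <= B)%N by case: la hla {hs hsort hm sla hlow} => [_|a la /andP[ha _]] /=; apply: ltnW.
have hin : la \in nlists n B.
  by rewrite mem_nlists hs eqxx; apply: sub_all hla => i; apply: ltnW.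
rewrite (gt_schurS _ _ hhd) coef_sum (bigD1_seq la hin (nlists_uniq _ _)) /=.
rewrite hstrip_self // -exprM mulrC coefMXn big1 => [|ka hka]; last first.
  case: (hstrip_rcons (kron B n) la l ka) => [->|[e]|[e he ->]]; first by rewrite mul0r coef0.
    by rewrite e eqxx in hka.
  (* By [low_deg_le] the contribution of [la] is less than [B ^ n], so an exponent [e > l] of the
     last variable already brings the degree above [m]. *)
  rewrite -exprM mulrC coefMXn ifT //; nia.
rewrite addr0; case: ltnP => h; first by rewrite (_ : (m == _) = false) //; lia.
by rewrite IH //; [congr (_%:R); lia | lia].
Qed.

(** Among the shapes with nonzero coefficient, the one of least [low_deg] has a lowest term that no
    other shape can cancel. *)
Lemma gt_schur_indep n (s : seq (seq nat)) (d : seq nat -> int) (B : nat) : uniq s ->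
  (forall la, la \in s -> [&& size la == n, sorted geq la & all (ltn^~ B) la]) ->
  \sum_(la <- s) d la *: gt_schur (kron B) n la = 0 -> forall la, la \in s -> d la = 0.
Proof.
move=> us hs h0 la hla; apply/eqP/negPn/negP => hd.
pose P k := has (fun mu => (d mu != 0) && (low_deg B mu 0 == k)) s.
have exP : exists k, P k by exists (low_deg B la 0); apply/hasP; exists la; rewrite ?hd ?eqxx.
case: (ex_minnP exP) => k /hasP[mu hmu /andP[dmu /eqP kmu]] kmin.
have /and3P[/eqP hmu1 hmu2 hmu3] := hs mu hmu.
have := congr1 (fun p : {poly int} => p`_k) h0; rewrite coef0 coef_sum (bigD1_seq mu) //=.
rewrite coefZ gt_schur_low_coef ?kmu // eqxx mulr1 big1_seq ?addr0; first by move/eqP: dmu.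
move=> nu /andP[hnu hnu2]; have /and3P[/eqP h1 h2 h3] := hs nu hnu2.
have [->|dnu] := eqVneq (d nu) 0; first by rewrite scale0r coef0.
have hk : (k <= low_deg B nu 0)%N by apply: kmin; apply/hasP; exists nu; rewrite ?dnu ?eqxx.
rewrite coefZ gt_schur_low_coef //; case: eqP => [e|_]; last by rewrite mulr0.
by case/negP: hnu; apply/eqP; apply: (@low_deg_inj B); rewrite ?h1 ?hmu1 // -e kmu.
Qed.

Local Close Scope ring_scope.

(** * Gelfand-Tsetlin patterns and semistandard tableaux *)

Fixpoint interlace (la ka : seq nat) : bool :=
  if la is l :: la' then
    if ka is k :: ka' then (head 0 la' <= k <= l) && interlace la' ka' else la' == [::]
  else false.

Lemma interlace_sumn la ka : interlace la ka -> sumn ka <= sumn la.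
Proof.
elim: la ka => [|l la IH] [|k ka] //= /andP[/andP[_ h1] /IH h2].
exact: leq_add.
Qed.

Lemma hstripE (R : comNzRingType) (x : R) la ka :
  hstrip x la ka = ((interlace la ka)%:R * x ^+ (sumn la - sumn ka))%R.
Proof.
elim: la ka => [|l la IH] [|k ka] //=; rewrite ?mul0r //.
  by case: la {IH} => [|m la] /=; rewrite ?mul0r // addn0 subn0.
rewrite IH; case: (boolP (_ <= k <= l)) => [/andP[_ h1]|] /=; last by rewrite !mul0r.
case: (boolP (interlace la ka)) => [/interlace_sumn h2|] /=; last by rewrite !mul0r mulr0.
by rewrite !mul1r -exprD; congr (x ^+ _)%R; lia.
Qed.

Lemma interlaceP la ka : reflect (size la = (size ka).+1 /\
    forall i, i < size ka -> nth 0 la i.+1 <= nth 0 ka i <= nth 0 la i) (interlace la ka).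
Proof.
elim: la ka => [|l la IH] [|k ka] /=.
- by constructor=> -[].
- by constructor=> -[].
- apply: (iffP eqP) => [->|[[/size0nil]]] //.
apply: (iffP andP) => [[h1 /IH[h2 h3]]|[[h2] h3]].
  split; first by rewrite h2.
  by case=> [|i] //=; rewrite ?nth0 //; apply: h3.
split; first by have := h3 0 isT; rewrite /= nth0.
by apply/IH; split=> // i hi; apply: (h3 i.+1).
Qed.

(** A tableau as a function on all pairs, 0 outside the shape, so that tableaux of different shapes
    can be compared. *)
Definition ssyt_fun (k : nat) (la : seq nat) (f : nat -> nat -> nat) : Prop :=
  forall i j, [/\ (0 < f i j) = in_shape la i j, f i j <= k,
    in_shape la i j.+1 -> f i j <= f i j.+1 & in_shape la i.+1 j -> f i j < f i.+1 j].

Lemma nth_sorted la i j : sorted geq la -> i <= j -> nth 0 la j <= nth 0 la i.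
Proof.
move=> h hij; case: (ltnP j (size la)) => hj; last by rewrite (nth_default 0 hj).
have tr : transitive geq by exact: rev_trans leq_trans.
have rf : reflexive geq by exact: leqnn.
by apply: (sorted_leq_nth tr rf 0 h) => //; rewrite inE; apply: leq_ltn_trans hj.
Qed.

Lemma in_shape_up la i j : sorted geq la -> in_shape la i.+1 j -> in_shape la i j.
Proof.
rewrite /in_shape => h /andP[h1 h2]; rewrite (ltnW h1) /=.
exact: leq_trans h2 (nth_sorted h (leqnSn i)).
Qed.

Lemma in_shape_left la i j : in_shape la i j.+1 -> in_shape la i j.
Proof. by rewrite /in_shape => /andP[-> /ltnW]. Qed.

(** Columns increase strictly. Hence entries at most [n] occupy only the first [n] rows, which is
    why [subshape] may have length [n]. *)
Lemma ssyt_fun_ge k la f i j : sorted geq la -> ssyt_fun k la f -> in_shape la i j -> i < f i j.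
Proof.
move=> sla hf; elim: i => [|i IH] h; first by have [-> _ _ _] := hf 0 j.
by have [_ _ _ /(_ h)] := hf i j; apply: leq_ltn_trans; apply/IH/in_shape_up.
Qed.

Lemma ssyt_fun_row k la f i j j' : ssyt_fun k la f -> in_shape la i j' -> j <= j' -> f i j <= f i j'.
Proof.
move=> hf; elim: j' => [|j' IH] h; first by rewrite leqn0 => /eqP->.
rewrite leq_eqVlt ltnS => /orP[/eqP-> //|h2].
have [_ _ /(_ h) h3 _] := hf i j'; apply: leq_trans h3; apply: IH => //.
exact: in_shape_left h.
Qed.

(** If no entry of a row exceeds [n], [find] returns the full row length, as it should. *)
Definition subshape (n : nat) (la : seq nat) (f : nat -> nat -> nat) : seq nat :=
  mkseq (fun i => find (fun j => n < f i j) (iota 0 (nth 0 la i))) n.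

Definition fun_restr n (f : nat -> nat -> nat) i j := if f i j <= n then f i j else 0.
Definition fun_ext n la ka (f : nat -> nat -> nat) i j :=
  if in_shape la i j && ~~ in_shape ka i j then n.+1 else f i j.

Lemma in_subshape n la f i j : sorted geq la -> size la = n.+1 -> ssyt_fun n.+1 la f ->
  in_shape (subshape n la f) i j = (0 < f i j <= n).
Proof.
move=> sla hs hf; have [-> _ _ _] := hf i j; rewrite {1}/in_shape size_mkseq.
have [hi|hi] := ltnP i n; last first.
  symmetry; apply/negP => /andP[h1 h2]; have := ssyt_fun_ge sla hf h1; lia.
rewrite nth_mkseq //=; set k := find _ _.
have hk : k <= nth 0 la i by have := find_size (fun j => n < f i j) (iota 0 (nth 0 la i)); rewrite size_iota.
rewrite /in_shape hs (leq_trans hi (leqnSn n)) /=.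
have [hj|hj] := ltnP j k.
  rewrite (leq_trans hj hk) /=; have := before_find 0 hj.
  by rewrite nth_iota ?(leq_trans hj hk) // add0n => h; rewrite leqNgt h.
have [hj2|//] := ltnP j (nth 0 la i); symmetry; apply/negbTE; rewrite -ltnNge.
have hk2 : k < nth 0 la i by apply: leq_ltn_trans hj2.
have : has (fun j => n < f i j) (iota 0 (nth 0 la i)) by rewrite has_find size_iota.
move/(nth_find 0); rewrite -/k nth_iota // add0n => /leq_trans; apply.
apply: ssyt_fun_row hf _ hj; by rewrite /in_shape hs (leq_trans hi (leqnSn n)).
Qed.

(** The entries [n.+1] form a horizontal strip: an entry with another one below it is at most [n]
    and survives the erasure. *)
Lemma subshape_interlace n la f : sorted geq la -> size la = n.+1 -> ssyt_fun n.+1 la f ->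
  interlace la (subshape n la f).
Proof.
move=> sla hs hf; apply/interlaceP; rewrite size_mkseq hs; split=> // i hi.
rewrite nth_mkseq //; set k := find _ _.
have hk : k <= nth 0 la i by have := find_size (fun j => n < f i j) (iota 0 (nth 0 la i)); rewrite size_iota.
rewrite hk andbT leqNgt; apply/negP => h.
have h1 : in_shape la i.+1 k by rewrite /in_shape hs ltnS hi.
have [_ _ _ /(_ h1) h2] := hf i k; have [_ h3 _ _] := hf i.+1 k.
have : in_shape (subshape n la f) i k.
  by rewrite in_subshape //; have [-> _ _ _] := hf i k; rewrite (in_shape_up sla h1) /=; lia.
by rewrite /in_shape nth_mkseq // -/k ltnn andbF.
Qed.

Lemma fun_restr_ssyt n la f : sorted geq la -> size la = n.+1 -> ssyt_fun n.+1 la f ->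
  ssyt_fun n (subshape n la f) (fun_restr n f).
Proof.
move=> sla hs hf i j; rewrite !in_subshape // /fun_restr.
have [a1 a2 a3 a4] := hf i j; have [b1 _ _ _] := hf i j.+1; have [c1 _ _ _] := hf i.+1 j.
split; first by case: (leqP (f i j) n) => //; rewrite ?andbT ?andbF.
- by case: (leqP (f i j) n).
- by move=> /andP[h1 h2]; rewrite h2; case: (leqP (f i j) n) => // _; apply: a3; rewrite -b1.
- move=> /andP[h1 h2]; rewrite h2; have h3 : in_shape la i.+1 j by rewrite -c1.
  by have := a4 h3; case: (leqP (f i j) n) => // h4 h5; lia.
Qed.

Lemma interlace_in_shape la ka i j : interlace la ka -> in_shape ka i j -> in_shape la i j.
Proof.
move=> /interlaceP[hs h]; rewrite /in_shape hs => /andP[hi hj].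
by have /andP[_ h2] := h i hi; rewrite ltnS (ltnW hi) (leq_trans hj h2).
Qed.

Lemma fun_ext_ssyt n la ka f : sorted geq la -> size la = n.+1 -> interlace la ka ->
  ssyt_fun n ka f -> ssyt_fun n.+1 la (fun_ext n la ka f).
Proof.
move=> sla hs hil hf i j; have /interlaceP[hs2 hil2] := hil; rewrite /fun_ext.
have [a1 a2 a3 a4] := hf i j; have [b1 b2 _ _] := hf i j.+1; have [c1 c2 _ _] := hf i.+1 j.
have sub i' j' := @interlace_in_shape la ka i' j' hil.
split.
- case: (boolP (in_shape la i j)) => /= h; case: (boolP (in_shape ka i j)) => /= h2 //.
    by rewrite a1 h2.
  by rewrite (sub _ _ h2) in h.
  by rewrite a1 (negPf h2).
- by case: ifP => // _; apply: leq_trans a2 _.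
- move=> h; rewrite h (in_shape_left h) /=; case: (boolP (in_shape ka i j.+1)) => h2 /=.
    by rewrite (in_shape_left h2) /= a3.
  by case: ifP => // _; apply: leq_trans a2 _.
- move=> h; rewrite h (in_shape_up sla h) /=; case: (boolP (in_shape ka i.+1 j)) => h2 /=.
    have -> : in_shape ka i j; last by rewrite /= a4.
    rewrite /in_shape; move: h2 => /andP[h3 h4]; rewrite (ltnW h3) /=.
    have /andP[_ h5] := hil2 _ h3; have /andP[h6 _] := hil2 i (ltnW h3).
    exact: leq_trans h4 (leq_trans h5 h6).
  have -> : in_shape ka i j; last by rewrite /= ltnS.
  move: h => /andP[h3 h4]; have hi : i < size ka by rewrite -ltnS -hs2.
  by rewrite /in_shape hi; have /andP[h6 _] := hil2 _ hi; apply: leq_trans h6.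
Qed.

Section Matrices.
Variables A Bd M : nat.
(** One finite type for all shapes in an [A] by [Bd] box and all entries up to [M]. The type
    [filling n la] changes with [n] and [la], both of which vary in the induction. *)
Definition mat := {ffun 'I_A * 'I_Bd -> 'I_M.+1}.
Implicit Types (G : mat) (f : nat -> nat -> nat).

Definition mfun G i j : nat :=
  if insub i is Some i' then if insub j is Some j' then val (G (i', j')) else 0 else 0.
Definition mk f : mat := [ffun p : 'I_A * 'I_Bd => inord (f p.1 p.2)].

Lemma mfun_ord G (i : 'I_A) (j : 'I_Bd) : mfun G i j = G (i, j).
Proof. by rewrite /mfun !valK. Qed.

Lemma mfun_out G i j : ~~ ((i < A) && (j < Bd)) -> mfun G i j = 0.
Proof.
rewrite /mfun; case: insubP => [i' hi _|//]; rewrite hi /=.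
by case: insubP => // j' ->.
Qed.

Lemma mfun_mk f i j : (forall i j, f i j <= M) ->
  (forall i j, ~~ ((i < A) && (j < Bd)) -> f i j = 0) -> mfun (mk f) i j = f i j.
Proof.
move=> h1 h2; have [/andP[hi hj]|h] := boolP ((i < A) && (j < Bd)); last first.
  by rewrite mfun_out // h2.
by rewrite -[i]/(val (Ordinal hi)) -[j]/(val (Ordinal hj)) mfun_ord ffunE inordK // ltnS.
Qed.

Lemma mfun_le G i j : mfun G i j <= M.
Proof. by rewrite /mfun; case: insub => // i'; case: insub => // j'; rewrite -ltnS; exact: ltn_ord. Qed.

Definition ssyt_mat (k : nat) (la : seq nat) G : bool :=
  [forall i : 'I_A, forall j : 'I_Bd, [&& (0 < mfun G i j) == in_shape la i j, mfun G i j <= k,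
    in_shape la i j.+1 ==> (mfun G i j <= mfun G i j.+1) &
    in_shape la i.+1 j ==> (mfun G i j < mfun G i.+1 j)]].

Definition fits (la : seq nat) := [&& sorted geq la, size la <= A & head 0 la <= Bd].

Lemma fits_shape la i j : fits la -> in_shape la i j -> (i < A) && (j < Bd).
Proof.
move=> /and3P[h1 h2 h3] /andP[h4 h5]; rewrite (leq_trans h4 h2) /=.
apply: leq_trans h3; rewrite -nth0; apply: leq_trans h5 _; exact: nth_sorted.
Qed.

Lemma ssyt_matP k la G : fits la -> reflect (ssyt_fun k la (mfun G)) (ssyt_mat k la G).
Proof.
move=> hla; apply: (iffP idP) => [h i j|h]; last first.
  apply/forallP => i; apply/forallP => j; have [-> -> h3 h4] := h i j; rewrite eqxx /=.
  by apply/andP; split; apply/implyP.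
have [/andP[hi hj]|hn] := boolP ((i < A) && (j < Bd)).
  have := forallP (forallP h (Ordinal hi)) (Ordinal hj) => /= /and4P[/eqP-> -> h3 h4].
  by split=> //; apply/implyP.
have h0 : in_shape la i j = false by apply: contraNF hn; exact: fits_shape.
rewrite mfun_out // h0; split=> // h5; have /and3P[sla _ _] := hla.
by have := in_shape_up sla h5; rewrite h0.
Qed.

Lemma sum_in_shape la : size la <= A -> all (leq^~ Bd) la ->
  \sum_(p : 'I_A * 'I_Bd) in_shape la p.1 p.2 = sumn la.
Proof.
move=> hs ha; rewrite -(pair_bigA _ (fun (i : 'I_A) (j : 'I_Bd) => in_shape la i j : nat)) /=.
transitivity (\sum_(i < A) nth 0 la i).
  apply: eq_bigr => i _; rewrite /in_shape; case: ltnP => hi /=; last first.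
    by rewrite nth_default // big1.
  have hb : nth 0 la i <= Bd by apply: (allP ha); apply: mem_nth.
  rewrite -(big_mkord xpredT (fun j => (j < nth 0 la i) : nat)) (big_cat_nat (leq0n _) hb) //=.
  rewrite [X in _ + X]big_nat_cond [X in _ + X]big1 => [|j]; last by rewrite andbT => /andP[h _]; rewrite ltnNge h.
  rewrite addn0 big_nat (eq_bigr (fun _ => 1)) => [|j /andP[_ ->] //].
  by rewrite -big_nat sum_nat_const_nat subn0 muln1.
rewrite -(big_mkord xpredT (nth 0 la)) (big_cat_nat (leq0n _) hs) //= [X in _ + X]big_nat_cond.
rewrite [X in _ + X]big1 => [|i]; last by rewrite andbT => /andP[h _]; rewrite nth_default.
by rewrite addn0 sumnE [RHS](big_nth 0).
Qed.

Section Weight.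
Variables (R : comNzRingType) (X : nat -> R).
Local Open Scope ring_scope.

Definition entry_wt (m : nat) : R := if m is k.+1 then X k else 1.
Definition mat_wt G : R := \prod_p entry_wt (G p).
Definition mat_sum k la : R := \sum_(G : mat | ssyt_mat k la G) mat_wt G.

Lemma mat_wtE G : mat_wt G = \prod_(p : 'I_A * 'I_Bd) entry_wt (mfun G p.1 p.2).
Proof. by apply: eq_bigr => -[i j] _; rewrite mfun_ord. Qed.

Lemma ext_wt n la ka G G' : fits la -> all (leq^~ Bd) la -> all (leq^~ Bd) ka -> interlace la ka ->
  (forall i j, mfun G i j = fun_ext n la ka (mfun G') i j) ->
  (forall i j, ~~ in_shape ka i j -> mfun G' i j = 0%N) ->
  mat_wt G = X n ^+ (sumn la - sumn ka) * mat_wt G'.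
Proof.
move=> hla hla2 hka2 hil hG hG'.
pose P (p : 'I_A * 'I_Bd) := in_shape la p.1 p.2 && ~~ in_shape ka p.1 p.2.
transitivity (\prod_p (if P p then X n else 1) * mat_wt G').
  rewrite !mat_wtE -big_split; apply: eq_bigr => p _; rewrite hG /fun_ext -/(P p) /=.
  case: ifP => [/andP[_ h]|_]; last by rewrite mul1r.
  by rewrite hG' // mulr1.
congr (_ * _); rewrite -big_mkcond prodr_const; congr (_ ^+ _).
have /interlaceP[hs _] := hil; have /and3P[_ hA _] := hla.
have hkA : (size ka <= A)%N by apply: leq_trans hA; rewrite hs.
rewrite -sum1_card -(sum_in_shape hA hla2) -(sum_in_shape hkA hka2) big_mkcond.
apply/eqP; rewrite -(eqn_add2r (\sum_(p : 'I_A * 'I_Bd) in_shape ka p.1 p.2)) subnK; last first.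
  apply: leq_sum => p _; case h : (in_shape ka _ _) => //.
  by rewrite (interlace_in_shape hil h).
rewrite -big_split; apply/eqP/eq_bigr => p _; rewrite unfold_in /P.
case h : (in_shape ka _ _); first by rewrite (interlace_in_shape hil h).
by rewrite andbT; case: in_shape.
Qed.

Definition mat_shape n la G := subshape n la (mfun G).

(** The branching rule: tableaux are grouped by the shape of their entries at most [n], and erasing
    or restoring the entries [n.+1] gives the bijection [Rs], [E]. *)
Lemma mat_sumS n la B : fits la -> size la = n.+1 -> (n < M)%N -> (head 0 la <= B)%N ->
  mat_sum n.+1 la = \sum_(ka <- nlists n B) hstrip (X n) la ka * mat_sum n ka.
Proof.
move=> hla hs hn hB; have /and3P[sla hA hBd] := hla.
have ala : all (leq^~ Bd) la.
  apply/(all_nthP 0%N) => i hi; apply: leq_trans hBd; rewrite -nth0; exact: nth_sorted.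
have hshape G : ssyt_mat n.+1 la G -> mat_shape n la G \in nlists n B.
  move=> /(ssyt_matP _ _ hla) hf; rewrite mem_nlists size_mkseq eqxx /=.
  apply/(all_nthP 0%N) => i; rewrite size_mkseq => hi.
  have /interlaceP[_] := subshape_interlace sla hs hf.
  rewrite size_mkseq => /(_ i hi)/andP[_] h; apply: leq_trans h (leq_trans _ hB).
  by rewrite -nth0; apply: nth_sorted.
transitivity (\sum_(ka <- nlists n B) \sum_(G : mat | ssyt_mat n.+1 la G && (mat_shape n la G == ka)) mat_wt G).
  under [RHS]eq_bigr do rewrite big_mkcondr.
  rewrite exchange_big; apply: eq_bigr => G hG.
  rewrite (bigD1_seq _ (hshape G hG) (nlists_uniq _ _)) /= eqxx big1 ?addr0 // => ka.
  by rewrite eq_sym => /negPf->.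
rewrite big_seq [RHS]big_seq; apply: eq_bigr => ka; rewrite mem_nlists => /andP[/eqP hks hka].
rewrite hstripE; case: (boolP (interlace la ka)) => hil; last first.
  rewrite !mul0r big_pred0 // => G; apply/negP => /andP[/(ssyt_matP _ _ hla) hf /eqP e].
  by move: hil; rewrite -e (subshape_interlace sla hs hf).
have ska : sorted geq ka.
  by apply: (@hstrip_ka_sorted _ (1 : int) la); rewrite hstripE hil expr1n.
have hka0 : (head 0 ka <= head 0 la)%N.
  have /interlaceP[_] := hil; case: (ka) => // k ka' /(_ 0%N isT)/andP[_].
  by rewrite /= nth0.
have hfka : fits ka by rewrite /fits ska hks (leq_trans _ hA) ?hs // (leq_trans hka0).
have akB : all (leq^~ Bd) ka.
  apply/(all_nthP 0%N) => i hi; apply: leq_trans (leq_trans hka0 hBd); rewrite -nth0; exact: nth_sorted.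
pose E (G : mat) : mat := mk (fun_ext n la ka (mfun G)).
pose Rs (G : mat) : mat := mk (fun_restr n (mfun G)).
have mE G : forall i j, mfun (E G) i j = fun_ext n la ka (mfun G) i j.
  move=> i j; apply: mfun_mk => i' j'; rewrite /fun_ext; first by case: ifP => _ //; exact: mfun_le.
  move=> h; rewrite mfun_out //; case: ifP => // /andP[h2 _].
  by rewrite (fits_shape hla h2) in h.
have mR G : forall i j, mfun (Rs G) i j = fun_restr n (mfun G) i j.
  move=> i j; apply: mfun_mk => i' j'; rewrite /fun_restr; first by case: ifP => _ //; exact: mfun_le.
  by move=> h; rewrite mfun_out.
have mat_ext (G1 G2 : mat) : (forall i j, mfun G1 i j = mfun G2 i j) -> G1 = G2.
  by move=> h; apply/ffunP => -[i j]; apply: val_inj; rewrite /= -!mfun_ord h.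
rewrite mul1r mulr_sumr (reindex_onto E Rs) => [|G /andP[/(ssyt_matP _ _ hla) hf /eqP e]]; last first.
  apply: mat_ext => i j; rewrite mE /fun_ext mR /fun_restr -e /mat_shape in_subshape //.
  have [<- h2 _ _] := hf i j; case: (leqP (mfun G i j) n) => h3; rewrite ?andbT ?andbN ?andbF //.
  by rewrite andbT (leq_ltn_trans (leq0n n) h3); apply/eqP; rewrite eqn_leq h3 h2.
apply: eq_big => [G|G].
  apply/idP/idP => [/andP[/andP[/(ssyt_matP _ _ hla) hf /eqP e] /eqP h]|/(ssyt_matP _ _ hfka) hf].
    apply/(ssyt_matP _ _ hfka); have := fun_restr_ssyt sla hs hf; rewrite -/(mat_shape n la _) e => hr i j.
    by rewrite -h; have := hr i j; rewrite !mR.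
  have hf2 : ssyt_fun n.+1 la (mfun (E G)).
    by move=> i j; have := fun_ext_ssyt sla hs hil hf i j; rewrite !mE.
  have hRE : Rs (E G) = G.
    apply: mat_ext => i j; rewrite mR /fun_restr mE /fun_ext.
    have [h1 h2 _ _] := hf i j.
    case: (boolP (in_shape la i j && _)) => [/andP[_ h]|_]; last by rewrite h2.
    by rewrite ltnn; move: h1; rewrite (negPf h); case: (mfun G i j).
  rewrite hRE eqxx andbT; apply/andP; split; first exact/ssyt_matP.
  apply/eqP; apply: (@eq_from_nth _ 0%N) => [|i]; rewrite size_mkseq ?hks // => hi.
  have key j : (j < nth 0 (mat_shape n la (E G)) i)%N = (j < nth 0 ka i)%N.
    have := in_subshape i j sla hs hf2; rewrite -/(mat_shape n la _) /in_shape size_mkseq hi /= => ->.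
    have [h1 h2 _ _] := hf i j; rewrite mE /fun_ext.
    have -> : (j < nth 0 ka i)%N = in_shape ka i j by rewrite /in_shape hks hi.
    case: ifP => [/andP[_ /negPf->]|]; first by rewrite ltnn andbF.
    by rewrite h2 andbT h1.
  case: (ltngtP (nth 0%N (mat_shape n la (E G)) i) (nth 0%N ka i)) => // h.
    by have := key (nth 0%N (mat_shape n la (E G)) i); rewrite h ltnn.
  by have := key (nth 0%N ka i); rewrite h ltnn.
move=> /andP[/andP[/(ssyt_matP _ _ hla) hf _] /eqP hRE]; apply: (ext_wt hla ala akB hil (mE G)).
move=> i j hij; rewrite -hRE mR /fun_restr; have [h1 _ _ _] := hf i j.
case h : (in_shape la i j); first by rewrite mE /fun_ext h hij ltnn.
by case: leqP => //; move: h1; rewrite h; case: (mfun _ i j).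
Qed.

Lemma mat_sum0 : mat_sum 0 [::] = 1.
Proof.
have hf : fits [::] by [].
rewrite /mat_sum (big_pred1 [ffun => ord0]) => [|G]; last first.
  apply/idP/eqP => [/(ssyt_matP _ _ hf) h|->]; last first.
    apply/ssyt_matP => // i j; rewrite /in_shape /=.
    suff -> : mfun [ffun => ord0] i j = 0%N by split.
    by rewrite /mfun; do 2!case: insub => // ?; rewrite ffunE.
  apply/ffunP => -[i j]; apply: val_inj; rewrite /= -mfun_ord ffunE /=.
  by have [_ + _ _] := h i j; rewrite leqn0 => /eqP.
by rewrite /mat_wt big1 // => p _; rewrite ffunE.
Qed.

Lemma mat_sum_gt n la : fits la -> size la = n -> (n <= M)%N -> mat_sum n la = gt_schur X n la.
Proof.
elim: n la => [|n IH] la hla hs hn.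
  by move: hs => /size0nil->; rewrite mat_sum0.
rewrite (mat_sumS hla hs hn (leqnn _)) /= big_seq [RHS]big_seq; apply: eq_bigr => ka.
rewrite mem_nlists => /andP[/eqP hks aka].
have [->|h0] := eqVneq (hstrip (X n) la ka) 0; first by rewrite !mul0r.
rewrite IH // 1?ltnW //; have /and3P[sla hA hBd] := hla.
apply/and3P; split; first exact: hstrip_ka_sorted h0.
  by rewrite hks; apply: leq_trans hA; rewrite hs.
apply: leq_trans hBd; case: (ka) aka => //= k ka' /andP[] //.
Qed.
End Weight.
End Matrices.

Section Fillings.
Variables (n : nat) (la : seq nat).
Implicit Type T : filling n la.

Lemma fentry_ord T (i : 'I_(size la)) (j : 'I_(head 0 la)) :
  fentry T i j = if T (i, j) is Some k then k.+1 else 0.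
Proof. by rewrite /fentry !valK. Qed.

Lemma fentry_out T i j : ~~ ((i < size la) && (j < head 0 la)) -> fentry T i j = 0.
Proof.
rewrite /fentry; case: insubP => [i' hi _|//]; rewrite hi /=.
by case: insubP => // j' ->.
Qed.

Lemma fentry_le T i j : fentry T i j <= n.
Proof. by rewrite /fentry; case: insub => // i'; case: insub => // j'; case: (T (i', j')) => [k|] //; exact: ltn_ord. Qed.

Lemma is_ssytP T : sorted geq la -> reflect (ssyt_fun n la (fentry T)) (is_ssyt T).
Proof.
move=> sla; apply: (iffP idP) => [h i j|h]; last first.
  apply/forallP => i; apply/forallP => j; have [h1 h2 h3 h4] := h i j.
  rewrite -h1 fentry_ord; apply/and3P; split; first by case: (T (i, j)).
    by apply/implyP; rewrite -fentry_ord.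
  by apply/implyP; rewrite -fentry_ord.
have [/andP[hi hj]|hn] := boolP ((i < size la) && (j < head 0 la)).
  have := forallP (forallP h (Ordinal hi)) (Ordinal hj) => /= /and3P[/eqP h1 h3 h4].
  have := fentry_ord T (Ordinal hi) (Ordinal hj) => /= e.
  rewrite -h1 fentry_le e; split=> //; last by apply/implyP; rewrite -e.
    by case: (T (_, _)).
  by apply/implyP; rewrite -e.
have h0 : in_shape la i j = false.
  apply: contraNF hn => /andP[hi hj]; rewrite hi /=; apply: leq_trans hj _.
  by rewrite -nth0; apply: nth_sorted.
rewrite fentry_out // h0; split=> // h5.
by have := in_shape_up sla h5; rewrite h0.
Qed.

Variables A Bd : nat.
Hypothesis hla : fits A Bd la.

Definition fill_mat T : mat A Bd n := mk A Bd n (fentry T).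
Definition mat_fill (G : mat A Bd n) : filling n la :=
  [ffun p : 'I_(size la) * 'I_(head 0 la) => if mfun G p.1 p.2 is k.+1 then insub k else None].

Lemma mfun_fill T i j : mfun (fill_mat T) i j = fentry T i j.
Proof.
apply: mfun_mk => i' j'; first exact: fentry_le.
have /and3P[_ h1 h2] := hla; move=> h; apply: fentry_out; apply: contra h => /andP[h3 h4].
by rewrite (leq_trans h3 h1) (leq_trans h4 h2).
Qed.

Lemma fill_matK : cancel fill_mat mat_fill.
Proof.
move=> T; apply/ffunP => -[i j]; rewrite ffunE /= mfun_fill fentry_ord.
by case: (T (_, _)) => // k; rewrite valK.
Qed.

Definition xvar (k : nat) : {mpoly int[n]} := (if insub k is Some k' then 'X_k' else 0)%R.

Lemma content_wt T : 'X_[content T] = mat_wt xvar (fill_mat T).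
Proof.
rewrite mpolyXE_id.
transitivity (\prod_(c : 'I_(size la) * 'I_(head 0 la)) entry_wt xvar (fentry T c.1 c.2))%R.
  transitivity (\prod_(k < n) \prod_(c | T c == Some k) 'X_k : {mpoly int[n]})%R.
    apply: eq_bigr => k _; rewrite prodr_const mnmE; congr (_ ^+ _)%R.
    by apply: eq_card => c; rewrite inE.
  rewrite (exchange_big_dep xpredT) //=; apply: eq_bigr => -[i j] _.
  rewrite fentry_ord; case: (T (_, _)) => [k|] /=; last by rewrite big_pred0.
  rewrite (big_pred1 k) => [|k']; last by rewrite /= eq_sym; apply/eqP/eqP => [[]|->].
  by rewrite /xvar valK.
rewrite mat_wtE; have /and3P[_ h1 h2] := hla.
transitivity (\prod_(i < size la) \prod_(j < head 0%N la) entry_wt xvar (fentry T i j))%R.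
  by rewrite pair_bigA.
rewrite -(pair_bigA _ (fun (i : 'I_A) (j : 'I_Bd) => entry_wt xvar (mfun (fill_mat T) i j))) /=.
rewrite (big_ord_widen A (fun i => \prod_(j < head 0%N la) entry_wt xvar (fentry T i j))%R h1).
rewrite big_mkcond; apply: eq_bigr => i _.
rewrite (big_ord_widen Bd (fun j => entry_wt xvar (fentry T i j))%R h2) big_mkcond.
case: ifP => hi; last first.
  by rewrite big1 // => j _; rewrite mfun_fill fentry_out // hi.
apply: eq_bigr => j _; rewrite mfun_fill; case: ifP => // hj.
by rewrite fentry_out // hj andbF.
Qed.

Lemma schur_mat : schur n la = @mat_sum A Bd n _ xvar n la.
Proof.
have /and3P[sla _ _] := hla; rewrite /schur /mat_sum.
rewrite (reindex_onto fill_mat mat_fill) => [|G /(ssyt_matP _ _ hla) hG]; last first.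
  apply/ffunP => -[i j]; apply: val_inj; rewrite /= -!mfun_ord mfun_fill.
  have [hs hle _ _] := hG i j; case: (boolP (in_shape la i j)) => h.
    have hij : (i < size la) && (j < head 0 la).
      move: h => /andP[hi hj]; rewrite hi /=; apply: leq_trans hj _.
      by rewrite -nth0; apply: nth_sorted.
    move: hij => /andP[hi hj].
    have := fentry_ord (mat_fill G) (Ordinal hi) (Ordinal hj) => /= ->; rewrite ffunE /=.
    case: (mfun G i j) hle => // k hk; by rewrite insubT.
  move: hs; rewrite (negPf h) lt0n => /negbFE/eqP ->.
  have [/andP[hi hj]|h2] := boolP ((i < size la) && (j < head 0 la)); last by rewrite fentry_out.
  have := fentry_ord (mat_fill G) (Ordinal hi) (Ordinal hj) => /= ->; rewrite ffunE /=.
  have [h3 _ _ _] := hG i j; move: h3; rewrite (negPf h); by case: (mfun G i j).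
apply: eq_big => [T|T _]; last exact: content_wt.
rewrite fill_matK eqxx andbT; apply/(is_ssytP _ sla)/(ssyt_matP _ _ hla) => h i j.
  by have := h i j; rewrite !mfun_fill.
by have := h i j; rewrite !mfun_fill.
Qed.
End Fillings.

Lemma in_shape_pad la m i j : in_shape (la ++ nseq m 0) i j = in_shape la i j.
Proof.
rewrite /in_shape size_cat size_nseq nth_cat; case: (ltnP i (size la)) => h.
  by rewrite ltn_addr.
by rewrite nth_nseq if_same ltn0 andbF.
Qed.

Lemma sorted_pad la m : sorted geq la -> sorted geq (la ++ nseq m 0).
Proof.
case: la => [|a la] /= h; first by elim: m => //= m; case: m.
rewrite cat_path h /=; elim: m (last a la) => //= m IH b; by rewrite IH.
Qed.

(** [gt_schur] expects exactly [n] parts; trailing zeros do not affect tableaux. *)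
Lemma schur_gt n la : sorted geq la -> size la <= n ->
  schur n la = gt_schur (@xvar n) n (la ++ nseq (n - size la) 0).
Proof.
move=> sla hs; set la' := la ++ _; pose Bd := maxn (head 0 la) (head 0 la').
have hs' : size la' = n by rewrite size_cat size_nseq subnKC.
have f1 : fits n Bd la by rewrite /fits sla hs leq_maxl.
have f2 : fits n Bd la' by rewrite /fits sorted_pad // hs' leqnn leq_maxr.
rewrite (schur_mat n f1) -(mat_sum_gt _ f2 hs' (leqnn n)).
apply: eq_bigl => G; apply: eq_forallb => i; apply: eq_forallb => j.
by rewrite !in_shape_pad.
Qed.

(** * Expansion of products of Schur polynomials *)

(* the partition [lam w], padded by zeros to length [size w] *)
Definition npart (w : seq bool) : seq nat := rev (parts 0 w) ++ nseq (ones w) 0.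

Lemma size_parts k w : size (parts k w) = nzeros w.
Proof. by elim: w k => //= -[] w IH k /=; rewrite IH. Qed.

Lemma nzeros_ones w : nzeros w + ones w = size w.
Proof. by rewrite addnC -(count_predC id w). Qed.

Lemma size_npart w : size (npart w) = size w.
Proof. by rewrite size_cat size_rev size_nseq size_parts nzeros_ones. Qed.

Lemma parts_inj k w w' : size w = size w' -> parts k w = parts k w' -> w = w'.
Proof.
elim: w w' k => [|b w IH] [|b' w'] //= k [hs].
have ge j x : all (leq j) (parts j x) := parts_ge j x.
case: b b' => [] [] /=; first by move/(IH _ _ hs)->.
- by move=> e; have := ge k.+1 w; rewrite e /= ltnn.
- by move=> e; have := ge k.+1 w'; rewrite -e /= ltnn.
by case=> /(IH _ _ hs)->.
Qed.

Lemma npart_inj w w' : size w = size w' -> nzeros w = nzeros w' -> npart w = npart w' -> w = w'.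
Proof.
move=> hs hz /eqP; rewrite /npart eqseq_cat ?size_rev ?size_parts // => /andP[/eqP h _].
by apply: (@parts_inj 0 _ _ hs); apply: (can_inj revK).
Qed.

Lemma parts_sorted k w : sorted leq (parts k w).
Proof.
elim: w k => //= -[] w IH k //=; rewrite path_min_sorted ?IH //.
exact: parts_ge.
Qed.

Lemma npart_sorted w : sorted geq (npart w).
Proof.
have h : sorted geq (rev (parts 0 w)) by rewrite rev_sorted; exact: parts_sorted.
rewrite /npart; move: (rev _) h => la; case: la => [|a la] /= h.
  by elim: (ones w) => //= m; case: m.
rewrite cat_path h /=; elim: (ones w) (last a la) => //= m IH b; by rewrite IH.
Qed.

Lemma parts_le k w : all (leq^~ (k + ones w)) (parts k w).
Proof.
elim: w k => //= -[] w IH k /=; first by rewrite addnA addn1.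
by rewrite add0n leq_addr /=.
Qed.

Lemma npart_le w : all (leq^~ (ones w)) (npart w).
Proof.
rewrite all_cat all_rev; have := parts_le 0 w; rewrite add0n => -> /=.
by rewrite all_nseq leq0n orbT.
Qed.

Fixpoint word_of (b k : nat) (p : seq nat) : seq bool :=
  if p is i :: p' then nseq (i - k) true ++ false :: word_of b i p' else nseq (b - k) true.

Lemma parts_ones k m w : parts k (nseq m true ++ w) = parts (k + m) w.
Proof. by elim: m k => [|m IH] k /=; rewrite ?addn0 // IH addnS addSn. Qed.

Lemma word_ofP b k p : k <= b -> path leq k p -> all (leq^~ b) p ->
  [/\ parts k (word_of b k p) = p, nzeros (word_of b k p) = size p & ones (word_of b k p) = b - k].
Proof.
elim: p k => [|i p IH] k /= hk.
  move=> _ _; rewrite -[nseq _ _]cats0 parts_ones /= cats0; split=> //.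
    by rewrite /nzeros count_nseq.
  by rewrite count_nseq mul1n.
move=> /andP[h1 h2] /andP[h3 h4]; have [e1 e2 e3] := IH i h3 h2 h4.
rewrite parts_ones subnKC //= e1; split=> //.
  by rewrite /nzeros count_cat count_nseq /= -/(nzeros _) e2 mul0n.
by rewrite count_cat count_nseq /= e3 mul1n add0n; lia.
Qed.

Lemma npart_surj (la : seq nat) a b : sorted geq la -> size la = a + b ->
  all (leq^~ b) la -> (forall i, a <= i -> nth 0 la i = 0) ->
  exists2 w, (size w = a + b /\ nzeros w = a) & npart w = la.
Proof.
move=> sla hs hb h0.
have hcat : la = take a la ++ nseq b 0.
  rewrite -{1}(cat_take_drop a la); congr (_ ++ _).
  apply: (@eq_from_nth _ 0); first by rewrite size_drop hs addKn size_nseq.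
  by move=> i _; rewrite nth_drop h0 ?leq_addr // nth_nseq if_same.
have hst : size (take a la) = a by rewrite size_takel // hs leq_addr.
have := @word_ofP b 0 (rev (take a la)) (leq0n _).
have -> : path leq 0 (rev (take a la)).
  rewrite path_min_sorted ?rev_sorted; last by apply/allP.
  by have := take_sorted a sla.
rewrite all_rev; have -> : all (leq^~ b) (take a la).
  by apply/allP => i /mem_take hi; apply: (allP hb).
move=> /(_ isT isT); rewrite size_rev hst subn0 => -[e1 e2 e3].
exists (word_of b 0 (rev (take a la))).
  by split; rewrite // -nzeros_ones e2 e3.
by rewrite /npart e1 e3 revK -hcat.
Qed.

(** * Vertical strips and the box of partitions encoded by words *)

Fixpoint vstripb (p q : seq nat) : bool :=
  match p, q with
  | [::], [::] => true
  | a :: p', b :: q' => ((b == a) || (b == a.+1)) && vstripb p' q'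
  | _, _ => false
  end.

Lemma vstripb_sumn p q : vstripb p q -> sumn p <= sumn q.
Proof. by elim: p q => [|a p IH] [|b q] //= /andP[h /IH h2]; lia. Qed.

Lemma vstripE (R : comNzRingType) (z : R) p q :
  vstrip z p q = ((vstripb p q)%:R * z ^+ (sumn q - sumn p))%R.
Proof.
elim: p q => [|a p IH] [|b q] /=; rewrite ?mul0r ?mul1r //.
rewrite IH /vstep; have [->|hab] := eqVneq b a.
  by rewrite mul1r /= subnDl.
have [->|hab2] := eqVneq b a.+1; last by rewrite !mul0r.
case: (boolP (vstripb p q)) => [/vstripb_sumn h|_]; last by rewrite !mul0r mulr0.
by rewrite !mul1r -exprS; congr (_ ^+ _)%R; lia.
Qed.

Lemma vstripb_cat p1 p2 q1 q2 : size p1 = size q1 ->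
  vstripb (p1 ++ p2) (q1 ++ q2) = vstripb p1 q1 && vstripb p2 q2.
Proof. by elim: p1 q1 => [|a p IH] [|b q] //= [/IH->]; rewrite andbA. Qed.

Lemma vstripb_size p q : vstripb p q -> size p = size q.
Proof. by elim: p q => [|a p IH] [|b q] //= /andP[_ /IH->]. Qed.

Lemma vstripb_refl p : vstripb p p.
Proof. by elim: p => //= a p ->; rewrite eqxx. Qed.

Lemma vstripb_rev p q : vstripb (rev p) (rev q) = vstripb p q.
Proof.
case: (eqVneq (size p) (size q)) => [|h]; last first.
  transitivity false; last symmetry; apply: contraNF h => /vstripb_size; rewrite ?size_rev => -> //.
elim: p q => [|a p IH] [|b q] // [hs]; rewrite !rev_cons -!cats1 vstripb_cat ?size_rev //.
by rewrite IH //= andbT andbC.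
Qed.

Lemma vstripb_npart v w : nzeros v = nzeros w -> size v = size w ->
  vstripb (npart v) (npart w) = vstripb (parts 0 v) (parts 0 w).
Proof.
move=> hz hs; rewrite /npart vstripb_cat ?size_rev ?size_parts // vstripb_rev.
have -> : ones v = ones w by have := nzeros_ones v; have := nzeros_ones w; lia.
by rewrite vstripb_refl andbT.
Qed.

Lemma sumn_npart w : sumn (npart w) = sumn (parts 0 w).
Proof. by rewrite sumn_cat sumn_rev sumn_nseq mul0n addn0. Qed.

Lemma nth_vstripb p q i : vstripb p q -> nth 0 p i <= nth 0 q i <= (nth 0 p i).+1.
Proof.
by elim: p q i => [|a p IH] [|b q] [|i] //= /andP[h h2]; [lia|apply: IH].
Qed.

Definition vstripk (k : nat) (p q : seq nat) : bool := vstripb p q && (sumn q == sumn p + k).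

(** Removing a strip only lowers parts. This closure of the box is what makes coefficients outside
    it irrelevant. *)
Lemma vstripk_npart_closed k la w : sorted geq la -> vstripk k la (npart w) ->
  exists2 v, (size v = size w /\ nzeros v = nzeros w) & npart v = la.
Proof.
move=> sla /andP[h _]; have hs := vstripb_size h; rewrite size_npart -nzeros_ones in hs.
rewrite -(nzeros_ones w); apply: npart_surj => //.
  apply/(all_nthP 0) => i hi; have /andP[h1 _] := nth_vstripb i h; apply: leq_trans h1 _.
  by apply: (all_nthP 0 (npart_le w)); rewrite size_npart -nzeros_ones -hs.
move=> i hi; have /andP[h1 _] := nth_vstripb i h; move: h1.
rewrite /npart nth_cat size_rev size_parts ltnNge hi /= nth_nseq if_same leqn0.
by move/eqP.
Qed.

Definition box (n a : nat) : seq (seq bool) := [seq v <- words bools n | nzeros v == a].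

Lemma mem_box n a v : (v \in box n a) = (size v == n) && (nzeros v == a).
Proof.
rewrite mem_filter mem_words andbC; congr (_ && _).
by rewrite (_ : all _ _ = true) ?andbT //; apply/allP => -[].
Qed.

Lemma box_uniq n a : uniq (box n a).
Proof. exact/filter_uniq/words_uniq. Qed.

(** The coefficient of [z ^ k] in [exchange_puz], with [z] the indeterminate of [{poly int}]. *)
Lemma exchange_box k u v w : size v = size u -> size w = size u -> nzeros v = nzeros w ->
  \sum_(v' <- box (size u) (nzeros w) | vstripk k (npart v) (npart v')) puz u v' w =
  \sum_(w' <- box (size u) (nzeros w) | vstripk k (npart w') (npart w)) puz u v w'.
Proof.
move=> hv hw hz; have /= := @exchange_puz {poly int} 'X%R u v w hv hw.
have el x y : size x = size u -> size y = size u ->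
    (nzeros x != nzeros y -> eline ('X : {poly int})%R false x y = 0%R) /\
    (nzeros x = nzeros y -> (eline ('X : {poly int})%R false x y)`_k = (vstripk k (npart x) (npart y))%:R)%R.
  move=> hx hy; have [-> _] := eline_vstrip ('X : {poly int})%R 0 (etrans hx (esym hy)).
  split=> h; first by rewrite vstrip_size // !size_parts.
  rewrite vstripE /vstripk vstripb_npart ?hx // !sumn_npart.
  case: (boolP (vstripb _ _)) => [/vstripb_sumn h2|_] /=; last by rewrite mul0r coef0.
  by rewrite mul1r coefXn; congr (nat_of_bool _)%:R%R; apply/eqP/eqP; lia.
have coef (E : seq bool -> {poly int}) (V : pred (seq bool)) (p : seq bool -> nat) :
    (forall x, size x = size u -> nzeros x != nzeros w -> E x = 0%R) ->
    (forall x, size x = size u -> nzeros x = nzeros w -> (E x)`_k = (V x)%:R)%R ->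
    (\sum_(x <- words bools (size u)) (E x * (p x)%:R)`_k)%R =
    ((\sum_(x <- box (size u) (nzeros w) | V x) p x)%:R : int)%R.
  move=> h1 h2; rewrite natr_sum [RHS]big_filter_cond [RHS]big_mkcond [LHS]big_seq [RHS]big_seq.
  apply: eq_bigr => x; rewrite mem_words => /andP[/eqP hx _].
  rewrite -polyC_natr coefMC; case: eqP => hx2 /=; last by rewrite h1 ?coef0 ?mul0r //; apply/eqP.
  by rewrite h2 //; case: (V x); rewrite ?mul1r ?mul0r.
move=> h; apply/eqP; rewrite -(@eqr_nat int); apply/eqP.
have {h} := congr1 (fun p : {poly int} => p`_k)%R h; rewrite !coef_sum.
rewrite (coef _ (fun x => vstripk k (npart v) (npart x))); first last.
- by move=> x hx e; have [_ ->] := el v x hv hx; rewrite // hz.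
- by move=> x hx e; have [-> //] := el v x hv hx; rewrite hz eq_sym.
move=> ->; under [LHS]eq_bigr do rewrite mulrC.
rewrite (coef _ (fun x => vstripk k (npart x) (npart w))) //.
- by move=> x hx e; have [-> //] := el x w hx hw.
- by move=> x hx e; have [_ ->] := el x w hx hw.
Qed.

Lemma puz_box_base n u w : size u = n -> size w = n ->
  puz u (nseq (nzeros u) false ++ nseq (ones u) true) w = (w == u).
Proof. by move=> hu hw; rewrite (@puz_base _ _ _ (ones u)) // nzeros_ones. Qed.

Lemma npart_zero a b : npart (nseq a false ++ nseq b true) = nseq (a + b) 0.
Proof.
rewrite /npart count_cat !count_nseq mul0n mul1n add0n.
have -> : parts 0 (nseq a false ++ nseq b true) = nseq a 0.
  elim: a => /= [|a ->] //; rewrite -[nseq b true]cats0 parts_ones //.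
by rewrite rev_nseq -nseqD.
Qed.

Local Open Scope ring_scope.

Lemma nlists0 n : nlists n 0 = [:: nseq n 0%N].
Proof. by elim: n => //= n IH; rewrite /nlists /words /= -/(words _ _) -/(nlists n 0) IH. Qed.

Lemma gt_schur_zero (R : comNzRingType) (X : nat -> R) n : gt_schur X n (nseq n 0%N) = 1.
Proof.
elim: n => [|n IH]; first by [].
rewrite (gt_schurS X n (B := 0%N)) // nlists0 big_seq1 IH mulr1.
elim: {IH}n (X n) => [|n IH] x; first by rewrite /= mul1r.
rewrite (_ : hstrip x _ _ = 1%:R * x ^+ 0 * hstrip x (nseq n.+1 0%N) (nseq n 0%N)) //.
by rewrite !mul1r; apply: IH.
Qed.

Lemma pieri_coef (R : comNzRingType) (X : nat -> R) n k mu B :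
  size mu = n -> sorted geq mu -> (head 0 mu < B)%N ->
  (\prod_(i < n) (1 + (X i)%:P * 'X))`_k * gt_schur X n mu =
  \sum_(la <- nlists n B | vstripk k mu la) gt_schur X n la.
Proof.
move=> hs smu hB; have := pieri (fun i => (X i)%:P) ('X : {poly R}) hs smu hB.
have e la : gt_schur (fun i => (X i)%:P) n la = (gt_schur X n la)%:P.
  by rewrite (gt_schur_morph (@polyC R)).
rewrite e => /(congr1 (fun p : {poly R} => p`_k)); rewrite coefMC => <-.
rewrite coef_sum [RHS]big_mkcond; apply: eq_bigr => la _.
rewrite e coefMC vstripE /vstripk; case: (boolP (vstripb mu la)) => [/vstripb_sumn h|_] /=.
  rewrite mul1r coefXn; case: eqP => h1; case: eqP => h2; rewrite ?mul1r ?mul0r //; lia.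
by rewrite mul0r coef0 mul0r.
Qed.

Lemma sum_subset (V : nmodType) (I : eqType) (r1 r2 : seq I) (F : I -> V) : uniq r1 -> uniq r2 ->
  (forall x, x \in r1 -> x \notin r2 -> F x = 0) -> (forall x, x \in r2 -> x \notin r1 -> F x = 0) ->
  \sum_(x <- r1) F x = \sum_(x <- r2) F x.
Proof.
move=> u1 u2 h1 h2; rewrite (bigID (mem r2)) /= [X in _ + X]big1_seq => [|x /andP[hx hx1]]; last exact: h1.
rewrite [RHS](bigID (mem r1)) /= [X in _ = _ + X]big1_seq => [|x /andP[hx hx1]]; last exact: h2.
rewrite !addr0 -[LHS]big_filter -[RHS]big_filter; apply: perm_big; apply: uniq_perm; rewrite ?filter_uniq //.
by move=> x; rewrite !mem_filter /= andbC.
Qed.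

Section Expansion.
Variables (R : comNzRingType) (X : nat -> R) (n : nat) (u : seq bool).
Hypothesis hu : size u = n.
Notation S := (gt_schur X n).
Notation bx := (box n (nzeros u)).

(** A finite support makes the expansion independent of the bound [B], so expansions with different
    bounds can be added. *)
Definition supported (D : seq nat -> int) (B : nat) : Prop :=
  forall la, ~~ ((la \in nlists n B) && sorted geq la) -> D la = 0.

(* [f] is a combination of Schur polynomials whose coefficients inside the box are
   given by [g]; outside of the box they are unconstrained *)
Definition expands (f : R) (g : seq bool -> int) : Prop :=
  exists B D, [/\ (n <= B)%N, supported D B, f = \sum_(la <- nlists n B) (D la)%:~R * S la &
    forall w, w \in bx -> D (npart w) = g w].

Lemma supported_sum D B B' : supported D B -> (B <= B')%N ->
  \sum_(la <- nlists n B) (D la)%:~R * S la = \sum_(la <- nlists n B') (D la)%:~R * S la.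
Proof.
move=> hD hB; apply: sum_subset; rewrite ?nlists_uniq // => la; rewrite !mem_nlists.
  move=> /andP[-> h1] /negP[]; apply: sub_all h1 => i hi; exact: leq_trans hi hB.
by move=> _ h; rewrite hD ?mul0r // mem_nlists (negPf h).
Qed.

Lemma supported_le D B B' : supported D B -> (B <= B')%N -> supported D B'.
Proof.
move=> hD hB la h; apply: hD; apply: contra h; rewrite !mem_nlists => /andP[/andP[-> h1] ->].
by rewrite andbT /=; apply: sub_all h1 => i hi; exact: leq_trans hi hB.
Qed.

Lemma expandsB f1 g1 f2 g2 : expands f1 g1 -> expands f2 g2 ->
  expands (f1 - f2) (fun w => g1 w - g2 w).
Proof.
move=> [B1 [D1 [b1 s1 -> e1]]] [B2 [D2 [b2 s2 -> e2]]].
exists (maxn B1 B2), (fun la => D1 la - D2 la); split.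
- by rewrite leq_max b1.
- move=> la h; rewrite (supported_le s1 (leq_maxl B1 B2) h).
  by rewrite (supported_le s2 (leq_maxr B1 B2) h) subr0.
- rewrite (supported_sum s1 (leq_maxl B1 B2)) (supported_sum s2 (leq_maxr B1 B2)) -sumrB.
  by apply: eq_bigr => la _; rewrite rmorphB mulrBl.
by move=> w hw; rewrite e1 // e2.
Qed.

Lemma expands_ext f g1 g2 : expands f g1 -> (forall w, w \in bx -> g1 w = g2 w) -> expands f g2.
Proof.
by move=> [B [D [b s e h]]] h2; exists B, D; split=> // w hw; rewrite h // h2.
Qed.

Lemma expands0 : expands 0 (fun _ => 0).
Proof.
by exists n, (fun _ => 0); split=> //; rewrite big1 // => la _; rewrite mul0r.
Qed.

Lemma expandsD f1 g1 f2 g2 : expands f1 g1 -> expands f2 g2 ->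
  expands (f1 + f2) (fun w => g1 w + g2 w).
Proof.
move=> h1 h2; have h3 := expandsB expands0 h2; have := expandsB h1 h3.
rewrite sub0r opprK => h; apply: expands_ext h _ => w _; by rewrite sub0r opprK.
Qed.

Lemma expands_sum (I : eqType) (r : seq I) (F : I -> R) (g : I -> seq bool -> int) :
  (forall i, i \in r -> expands (F i) (g i)) ->
  expands (\sum_(i <- r) F i) (fun w => \sum_(i <- r) g i w).
Proof.
elim: r => [|i r IH] h.
  by rewrite big_nil; apply: expands_ext expands0 _ => w _; rewrite big_nil.
have ih : expands (\sum_(i <- r) F i) (fun w => \sum_(i <- r) g i w).
  by apply: IH => j hj; apply: h; rewrite inE hj orbT.
rewrite big_cons; apply: expands_ext (expandsD (h i (mem_head _ _)) ih) _ => w _.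
by rewrite big_cons.
Qed.

Definition elem (k : nat) : R := (\prod_(i < n) (1 + (X i)%:P * 'X))`_k.

Lemma npart_in_nlists B w : (n <= B)%N -> w \in bx -> (npart w \in nlists n B) && sorted geq (npart w).
Proof.
move=> hB; rewrite mem_box => /andP[/eqP hs _]; rewrite mem_nlists size_npart hs eqxx npart_sorted andbT /=.
apply: sub_all (npart_le w) => i hi; apply: leq_trans hi (leq_trans _ hB).
by rewrite -hs -nzeros_ones leq_addl.
Qed.

(** By the Pieri rule the coefficient at [npart w] sums those of [f] at partitions from which a
    vertical strip leads to [npart w]. They lie in the box, where [g] is prescribed. *)
Lemma expands_elem k f g : expands f g ->
  expands (elem k * f)
    (fun w => \sum_(w' <- bx | vstripk k (npart w') (npart w)) g w').
Proof.
move=> [B [D [hB sD -> hD]]].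
pose D' la : int := if (la \in nlists n B.+1) && sorted geq la then
   \sum_(mu <- nlists n B | vstripk k mu la) D mu else 0.
(* A vertical strip can lengthen the first row by one. *)
exists B.+1, D'; split.
- exact: leqW.
- by move=> la /negPf h; rewrite /D' h.
- rewrite mulr_sumr.
  transitivity (\sum_(mu <- nlists n B) \sum_(la <- nlists n B.+1 | vstripk k mu la)
      (D mu)%:~R * S la).
    rewrite big_seq [RHS]big_seq; apply: eq_bigr => mu hmu; rewrite mulrCA -mulr_sumr.
    case: (boolP (sorted geq mu)) => smu; last by rewrite sD ?mul0r // (negPf smu) andbF.
    move: hmu; rewrite mem_nlists => /andP[/eqP h1 h2].
    congr (_ * _); apply: (@pieri_coef _ X n k mu B.+1) => //.
    by rewrite ltnS; case: (mu) h2 => //= ? ? /andP[].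
  rewrite (exchange_big_dep xpredT) //= big_seq [RHS]big_seq; apply: eq_bigr => la hla.
  rewrite /D' hla /=; case: (boolP (sorted geq la)) => sla; last first.
    by rewrite mul0r big1 // => mu _; rewrite gt_schur_sorted ?mulr0.
  by rewrite rmorph_sum mulr_suml.
move=> w hw; rewrite /D' (npart_in_nlists (leqW hB) hw) /=.
transitivity (\sum_(mu <- map npart bx | vstripk k mu (npart w)) D mu); last first.
  rewrite big_map big_seq_cond [RHS]big_seq_cond.
  by apply: eq_bigr => w' /andP[hw' _]; rewrite hD.
rewrite big_mkcond [RHS]big_mkcond; apply: sum_subset; first exact: nlists_uniq.
- rewrite map_inj_in_uniq ?box_uniq // => x y; rewrite !mem_box => /andP[/eqP h1 /eqP h2] /andP[/eqP h3 /eqP h4].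
  by apply: npart_inj; rewrite ?h1 ?h2.
- move=> mu hmu hn; case: ifP => // hv; apply: sD; apply: contra hn => /andP[_ smu].
  have [v [h1 h2] <-] := vstripk_npart_closed smu hv.
  apply: map_f; move: hw; rewrite !mem_box => /andP[/eqP h3 /eqP h4].
  by rewrite h1 h2 h3 h4 !eqxx.
move=> mu /mapP[v hv ->]; have /andP[-> _] := npart_in_nlists hB hv.
by [].
Qed.

(** Puzzle numbers indexed by partitions, 0 outside the box, because the induction on [nu] also
    meets partitions that no word encodes. *)
Definition box_coef (nu : seq nat) (w : seq bool) : int :=
  \sum_(v <- bx | npart v == nu) (puz u v w)%:R.

Lemma box_coef_npart v w : v \in bx -> box_coef (npart v) w = (puz u v w)%:R.
Proof.
move=> hv; rewrite /box_coef -big_filter.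
have -> : [seq x <- bx | npart x == npart v] = [:: v]; last by rewrite big_seq1.
apply: perm_small_eq => //; apply: uniq_perm => // [|x]; first exact/filter_uniq/box_uniq.
rewrite mem_filter inE; apply/andP/eqP => [[/eqP h hx]|->]; last by [].
move: hv hx; rewrite !mem_box => /andP[/eqP h3 /eqP h4] /andP[/eqP h1 /eqP h2].
by apply: npart_inj; rewrite ?h1 ?h2.
Qed.

Lemma box_coef_out nu w : (forall v, v \in bx -> npart v != nu) -> box_coef nu w = 0.
Proof. by move=> h; rewrite /box_coef big1_seq // => v /andP[h1 h2]; move: (h v h2); rewrite h1. Qed.

(* [nu] may lie outside the box: the box is closed under removal of vertical
   strips, so both sides then vanish *)
Lemma box_coef_exchange k nu w B : w \in bx -> sorted geq nu -> size nu = n ->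
  (head 0%N nu < B)%N ->
  \sum_(la <- nlists n B | sorted geq la && vstripk k nu la) box_coef la w =
  \sum_(w' <- bx | vstripk k (npart w') (npart w)) box_coef nu w'.
Proof.
move=> hw snu hs hB.
transitivity (\sum_(v <- bx | vstripk k nu (npart v)) (puz u v w)%:R : int).
  rewrite (exchange_big_dep (fun v => vstripk k nu (npart v))) /=; last first.
    by move=> la v /andP[_ h] /eqP->.
  rewrite big_seq_cond [RHS]big_seq_cond; apply: eq_bigr => v /andP[hv hk].
  rewrite big_mkcond (bigD1_seq (npart v)) ?nlists_uniq //=; last first.
    move: hk => /andP[hk _]; rewrite mem_nlists -(vstripb_size hk) hs eqxx /=.
    apply/(all_nthP 0%N) => i _; have /andP[_ h] := nth_vstripb i hk; apply: leq_trans h _.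
    by apply: leq_trans hB; rewrite ltnS -nth0; apply: nth_sorted.
  rewrite npart_sorted hk eqxx /= big1 ?addr0 // => la.
  by rewrite eq_sym => /negPf->; rewrite andbF.
have [/hasP[v hv /eqP e]|hn] := boolP (has (fun v => npart v == nu) bx).
  rewrite -e; under [RHS]eq_bigr do rewrite box_coef_npart //.
  rewrite -!natr_sum; congr (_%:R).
  move: (hv) (hw); rewrite !mem_box => /andP[/eqP h1 /eqP h2] /andP[/eqP h3 /eqP h4].
  by have := @exchange_box k u v w; rewrite hu h1 h3 h2 h4; apply.
have out : forall v, v \in bx -> npart v != nu.
  by move=> v hv; apply: contra hn => e; apply/hasP; exists v.
rewrite [RHS]big1 => [|w' _]; last exact: box_coef_out.
rewrite big1_seq // => v /andP[hk hv].
have [v' [h1 h2] e] := vstripk_npart_closed snu hk.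
move: hv; rewrite mem_box -h1 -h2 -mem_box => /out.
by rewrite e eqxx.
Qed.
End Expansion.

Local Close Scope ring_scope.

(** * Induction on the second factor *)

Lemma sorted_top m la : sorted geq la -> all (leq^~ m) la ->
  la = nseq (count_mem m la) m ++ drop (count_mem m la) la.
Proof.
elim: la => //= x la IH hs /andP[hx ha]; have [e|h] := eqVneq x m.
  by rewrite e /= -IH // (path_sorted hs).
have hc : count_mem m la = 0.
  apply/eqP; rewrite -leqn0 leqNgt -has_count; apply/hasPn => y hy /=.
  have tr : transitive geq by exact: rev_trans leq_trans.
  have := order_path_min tr hs => /allP/(_ y hy) /= h2.
  by rewrite neq_ltn (leq_ltn_trans h2) // ltn_neqAle h hx.
by rewrite hc add0n drop0.
Qed.

Lemma vstripb_eq p q : vstripb p q -> sumn p = sumn q -> p = q.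
Proof.
elim: p q => [|a p IH] [|b q] //= /andP[h1 h2] h3.
have h4 := vstripb_sumn h2; have e : b = a by lia.
by rewrite e (IH q) //; lia.
Qed.

(* the induction removes one box from every row of maximal length, counted by
   lexicographic order on (largest part, its multiplicity) *)
Definition measure n (la : seq nat) := head 0 la * n.+1 + count_mem (head 0 la) la.

Lemma measure_lt n la m k : size la = n -> head 0 la < m -> measure n la < m * n.+1 + k.
Proof.
move=> hs h; rewrite /measure; have := count_size (pred1 (head 0 la)) la; rewrite hs.
by move=> h2; have : (head 0 la).+1 * n.+1 <= m * n.+1; [rewrite leq_mul2r h orbT | rewrite mulSn]; lia.
Qed.

Section Top.
Variables (n m k : nat) (rest : seq nat).
Let nu := nseq k m ++ rest.
Let nu' := nseq k m.-1 ++ rest.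
Hypotheses (m0 : 0 < m) (k0 : 0 < k) (hrest : all (ltn^~ m) rest) (hs : size nu = n).

Lemma vstripk_top : vstripk k nu' nu.
Proof.
rewrite /vstripk /nu /nu' vstripb_cat ?size_nseq // vstripb_refl andbT; apply/andP; split.
  by elim: (k) => //= j ->; rewrite andbT (prednK m0) eqxx orbT.
rewrite !sumn_cat !sumn_nseq; apply/eqP; case: (m) m0 => //= j _; lia.
Qed.

(** If [la] has at least [k] parts equal to [m], the strip spends its [k] boxes on the first [k]
    rows and [la] is [nu]. Otherwise the first part or its multiplicity drops. *)
Lemma vstripk_top_lt la : sorted geq la -> vstripk k nu' la -> la != nu ->
  measure n la < m * n.+1 + k.
Proof.
move=> sla /andP[hv /eqP hsum] hne; have hsz : size la = n.
  by rewrite -(vstripb_size hv) -hs !size_cat !size_nseq.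
have hla : all (leq^~ m) la.
  apply/(all_nthP 0) => i _; have /andP[_ h] := nth_vstripb i hv; apply: leq_trans h _.
  rewrite -(prednK m0) ltnS nth_cat size_nseq nth_nseq; case: (ltnP i k) => // _.
  case: (ltnP (i - k) (size rest)) => h; last by rewrite nth_default.
  by rewrite -ltnS (prednK m0); apply: (all_nthP 0 hrest).
have : head 0 la <= m by case: (la) hla => //= ? ? /andP[].
rewrite leq_eqVlt => /orP[/eqP hh|]; last exact: measure_lt.
rewrite /measure hh ltn_add2l ltnNge; apply: contra hne => hk.
have ht : take k la = nseq k m.
  by rewrite (sorted_top sla hla) takel_cat ?size_nseq // take_nseq.
have hv2 := hv; rewrite -(cat_take_drop k la) ht vstripb_cat ?size_nseq // in hv2.
have /andP[_ hv3] := hv2; rewrite -(cat_take_drop k la) ht /nu eq_sym; apply/eqP; congr (_ ++ _).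
apply: vstripb_eq hv3 _; move: hsum; rewrite -{1}(cat_take_drop k la) ht /nu' !sumn_cat !sumn_nseq.
case: (m) m0 => //= j _; lia.
Qed.
End Top.

Local Open Scope ring_scope.

Theorem schur_product (R : comNzRingType) (X : nat -> R) n u nu :
  size u = n -> sorted geq nu -> size nu = n ->
  expands X n u (gt_schur X n (npart u) * gt_schur X n nu) (box_coef n u nu).
Proof.
move=> hu; have [M] := ubnP (measure n nu); elim: M nu => // M IH nu hM snu hs.
have [h0|m0] := posnP (head 0%N nu).
  have enu : nu = nseq n 0%N.
    apply: (@eq_from_nth _ 0%N); rewrite ?size_nseq // => i _.
    have := nth_sorted snu (leq0n i); rewrite nth0 h0 leqn0 => /eqP->.
    by rewrite nth_nseq if_same.
  have hub : u \in box n (nzeros u) by rewrite mem_box hu !eqxx.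
  rewrite enu gt_schur_zero mulr1; exists n, (fun la => (la == npart u)%:R); split=> //.
  - by move=> la; case: eqP => // ->; rewrite (npart_in_nlists (leqnn n) hub).
  - have /andP[h1 _] := npart_in_nlists (leqnn n) hub.
    rewrite (bigD1_seq _ h1 (nlists_uniq _ _)) /= eqxx mul1r big1 ?addr0 // => la /negPf->.
    by rewrite mul0r.
  move=> w; rewrite mem_box => /andP[/eqP hw /eqP hz].
  pose v0 := nseq (nzeros u) false ++ nseq (ones u) true.
  have hv0 : v0 \in box n (nzeros u).
    rewrite mem_box size_cat !size_nseq nzeros_ones hu eqxx /nzeros count_cat !count_nseq /=.
    by rewrite mul1n mul0n addn0.
  have -> : nseq n 0%N = npart v0 by rewrite npart_zero nzeros_ones hu.
  rewrite (box_coef_npart _ hv0) // (puz_box_base hu hw); congr (nat_of_bool _)%:R.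
  by apply/eqP/eqP => [|->] //; apply: npart_inj; rewrite ?hw ?hz.
set m := head 0%N nu in m0 *; pose k := count_mem m nu.
have anu : all (leq^~ m) nu.
  by apply/(all_nthP 0%N) => i _; rewrite /m -nth0; apply: nth_sorted.
have enu := sorted_top snu anu; rewrite -/k in enu.
have k0 : (0 < k)%N by rewrite -has_count has_pred1; move: m0; rewrite /m; case: (nu) => //= x s _; exact: mem_head.
set rest := drop k nu in enu.
have hrest : all (ltn^~ m) rest.
  apply/allP => y hy /=; have hy2 : (y <= m)%N by apply: (allP anu); apply: mem_drop hy.
  rewrite ltn_neqAle hy2 andbT; apply/eqP => e.
  have : (0 < count_mem m rest)%N by rewrite -has_count has_pred1 -e.
  have : count_mem m nu = (k + count_mem m rest)%N by rewrite {1}enu count_cat count_nseq /= eqxx mul1n.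
  by rewrite -/k; lia.
pose nu' := nseq k m.-1 ++ rest.
have hs' : size nu' = n by rewrite -hs enu !size_cat !size_nseq.
have hsn : size (nseq k m ++ rest) = n by rewrite -enu.
have snu' : sorted geq nu'.
  have tr : transitive geq by exact: rev_trans leq_trans.
  have srest : sorted geq rest by apply: drop_sorted.
  rewrite /nu'; elim: (k) => //= j; case: j => [_|j /= ->]; last by rewrite leqnn.
  rewrite /= path_min_sorted //; apply/allP => y /(allP hrest) /=.
  by rewrite -[in X in X -> _](prednK m0).
have hd' : head 0%N nu' = m.-1 by rewrite /nu'; case: (k) k0.
have hB : (head 0%N nu' < m.+1)%N by rewrite hd' ltnS leq_pred.
have hmeas : measure n nu = (m * n.+1 + k)%N by [].
have ltM la : (measure n la < m * n.+1 + k)%N -> (measure n la < M)%N.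
  by rewrite -hmeas => h; apply: leq_trans h _.
have hlt' : (measure n nu' < M)%N by apply/ltM/measure_lt; rewrite // hd' prednK.
have ih' := expands_elem k (IH nu' hlt' snu' hs').
pose P la := sorted geq la && vstripk k nu' la.
pose others := [seq la <- nlists n m.+1 | P la && (la != nu)].
have ihs : expands X n u (\sum_(la <- others) gt_schur X n (npart u) * gt_schur X n la)
    (fun w => \sum_(la <- others) box_coef n u la w).
  apply: expands_sum => la; rewrite mem_filter mem_nlists => /andP[/andP[/andP[sla hk] hne] /andP[/eqP hla _]].
  apply: IH => //; apply: ltM; apply: (vstripk_top_lt m0 k0 hrest hsn sla hk).
  by rewrite -enu.
have hin : nu \in nlists n m.+1.
  by rewrite mem_nlists hs eqxx; apply: sub_all anu => i hi; apply: leqW.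
have hP : P nu by rewrite /P snu /= [X in vstripk _ _ X]enu; apply: vstripk_top.
have split (V : nmodType) (F : seq nat -> V) :
    \sum_(la <- nlists n m.+1 | P la) F la = F nu + \sum_(la <- others) F la.
  by rewrite big_mkcond (bigD1_seq nu hin (nlists_uniq _ _)) /= hP big_filter [in RHS]big_mkcondl.
(* [s_nu] is isolated as [e_k s_nu'] minus the other terms of the Pieri rule, all of smaller
   measure. *)
have := expandsB ih' ihs; set f := _ - _; have -> : f = gt_schur X n (npart u) * gt_schur X n nu.
  rewrite /f mulrCA (pieri_coef _ _ hs' snu' hB) -mulr_sumr -mulrBr; congr (_ * _).
  apply/eqP; rewrite subr_eq -split; apply/eqP.
  rewrite big_mkcond [RHS]big_mkcond; apply: eq_bigr => la _; rewrite /P.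
  by case: (boolP (sorted geq la)) => //= h; rewrite gt_schur_sorted // if_same.
move=> h; apply: expands_ext h _ => w hw.
(* The puzzle numbers satisfy the same relation, by the exchange with the line. *)
by rewrite -(box_coef_exchange hu k hw snu' hs' hB) -/P split addrK.
Qed.

Local Close Scope ring_scope.

(** * From padded lists to partitions, and uniqueness of the coefficients *)

Lemma partsE k w :
  parts k w = [seq k + count id (take j w) | j <- iota 0 (size w) & ~~ nth false w j].
Proof.
elim: w k => //= b w IH k.
have e : iota 1 (size w) = map succn (iota 0 (size w)) by rewrite (iotaDl 1).
case: b => /=; rewrite IH e filter_map -map_comp.
  by apply: eq_map => j /=; rewrite addSnnS add1n.
by rewrite addn0; congr (_ :: _); apply: eq_map => j.
Qed.

Definition trim (la : seq nat) : seq nat := [seq i <- la | 0 < i].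
Definition pad (n : nat) (la : seq nat) : seq nat := la ++ nseq (n - size la) 0.

Lemma lam_npart w : lam w = trim (npart w).
Proof.
have -> : lam w = rev [seq k <- parts 0 w | 0 < k] by rewrite partsE.
by rewrite /trim filter_cat filter_rev (filter_nseq _ _ 0) /= cats0.
Qed.

Lemma pad_trim n la : sorted geq la -> size la = n -> pad n (trim la) = la.
Proof.
elim: la n => [|x la IH] n h hs; rewrite /pad /=; first by rewrite -hs.
move: hs => /= <-; case: x h => [|x] h /=; last first.
  by congr (_ :: _); rewrite subSS; apply: IH => //; apply: path_sorted h.
have tr : transitive geq by exact: rev_trans leq_trans.
have h0 : la = nseq (size la) 0.
  apply/all_pred1P/allP => y hy; have := order_path_min tr h => /allP/(_ y hy) /=.
  by rewrite leqn0.
rewrite h0 /trim filter_nseq /= size_nseq.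
by [].
Qed.

Lemma trim_pad n la : is_part la -> trim (pad n la) = la.
Proof.
move=> /andP[_ h]; rewrite /trim filter_cat filter_nseq /= cats0.
exact/all_filterP.
Qed.

Lemma is_part_trim la : sorted geq la -> is_part (trim la).
Proof.
move=> h; rewrite /is_part filter_all andbT; apply: sorted_filter h.
exact: rev_trans leq_trans.
Qed.

Lemma size_pad n la : size la <= n -> size (pad n la) = n.
Proof. by move=> h; rewrite size_cat size_nseq subnKC. Qed.

Lemma le_sumn (s : seq nat) x : x \in s -> x <= sumn s.
Proof.
elim: s => //= y s IH; rewrite inE => /orP[/eqP->|/IH h]; first exact: leq_addr.
exact: leq_trans h (leq_addl _ _).
Qed.

Local Open Scope ring_scope.

Lemma gt_schur_ext (R : comNzRingType) (X Y : nat -> R) n la :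
  (forall i, (i < n)%N -> X i = Y i) -> gt_schur X n la = gt_schur Y n la.
Proof.
elim: n la => //= n IH la h; apply: eq_bigr => ka _; rewrite h // IH // => i hi.
by apply: h; apply: ltnW.
Qed.

Section Uniqueness.
Variables (n : nat).
Notation S := (gt_schur (@xvar n) n).

Lemma schur_pad ka : is_part ka -> (size ka <= n)%N -> schur n ka = S (pad n ka).
Proof. by move=> /andP[h _] h2; apply: schur_gt. Qed.

Notation kron_morph B := (mmap (@polyC int) (fun i : 'I_n => kron B i)).

Lemma kron_morph_schur B la : kron_morph B (S la) = gt_schur (kron B) n la.
Proof.
rewrite (gt_schur_morph (kron_morph B)); apply: gt_schur_ext => i hi /=.
by rewrite /xvar insubT /= mmapX mmap1U.
Qed.

Lemma schur_indep (s : seq (seq nat)) (d : seq nat -> int) : uniq s ->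
  (forall la, la \in s -> (size la == n) && sorted geq la) ->
  \sum_(la <- s) (d la)%:~R * S la = 0 -> forall la, la \in s -> d la = 0.
Proof.
(* [B] exceeds every part of every shape in [s], so parts are base-[B] digits. *)
move=> us hs h0; pose B := (sumn (map sumn s)).+1.
have hB : forall la, la \in s -> [&& size la == n, sorted geq la & all (ltn^~ B) la].
  move=> la hla; have /andP[-> ->] := hs la hla; apply/allP => x hx /=; rewrite ltnS.
  apply: leq_trans (le_sumn hx) _; apply: le_sumn; exact: map_f.
apply: (gt_schur_indep (n := n) us hB); have h1 := congr1 (kron_morph B) h0.
rewrite rmorph0 rmorph_sum /= in h1; rewrite -[RHS]h1; apply: eq_bigr => la _.
by rewrite rmorphM rmorph_int /= kron_morph_schur -[d la in LHS]intz scaler_int mulrzl.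
Qed.
End Uniqueness.

Theorem puz_LR n u v w : size u = n -> size v = n -> size w = n ->
  nzeros u = nzeros v -> nzeros v = nzeros w ->
  is_LR_coeff n (lam w) (lam u) (lam v) (Posz (puz u v w)).
Proof.
move=> hu hv hw huv hvw.
have slam x : size x = n -> [/\ is_part (lam x), (size (lam x) <= n)%N & pad n (lam x) = npart x].
  move=> hx; rewrite lam_npart is_part_trim ?npart_sorted // pad_trim ?npart_sorted ?size_npart //.
  by split=> //; rewrite size_filter; apply: leq_trans (count_size _ _) _; rewrite size_npart hx.
have [pu su eu] := slam u hu; have [pv sv ev] := slam v hv; have [pw sw ew] := slam w hw.
have [B [D [hB sD prod hD]]] := schur_product (@xvar n) hu (npart_sorted v) (etrans (size_npart v) hv).
rewrite -eu -ev -!schur_pad // in prod.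
pose P := [seq la <- nlists n B | sorted geq la].
have hP la : la \in P -> (size la == n) && sorted geq la.
  by rewrite mem_filter mem_nlists => /andP[-> /andP[-> _]].
have uP : uniq P by apply/filter_uniq/nlists_uniq.
have prodP : schur n (lam u) * schur n (lam v) = \sum_(la <- P) (D la)%:~R * gt_schur (@xvar n) n la.
  rewrite prod big_filter [RHS]big_mkcond; apply: eq_bigr => la _; case: ifP => // /negbT h.
  by rewrite gt_schur_sorted // mulr0.
have wP : npart w \in P.
  have hwb : w \in box n (nzeros u) by rewrite mem_box hw huv hvw !eqxx.
  by have /andP[h1 h2] := npart_in_nlists hB hwb; rewrite mem_filter h2 h1.
have Dw : D (npart w) = Posz (puz u v w).
  rewrite hD ?mem_box ?hw ?huv ?hvw ?eqxx // box_coef_npart ?mem_box ?hv ?huv ?eqxx //.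
  by rewrite natz.
have scaleE (d : int) (p : {mpoly int[n]}) : d *: p = d%:~R * p.
  by rewrite -[d in LHS]intz scaler_int mulrzl.
split.
  (* The expansion from [schur_product], with zero parts removed from the shapes. *)
  exists (map trim P), (fun ka => D (pad n ka)); split.
  - rewrite map_inj_in_uniq // => x y /hP/andP[/eqP hx sx] /hP/andP[/eqP hy sy] e.
    by rewrite -(pad_trim sx hx) -(pad_trim sy hy) e.
  - apply/allP => ka /mapP[la /hP/andP[/eqP hs sl] ->]; rewrite is_part_trim //=.
    by rewrite size_filter; apply: leq_trans (count_size _ _) _; rewrite hs.
  rewrite prodP big_map big_seq [RHS]big_seq; apply: eq_bigr => la /hP/andP[/eqP hs sl].
  rewrite pad_trim // scaleE schur_pad ?is_part_trim ?pad_trim //.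
  by rewrite size_filter; apply: leq_trans (count_size _ _) _; rewrite hs.
move=> ks d [uks hks e].
have hks2 ka : ka \in ks -> is_part ka /\ (size ka <= n)%N by move=> /(allP hks)/andP.
pose s := undup (map (pad n) ks ++ P).
(* The difference of the two expansions over their joint index set [s]; independence gives
   [E (npart w) = 0]. *)
pose E la : int := (if trim la \in ks then d (trim la) else 0) - (if la \in P then D la else 0).
have hs la : la \in s -> (size la == n) && sorted geq la.
  rewrite mem_undup mem_cat => /orP[/mapP[ka hka ->]|]; last exact: hP.
  have [h1 h2] := hks2 ka hka; rewrite size_pad // eqxx; apply: sorted_pad.
  by case/andP: h1.
have : E (npart w) = 0.
  apply: (schur_indep (n := n) (s := s) (undup_uniq _) hs); last by rewrite mem_undup mem_cat wP orbT.
  have -> : \sum_(la <- s) (E la)%:~R * gt_schur (@xvar n) n la =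
     \sum_(la <- s) (if trim la \in ks then d (trim la) else 0)%:~R * gt_schur (@xvar n) n la -
     \sum_(la <- s) (if la \in P then D la else 0)%:~R * gt_schur (@xvar n) n la.
    by rewrite -sumrB; apply: eq_bigr => la _; rewrite rmorphB mulrBl.
  apply/eqP; rewrite subr_eq0; apply/eqP.
  transitivity (schur n (lam u) * schur n (lam v)); last rewrite prodP; rewrite ?e.
    transitivity (\sum_(la <- map (pad n) ks) (if trim la \in ks then d (trim la) else 0)%:~R * gt_schur (@xvar n) n la).
      apply: sum_subset; rewrite ?undup_uniq //.
      - rewrite map_inj_in_uniq // => x y hx hy exy.
        by rewrite -(trim_pad n (proj1 (hks2 _ hx))) exy trim_pad // (proj1 (hks2 _ hy)).
      - move=> la hla hn; case: ifP => h; last by rewrite mul0r.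
        case/negP: hn; have /andP[/eqP h1 h2] := hs la hla.
        by rewrite -(pad_trim h2 h1) map_f.
      - by move=> la hla; rewrite mem_undup mem_cat hla.
    rewrite big_map big_seq [RHS]big_seq; apply: eq_bigr => ka hka.
    have [h1 h2] := hks2 ka hka; rewrite trim_pad // hka scaleE schur_pad //.
  rewrite [RHS](@sum_subset _ _ _ P) ?undup_uniq //.
  - by rewrite big_seq [RHS]big_seq; apply: eq_bigr => la ->.
  - by move=> la _ /negPf->; rewrite mul0r.
  - by move=> la hla; rewrite mem_undup mem_cat hla orbT.
by rewrite /E wP -lam_npart Dw => /eqP; rewrite subr_eq0 => /eqP.
Qed.

Local Close Scope ring_scope.

(** * The excess identity *)

(** One incoming and one outgoing edge, for both colours: at an even vertex [T_] goes out and [F_]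
    comes in, at an odd vertex the reverse. *)
Definition ok4 (a b c d : lab) : bool :=
  (count_mem F_ [:: a; b; c; d] == 1) && (count_mem T_ [:: a; b; c; d] == 1).

(* the local patterns counted by the excess d(w) - d(u) - d(v) *)
Definition bad_even (l t r : lab) : nat :=
  match t with
  | Some false => if l == T_ then 2 else 1
  | Some true => if r == F_ then 2 else 1
  | None => (l == T_) && (r == F_)
  end.

Definition bad_odd (l t r d : lab) : nat :=
  (t == N_) && [|| (d == F_) && (r == T_), (l == F_) && (r == T_) | (l == F_) && (d == T_)].

Local Open Scope ring_scope.

(* charges of the letters of an interface between two rows; odd positions lie
   below even vertices, even positions lie below odd vertices *)
Definition rho (b : bool) (x : lab) : int := if b then (x == F_)%:R else - (x == F_)%:R.
Definition rho' (b : bool) (x : lab) : int := if b then (x == T_)%:R else - (x == T_)%:R.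
Definition tau (b : bool) (x : lab) : int := if b then (x == N_)%:R else (x != N_)%:R.

Section Prefix.
Variable f : nat -> lab.
Definition cF (m : nat) : int := \sum_(i < m) rho (odd i) (f i).
Definition cT (m : nat) : int := \sum_(i < m) rho' (odd i) (f i).
Definition cN (m : nat) : int := \sum_(i < m) tau (odd i) (f i).
(** For the interface carrying [w], the sums [cF], [cT] and [winv] are the numbers of zeros, ones
    and inversions. The other terms extend them to interfaces with missing letters or with letters
    below odd vertices. *)
Definition winv (m : nat) : int := \sum_(i < m)
  ((cT i + cN i) * rho (odd i) (f i) + cT i * tau (odd i) (f i) - (~~ odd i && (f i != N_))%:R).

Lemma cFS m : cF m.+1 = cF m + rho (odd m) (f m). Proof. exact: big_ord_recr. Qed.
Lemma cTS m : cT m.+1 = cT m + rho' (odd m) (f m). Proof. exact: big_ord_recr. Qed.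
Lemma cNS m : cN m.+1 = cN m + tau (odd m) (f m). Proof. exact: big_ord_recr. Qed.
Lemma winvS m : winv m.+1 = winv m +
  ((cT m + cN m) * rho (odd m) (f m) + cT m * tau (odd m) (f m) - (~~ odd m && (f m != N_))%:R).
Proof. exact: big_ord_recr. Qed.
Lemma cF0 : cF 0 = 0. Proof. exact: big_ord0. Qed.
Lemma cT0 : cT 0 = 0. Proof. exact: big_ord0. Qed.
Lemma cN0 : cN 0 = 0. Proof. exact: big_ord0. Qed.
Lemma winv0 : winv 0 = 0. Proof. exact: big_ord0. Qed.
End Prefix.

Section Row.
Variables (K : nat) (u v : bool) (h f g : nat -> lab).
Hypothesis hL : (h 0%N, g 0%N) \in (if u then [:: (F_, N_); (N_, F_)] else [:: (N_, N_)]).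
Hypothesis hv : forall j, (j < K.*2.+1)%N -> ok4 (h j) (f j) (h j.+1) (g j.+1).
Hypothesis hR : (h K.*2.+1, g K.*2.+2) \in (if v then [:: (N_, N_)] else [:: (T_, N_); (N_, T_)]).

Definition row_bad (m : nat) : nat :=
  (\sum_(j < m) if odd j then bad_odd (h j) (f j) (h j.+1) (g j.+1) else bad_even (h j) (f j) (h j.+1))%N.

(** Cutting a row at a horizontal edge, the interfaces above and below it differ by a correction
    depending on the label [h j], on [u], on the parity and on the prefix sums, besides the bad
    patterns passed. With it explicit, each step is a finite case check. [g] is one letter ahead
    since the interface below extends further on both sides. *)
Lemma row_prefix j : (j <= K.*2.+1)%N ->
  let m1 : int := (h j == F_)%:R in let m2 : int := (h j == T_)%:R in let U : int := u%:R in
  let e : int := (odd j)%:R in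
  [/\ cF g j.+1 = cF f j + (if odd j then 1 - U - m1 else m1 - U),
      cT g j.+1 = cT f j + (if odd j then 1 - m2 else m2),
      cN g j.+1 = cN f j + (if odd j then U + m1 + m2 - 1 else U - m1 - m2) &
      winv g j.+1 = winv f j + (row_bad j)%:R +
        (if odd j then U * cF f j + m2 * cT f j - m1 * cN f j - U * m1
         else U * cF f j + m1 * cN f j - m2 * cT f j - cN f j + U * (m1 - 1))].
Proof.
elim: j => [_|j IH hj].
  rewrite /= !(cFS, cTS, cNS, winvS) !(cF0, cT0, cN0, winv0) /row_bad big_ord0 /rho /rho' /tau /=.
  by move: hL; case: u; rewrite !inE; [move=> /orP[]|] => /eqP[-> ->].
have /= [e1 e2 e3 e4] := IH (ltnW hj).
have := hv hj => /=.
rewrite !(cFS _ j.+1, cTS _ j.+1, cNS _ j.+1, winvS _ j.+1) e1 e2 e3 e4.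
rewrite !(cFS f j, cTS f j, cNS f j, winvS f j) /row_bad big_ord_recr /= -/(row_bad j) natrD.
rewrite /rho /rho' /tau /bad_odd /bad_even.
move: (cF f j) (cT f j) (cN f j) (winv f j) (row_bad j) => P P' Pt I B.
case: (odd j) => /=; case: u; case: (h j) => [[|]|]; case: (f j) => [[|]|]; case: (h j.+1) => [[|]|]; case: (g j.+1) => [[|]|] //= _; clear; split; lia.
Qed.

(** The last two terms of [winv] are those gained by [dinv] when [u] gets a new first letter and [v]
    a new last one. *)
Lemma row_total : [/\ cF g K.+1.*2.+1 = cF f K.*2.+1 + (~~ u)%:R,
    cT g K.+1.*2.+1 = cT f K.*2.+1 + v%:R &
    winv g K.+1.*2.+1 = winv f K.*2.+1 + (row_bad K.*2.+1)%:R +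
      u%:R * cF f K.*2.+1 + (~~ v)%:R * cT f K.*2.+1].
Proof.
have /= := row_prefix (leqnn K.*2.+1); rewrite odd_double /= => -[e1 e2 e3 e4].
rewrite doubleS !(cFS _ K.*2.+2, cTS _ K.*2.+2, winvS _ K.*2.+2) e1 e2 e3 e4 /= odd_double /=.
rewrite /rho /rho' /tau; move: (cF f _) (cT f _) (cN f _) (winv f _) (row_bad _) => P P' Pt I B.
by move: hR; case: v; rewrite !inE; [|move=> /orP[]] => /eqP[-> ->]; case: u => /=; split; lia.
Qed.
End Row.

Lemma dinv_cons b s : dinv (b :: s) = (b * nzeros s + dinv s)%N.
Proof.
rewrite /dinv /= big_ord_recl; congr addn; last first.
  by apply: eq_bigr => i _; rewrite big_ord_recl.
rewrite big_ord_recl /= add0n.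
case: b => /=; last by rewrite big1.
rewrite mul1n /nzeros -sum1_count (big_nth false) big_mkord [RHS]big_mkcond.
by apply: eq_bigr => i _; case: nth.
Qed.

Lemma dinv_rcons s b : dinv (rcons s b) = (dinv s + ~~ b * ones s)%N.
Proof.
elim: s => [|x s IH] /=; first by rewrite dinv_cons /nzeros /= !muln0 addn0.
rewrite !dinv_cons IH {IH} /nzeros -cats1 count_cat /= addn0.
by case: x; case: b => /=; lia.
Qed.

Lemma winv_word (w : seq bool) f m : (m <= size w)%N ->
  (forall i, (i <= size w)%N -> f i.*2 = N_) ->
  (forall i, (i < size w)%N -> f i.*2.+1 = Some (nth false w i)) ->
  [/\ cF f m.*2.+1 = (nzeros (take m w))%:R, cT f m.*2.+1 = (ones (take m w))%:R,
      cN f m.*2.+1 = 0 & winv f m.*2.+1 = (dinv (take m w))%:R].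
Proof.
elim: m => [|m IH] hm h0 h1.
  rewrite take0 !(cFS, cTS, cNS, winvS, cF0, cT0, cN0, winv0) /= (h0 0%N) //.
  by rewrite /rho /rho' /tau /= /dinv big_ord0.
have [e1 e2 e3 e4] := IH (ltnW hm) h0 h1.
rewrite doubleS !(cFS _ m.*2.+2, cTS _ m.*2.+2, cNS _ m.*2.+2, winvS _ m.*2.+2).
rewrite !(cFS _ m.*2.+1, cTS _ m.*2.+1, cNS _ m.*2.+1, winvS _ m.*2.+1) e1 e2 e3 e4.
rewrite -doubleS (h0 _ hm) (h1 _ hm) /= odd_double /= /rho /rho' /tau (take_nth false hm).
rewrite dinv_rcons /nzeros -cats1 !count_cat /= !addn0.
by case: (nth false w m) => /=; split; lia.
Qed.

(* [h k j] labels the edge joining the vertices number [j] and [j.+1] of row [k], and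
   [f k i] the [i]-th vertical edge between the rows [k.-1] and [k]; the word [w] is
   written as labels of fictitious edges below the bottom row *)
Section Labelling.
Variables (N : nat) (u v w : seq bool) (h f : nat -> nat -> lab).

Definition left_ok (b : bool) (x y : lab) : bool :=
  (x, y) \in (if b then [:: (F_, N_); (N_, F_)] else [:: (N_, N_)]).
Definition right_ok (b : bool) (x y : lab) : bool :=
  (x, y) \in (if b then [:: (N_, N_)] else [:: (T_, N_); (N_, T_)]).

Definition labelling : Prop :=
  [/\ f 0%N 0%N = N_,
      forall k, (k < N)%N -> left_ok (nth false u (N - k.+1)) (h k 0%N) (f k.+1 0%N),
      forall k j, (k < N)%N -> (j < k.*2.+1)%N -> ok4 (h k j) (f k j) (h k j.+1) (f k.+1 j.+1),
      forall k, (k < N)%N -> right_ok (nth false v k) (h k k.*2.+1) (f k.+1 k.*2.+2) &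
      (forall i, (i <= N)%N -> f N i.*2 = N_) /\
      (forall i, (i < N)%N -> f N i.*2.+1 = Some (nth false w i))].

Hypotheses (hu : size u = N) (hv : size v = N) (hw : size w = N).

Lemma labelling_inv : labelling -> forall k, (k <= N)%N ->
  [/\ cF (f k) k.*2.+1 = (nzeros (drop (N - k) u))%:R,
      cT (f k) k.*2.+1 = (ones (take k v))%:R &
      winv (f k) k.*2.+1 = (dinv (drop (N - k) u) + dinv (take k v) +
        \sum_(i < k) row_bad (h i) (f i) (f i.+1) i.*2.+1)%N%:R].
Proof.
move=> [f0 hL hV hR _]; elim=> [_|k IH hk].
  rewrite big_ord0 subn0 -hu drop_size take0 !(cFS, cTS, winvS, cF0, cT0, cN0, winv0) f0 /=.
  by rewrite /rho /rho' /tau /= /dinv !big_ord0.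
have [e1 e2 e3] := IH (ltnW hk).
have [-> -> ->] := row_total (hL k hk) (fun j => hV k j hk) (hR k hk).
rewrite e1 e2 e3 big_ord_recr /=.
have hd : drop (N - k.+1) u = nth false u (N - k.+1) :: drop (N - k) u.
  by rewrite (drop_nth false) ?hu; [congr (_ :: drop _ _); lia | lia].
have ht : take k.+1 v = rcons (take k v) (nth false v k) by rewrite (take_nth false) // hv.
rewrite hd ht dinv_cons dinv_rcons /nzeros -cats1 count_cat /= addn0.
by case: (nth false u _); case: (nth false v _) => /=; split; lia.
Qed.

Lemma labelling_no_bad : labelling -> dinv w = (dinv u + dinv v)%N ->
  forall k j, (k < N)%N -> (j < k.*2.+1)%N ->
  (if odd j then bad_odd (h k j) (f k j) (h k j.+1) (f k.+1 j.+1)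
   else bad_even (h k j) (f k j) (h k j.+1)) = 0%N.
Proof.
move=> hl hd k j hk hj; have [_ _ e] := labelling_inv hl (leqnn N).
have [_ _ _ _ [h1 h2]] := hl; rewrite -{1}hw in h1; rewrite -{1}hw in h2.
have [_ _ _] := winv_word (f := f N) (leqnn (size w)) h1 h2; rewrite hw e subnn drop0.
have -> : take N v = v by rewrite -hv take_size.
have -> : take N w = w by rewrite -hw take_size.
move=> /eqP; rewrite eqr_nat hd => /eqP h3.
have /eqP : (\sum_(i < N) row_bad (h i) (f i) (f i.+1) i.*2.+1)%N = 0%N by lia.
rewrite sum_nat_eq0 => /forallP/(_ (Ordinal hk)) /=.
rewrite /row_bad sum_nat_eq0 => /forallP/(_ (Ordinal hj)) /eqP.
by [].
Qed.

Definition tiling : Prop :=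
  [/\ forall k i, (k <= N)%N -> (i <= k)%N -> f k i.*2 = N_,
      forall k, (k < N)%N -> h k 0%N = left_lab (nth false u (N - k.+1)) /\
                             h k k.*2.+1 = right_lab (nth false v k),
      forall k i, (k < N)%N -> (i <= k)%N -> up (h k i.*2) (h k i.*2.+1) (f k.+1 i.*2.+1),
      forall k i, (k < N)%N -> (i < k)%N -> dn (h k i.*2.+1) (f k i.*2.+1) (h k i.*2.+2) &
      forall i, (i < N)%N -> f N i.*2.+1 = Some (nth false w i)].

Lemma labelling_tiling : dinv w = (dinv u + dinv v)%N -> labelling -> tiling.
Proof.
move=> hd hl; have hbad := labelling_no_bad hl hd; have [_ hL hV hR [h1 h2]] := hl.
(* Any use of the edge above an even vertex is itself bad. *)
have f0 k i : (k <= N)%N -> (i <= k)%N -> f k i.*2 = N_.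
  rewrite leq_eqVlt => /orP[/eqP->|hk hi]; first exact: h1.
  have := hbad k i.*2 hk; rewrite ltnS leq_double hi odd_double => /(_ isT).
  by case: (f k _) => [[]|] //=; case: eqP.
split=> //.
- move=> k hk; have := hL k hk; have := hR k hk.
  rewrite (f0 k.+1 0%N) // -doubleS (f0 k.+1 k.+1) // /left_ok /right_ok.
  by case: (nth _ u _); case: (nth _ v _); case: (h k 0%N) => [[]|]; case: (h k _) => [[]|].
- move=> k i hk hi; have := hbad k i.*2 hk; have := hV k i.*2 hk.
  rewrite ltnS leq_double hi odd_double (f0 k i (ltnW hk) hi) => /(_ isT) + /(_ isT).
  by case: (h k _) => [[]|]; case: (h k _) => [[]|]; case: (f _ _) => [[]|].
move=> k i hk hi; have := hbad k i.*2.+1 hk; have := hV k i.*2.+1 hk.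
have -> : (i.*2.+1 < k.*2.+1)%N by lia.
rewrite /= odd_double -doubleS (f0 k.+1 i.+1 hk) ?(leqW hi) // => /(_ isT) + /(_ isT).
by case: (h k _) => [[]|]; case: (f _ _) => [[]|]; case: (h k _) => [[]|].
Qed.

Lemma tiling_labelling : f 0%N 0%N = N_ -> tiling -> labelling.
Proof.
move=> f00 [f0 hLR hU hD hB]; split=> //.
- move=> k hk; have [-> _] := hLR k hk; rewrite (f0 k.+1 0%N) // /left_ok.
  by case: (nth _ _ _).
- move=> k j hk hj; have := odd_double_half j; case: (odd j) => /= e; rewrite -e add0n || rewrite -e add1n.
    have hi : (j./2 < k)%N by lia.
    have := hD k j./2 hk hi; rewrite -doubleS (f0 k.+1 j./2.+1 hk) ?(leqW hi) //.
    by case: (h k _) => [[]|]; case: (f _ _) => [[]|]; case: (h k _) => [[]|].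
  have hi : (j./2 <= k)%N by lia.
  have := hU k j./2 hk hi; rewrite (f0 k j./2 (ltnW hk) hi).
  by case: (h k _) => [[]|]; case: (h k _) => [[]|]; case: (f _ _) => [[]|].
- move=> k hk; have [_ ->] := hLR k hk; rewrite -doubleS (f0 k.+1 k.+1) // /right_ok.
  by case: (nth _ _ _).
by split=> // i hi; apply: f0.
Qed.
End Labelling.

Local Close Scope ring_scope.

(** * Oriented TFPLs as puzzles *)

Fixpoint cells_ok (r : lab) (ts ds : seq lab) (v : lab) (hs : seq lab) : bool :=
  match ts, ds with
  | [::], [::] => (hs == [::]) && (r == v)
  | t :: ts', d :: ds' =>
      if hs is l :: r2 :: hs' then [&& dn r t l, up l r2 d & cells_ok r2 ts' ds' v hs'] else false
  | _, _ => false
  end.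

Definition row_ok (u : lab) (ts ds : seq lab) (v : lab) (hs : seq lab) : bool :=
  match ds, hs with
  | d :: ds', l :: r :: hs' => [&& l == u, up l r d & cells_ok r ts ds' v hs']
  | _, _ => false
  end.

Lemma sumn_words_cons (n : nat) (F : seq lab -> nat) :
  \sum_(s <- words labs n.+1) F s = \sum_(x <- labs) \sum_(s <- words labs n) F (x :: s).
Proof. exact: big_allpairs_dep. Qed.

Lemma count_sum (T : Type) (a : pred T) (s : seq T) : \sum_(x <- s) a x = count a s.
Proof. by rewrite -sum1_count [RHS]big_mkcond. Qed.

Lemma cells_count r ts ds v :
  \sum_(hs <- words labs (size ds).*2) cells_ok r ts ds v hs = cells r ts ds v.
Proof.
elim: ts ds r => [|t ts IH] [|d ds] r /=; [by rewrite /words big_seq1 | by rewrite big1 | by rewrite big1 |].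
rewrite doubleS sumn_words_cons; under eq_bigr do rewrite sumn_words_cons.
rewrite exchange_big; apply: eq_bigr => r2 _; rewrite /cell -count_sum big_distrl.
apply: eq_bigr => l _; rewrite -IH big_distrr; apply: eq_bigr => hs _ /=.
by case: (dn _ _ _); case: (up _ _ _); rewrite ?mul1n ?mul0n.
Qed.

Lemma row_count u ts ds v : \sum_(hs <- words labs (size ds).*2) row_ok u ts ds v hs = row u ts ds v.
Proof.
case: ds => [|d ds] /=; first by rewrite big1.
rewrite doubleS sumn_words_cons; under eq_bigr do rewrite sumn_words_cons.
rewrite exchange_big; apply: eq_bigr => r _.
have hu : u \in labs by case: (u) => [[]|].
rewrite (bigD1_seq u hu) //= [X in _ + X]big1 => [|l /negPf h]; last first.
  by rewrite big1 // => hs _; rewrite h.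
rewrite addn0 -cells_count big_distrr; apply: eq_bigr => hs _ /=.
by rewrite eqxx; case: (up _ _ _); rewrite ?mul1n ?mul0n.
Qed.

Definition rows := seq (seq lab * seq lab).

(** [puzzles] only counts; enumerating by the same recursion provides a target for a bijection with
    arc sets. *)
Fixpoint tilings (us vs ds : seq lab) : seq rows :=
  match us, vs with
  | [::], [::] => if ds == [::] then [:: [::]] else [::]
  | u :: us', v :: vs' =>
      [seq (p.2, ds) :: s | p <- [seq (ts, hs) | ts <- words labs (size us'),
                               hs <- [seq hs <- words labs (size ds).*2 | row_ok u ts ds v hs]],
                            s <- tilings us' vs' p.1]
  | _, _ => [::]
  end.

Lemma size_tilings us vs ds : size (tilings us vs ds) = puzzles us vs ds.
Proof.
elim: us vs ds => [|u us IH] [|v vs] ds //=; first by case: eqP.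
rewrite size_allpairs_dep sumnE big_map big_allpairs_dep /=; apply: eq_bigr => ts _.
by rewrite big_const_seq IH iter_addn_0 count_predT size_filter -count_sum row_count.
Qed.

Definition hrow (s : rows) m := (nth ([::], [::]) s m).1.
Definition drow (s : rows) m := (nth ([::], [::]) s m).2.

Lemma mem_words_labs n (s : seq lab) : (s \in words labs n) = (size s == n).
Proof. by rewrite mem_words andb_idr // => _; apply/allP => -[[]|]. Qed.

Lemma row_ok_size u ts ds v hs : row_ok u ts ds v hs ->
  size ds = (size ts).+1 /\ size hs = (size ds).*2.
Proof.
case: ds hs => [|d ds] [|l [|r hs]] //= /and3P[_ _].
suff: cells_ok r ts ds v hs -> size ds = size ts /\ size hs = (size ds).*2.
  by move=> h /h[e1 e2]; rewrite e2 -e1.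
elim: ts ds r hs => [|t ts IH] [|d' ds] r0 hs' //=; first by case: hs'.
by case: hs' => [|l' [|r' hs']] // /and3P[_ _ /IH[e1 e2]]; rewrite /= e2 -e1.
Qed.

Lemma tilingsP us vs ds s : reflect
  [/\ size s = size us, size vs = size us, drow s 0 = ds &
      forall m, m < size us -> size (drow s m.+1) = size us - m.+1 /\
        row_ok (nth N_ us m) (drow s m.+1) (drow s m) (nth N_ vs m) (hrow s m)]
  (s \in tilings us vs ds).
Proof.
elim: us vs ds s => [|u us IH] [|v vs] ds s /=.
- case: (eqVneq ds [::]) => [->|h]; last by constructor=> -[/size0nil-> _ e]; rewrite -e eqxx in h.
  rewrite inE; apply: (iffP eqP) => [->|[/size0nil->]] //.
- by constructor=> -[].
- by constructor=> -[].
apply: (iffP allpairsPdep) => [[[ts hs] [s' [/allpairsPdep[ts' [hs' [h1 h2 [e1 e2]]]] h3 ->]]]|].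
  rewrite e1 e2 {ts e1 hs e2} /= in h3 *; have [a1 a2 a3 a4] := IH _ _ _ h3.
  rewrite a1 a2; split=> // -[_|m hm]; last exact: a4.
  rewrite /drow /hrow /= -/(drow s' 0) a3 subn1 /=.
  by move: h1 h2; rewrite mem_words_labs mem_filter => /eqP-> /andP[-> _].
case: s => [|[hs ds'] s'] [] //= [a1] [a2] e a4; rewrite /drow /= in e; subst ds'.
have [b1 b2] := a4 0 isT; rewrite subn1 /= in b1.
exists (drow s' 0, hs), s'; split=> //.
  apply/allpairsPdep; exists (drow s' 0), hs; split=> //; first by rewrite mem_words_labs b1.
  rewrite mem_filter mem_words_labs; have [_ ->] := row_ok_size b2.
  by rewrite eqxx andbT; exact: b2.
apply/IH; split=> // m hm; exact: (a4 m.+1 hm).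
Qed.

Lemma tilings_uniq us vs ds : uniq (tilings us vs ds).
Proof.
elim: us vs ds => [|u us IH] [|v vs] ds //=; first by case: ifP.
apply: allpairs_uniq_dep => //=.
- apply: allpairs_uniq_dep; first exact: words_uniq.
    by move=> ts _; apply/filter_uniq/words_uniq.
  by move=> [ts hs] [ts' hs'] _ _ /= [-> ->].
- move=> [[ts hs] s] [[ts' hs'] s'] /allpairsPdep[p [s1 [hp h1 e1]]] /allpairsPdep[p' [s2 [hp' h2 e2]]] /=.
  case: p hp h1 e1 => [tsa hsa] /= hp h1 [-> -> ->]; case: p' hp' h2 e2 => [tsb hsb] /= hp' h2 [-> -> ->].
  move=> [-> e]; rewrite -e in h2 *.
  have /tilingsP[_ _ <- _] := h1; have /tilingsP[_ _ <- _] := h2.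
  by [].
Qed.

Lemma cells_okP r ts ds v hs : reflect
  [/\ size ds = size ts, size hs = (size ds).*2, nth N_ (r :: hs) (size ds).*2 = v &
      forall i, i < size ds ->
        up (nth N_ (r :: hs) i.*2.+1) (nth N_ (r :: hs) i.*2.+2) (nth N_ ds i) /\
        dn (nth N_ (r :: hs) i.*2) (nth N_ ts i) (nth N_ (r :: hs) i.*2.+1)]
  (cells_ok r ts ds v hs).
Proof.
elim: ts ds r hs => [|t ts IH] [|d ds] r hs.
- apply: (iffP andP) => [[/eqP-> /eqP->] //|[_ /size0nil-> <-]]; by rewrite !eqxx.
- by constructor=> -[].
- by constructor=> -[].
case: hs => [|l [|r2 hs]]; [by constructor=> -[] | by constructor=> -[] |].
apply: (iffP and3P) => [[h1 h2 /IH[e1 e2 e3 e4]]|[[e1] [e2] e3 e4]].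
  split=> //=; [by rewrite e1 | by rewrite e2 |].
  by case=> [|i] hi //; exact: e4.
have [a1 a2] := e4 0 isT; split=> //; apply/IH; split=> //.
by move=> i hi; exact: (e4 i.+1).
Qed.

Lemma row_okP u ts ds v hs : reflect
  [/\ size ds = (size ts).+1, size hs = (size ds).*2,
      nth N_ hs 0 = u /\ nth N_ hs (size ts).*2.+1 = v,
      forall i, i < size ds -> up (nth N_ hs i.*2) (nth N_ hs i.*2.+1) (nth N_ ds i) &
      forall i, i < size ts -> dn (nth N_ hs i.*2.+1) (nth N_ ts i) (nth N_ hs i.*2.+2)]
  (row_ok u ts ds v hs).
Proof.
case: ds => [|d ds]; first by constructor=> -[].
case: hs => [|l [|r hs]]; [by constructor=> -[] | by constructor=> -[] |].
apply: (iffP and3P) => [[/eqP-> h2 /cells_okP[e1 e2 e3 e4]]|[[e1] [e2] [/= -> e3] e4 e5]].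
  rewrite -e1 /= e2; split=> // [[|i] hi|i hi] //; first exact: (e4 i hi).1.
  exact: (e4 i hi).2.
split; [exact: eqxx | exact: (e4 0) |apply/cells_okP; split=> //; first by rewrite e1].
by move=> i hi; split; [exact: (e4 i.+1) | apply: e5; rewrite -e1].
Qed.

Definition trows N (h f : nat -> nat -> lab) : rows :=
  mkseq (fun m => (mkseq (h (N - m.+1)) (N - m).*2,
                   mkseq (fun i => f (N - m) i.*2.+1) (N - m))) N.

Lemma size_trows N h f : size (trows N h f) = N.
Proof. exact: size_mkseq. Qed.

Lemma hrow_trows N h f m : m < N -> hrow (trows N h f) m = mkseq (h (N - m.+1)) (N - m).*2.
Proof. by move=> hm; rewrite /hrow nth_mkseq. Qed.

Lemma drow_trows N h f m : m <= N ->
  drow (trows N h f) m = mkseq (fun i => f (N - m) i.*2.+1) (N - m).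
Proof.
rewrite leq_eqVlt => /orP[/eqP->|hm]; last by rewrite /drow nth_mkseq.
by rewrite /drow nth_default ?size_mkseq // subnn.
Qed.

Section Rows.
Variables (N : nat) (u v w : seq bool).
Hypotheses (hu : size u = N) (hv : size v = N) (hw : size w = N).

Let us := map left_lab u.
Let vs := rev (map right_lab v).
Let ws : seq lab := map Some w.

Lemma tiling_trows h f : (forall k i, k <= N -> i <= k -> f k i.*2 = N_) ->
  (trows N h f \in tilings us vs ws) <-> tiling N u v w h f.
Proof.
have e1 k : k < N -> nth N_ us (N - k.+1) = left_lab (nth false u (N - k.+1)).
  by move=> hk; rewrite (nth_map false) // hu; lia.
have e2 k : k < N -> nth N_ vs (N - k.+1) = right_lab (nth false v k).
  move=> hk; rewrite nth_rev size_map hv; last by lia.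
  rewrite (nth_map false) ?hv; last by lia.
  by congr (right_lab (nth _ _ _)); lia.
have hus : size us = N by rewrite size_map.
move=> h0; split=> [/tilingsP[_ _ h1 h2]|[_ h1 h2 h3 h4]].
  rewrite hus in h2; split=> //.
  - move=> k hk; have hm : N - k.+1 < N by lia.
    have [_ /row_okP[_ _ ]] := h2 _ hm.
    rewrite e1 // e2 // hrow_trows // drow_trows // size_mkseq => -[<- <-] _ _.
    rewrite !nth_mkseq; try lia.
    by split; [congr h; lia | congr h; lia].
  - move=> k i hk hi; have hm : N - k.+1 < N by lia.
    have [_ /row_okP[_ _ _ + _]] := h2 _ hm.
    have hm2 : (N - (N - k.+1) = k.+1) by lia.
    have hm3 : (N - (N - k.+1).+1 = k) by lia.
    rewrite hrow_trows // drow_trows ?(ltnW hm) // size_mkseq hm2 hm3 => /(_ i hi).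
    by rewrite !nth_mkseq //; lia.
  - move=> k i hk hi; have hm : N - k.+1 < N by lia.
    have [_ /row_okP[_ _ _ _]] := h2 _ hm.
    have hm2 : (N - (N - k.+1) = k.+1) by lia.
    have hm3 : (N - (N - k.+1).+1 = k) by lia.
    rewrite hrow_trows // drow_trows // size_mkseq hm2 hm3 => /(_ i hi).
    by rewrite !nth_mkseq //; lia.
  move=> i hi; move: h1; rewrite drow_trows // subn0 => /(congr1 (nth N_ ^~ i)).
  by rewrite nth_mkseq // (nth_map false) // hw.
apply/tilingsP; rewrite size_trows hus size_rev size_map hv; split=> //.
  rewrite drow_trows // subn0; apply: (@eq_from_nth _ N_); first by rewrite size_mkseq size_map hw.
  by move=> i; rewrite size_mkseq => hi; rewrite nth_mkseq // h4 // (nth_map false) // hw.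
move=> m hm; rewrite drow_trows // size_mkseq; split=> //.
have hk : N - m.+1 < N by lia.
have em : N - (N - m.+1).+1 = m by lia.
have em2 : N - m = (N - m.+1).+1 by lia.
apply/row_okP; rewrite hrow_trows // drow_trows ?(ltnW hm) // !size_mkseq em2; split=> //.
- have [e3 e4] := h1 _ hk; rewrite !nth_mkseq; try lia.
  by rewrite e3 e4 -e1 // -e2 // em.
- by move=> i hi; rewrite !nth_mkseq; [apply: h2 | lia..].
by move=> i hi; rewrite !nth_mkseq; [apply: h3 | lia..].
Qed.

Lemma tilings_trows s : s \in tilings us vs ws -> exists h f,
  (forall k i, k <= N -> i <= k -> f k i.*2 = N_) /\ s = trows N h f.
Proof.
have hus : size us = N by rewrite size_map.
move=> /tilingsP[]; rewrite hus => hs _ h1 h2.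
exists (fun k => nth N_ (hrow s (N - k.+1))).
exists (fun k i => if odd i then nth N_ (drow s (N - k)) i./2 else N_).
split=> [k i _ _|]; first by rewrite odd_double.
apply: (@eq_from_nth _ ([::], [::])); first by rewrite size_trows.
move=> m; rewrite hs => hm; have [h3 /row_okP[e1 e2 _ _ _]] := h2 m hm.
rewrite h3 in e1; rewrite e1 in e2.
rewrite nth_mkseq // [LHS]surjective_pairing; congr (_, _).
  apply: (@eq_from_nth _ N_) => [|i hi]; first by rewrite size_mkseq -/(hrow s m) e2; lia.
  rewrite nth_mkseq; first by congr (nth _ (hrow s _)); lia.
  by move: hi; rewrite -/(hrow s m) e2; lia.
apply: (@eq_from_nth _ N_) => [|i hi]; first by rewrite size_mkseq -/(drow s m) e1; lia.
rewrite nth_mkseq; last by move: hi; rewrite -/(drow s m) e1; lia.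
rewrite /= odd_double /= uphalf_double; congr (nth _ (drow s _)); lia.
Qed.
End Rows.

Lemma trows_inj N h f h' f' : trows N h f = trows N h' f' ->
  (forall k j, k < N -> j < k.+1.*2 -> h k j = h' k j) /\
  (forall k i, k <= N -> i < k -> f k i.*2.+1 = f' k i.*2.+1).
Proof.
move=> e; split=> k i hk hi.
  have hm : N - k.+1 < N by lia.
  have hm2 : (N - (N - k.+1) = k.+1) by lia.
  have hm3 : (N - (N - k.+1).+1 = k) by lia.
  have := congr1 (fun s => nth N_ (hrow s (N - k.+1)) i) e.
  by rewrite !hrow_trows // hm2 hm3 !nth_mkseq.
have := congr1 (fun s => nth N_ (drow s (N - k)) i) e.
by rewrite !drow_trows ?leq_subr // subKn // !nth_mkseq.
Qed.

(** * Coordinates and neighbours in the graph *)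

Section Graph.
Variable N : nat.
Notation vtx := (Vtx N).

(* [j] counts the vertices of row [k] from the left *)
Definition vx (k j : nat) : vtx := (inord k, inord (j + (N - k.+1))).

Definition evenp (p : vtx) : bool := ~~ odd (val p.1 + val p.2 + N).

Lemma vx1 k j : k < N -> val (vx k j).1 = k.
Proof. by move=> hk; rewrite /= inordK // ltnS ltnW. Qed.

Lemma vx2 k j : k < N -> j <= k.*2.+2 -> val (vx k j).2 = j + (N - k.+1).
Proof. by move=> hk hj; rewrite /= inordK //; lia. Qed.

Lemma vx_in k j : k < N -> j <= k.*2.+2 -> in_G (vx k j).
Proof. by move=> hk hj; rewrite /in_G vx1 // vx2 //; lia. Qed.

Lemma vtx_eq (p q : vtx) : (p == q) = (val p.1 == val q.1) && (val p.2 == val q.2).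
Proof. by case: p q => [a b] [c d]. Qed.

Lemma in_vx (p : vtx) : in_G p -> exists k j, [/\ k < N, j <= k.*2.+2 & p = vx k j].
Proof.
move=> /and3P[h1 h2 h3]; exists (val p.1), (val p.2 - (N - (val p.1).+1)).
split=> //; first by lia.
by apply/eqP; rewrite vtx_eq vx1 // vx2 //; lia.
Qed.

Lemma vx_inj k j k' j' : k < N -> j <= k.*2.+2 -> k' < N -> j' <= k'.*2.+2 ->
  vx k j = vx k' j' -> k = k' /\ j = j'.
Proof.
move=> h1 h2 h3 h4 /eqP; rewrite vtx_eq !vx1 // !vx2 // => /andP[/eqP e1 /eqP e2].
by split=> //; move: e2; rewrite e1; lia.
Qed.

Lemma evenp_vx k j : k < N -> j <= k.*2.+2 -> evenp (vx k j) = odd j.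
Proof. by move=> h1 h2; rewrite /evenp vx1 // vx2 //; lia. Qed.

Lemma adj_sym (p q : vtx) : adjG p q = adjG q p.
Proof.
rewrite /adjG andbCA; congr (_ && (_ && _)).
by rewrite [val p.1 == _]eq_sym [val p.2 == val q.2]eq_sym
  [((val p.2).+1 == _) || _]orbC [((val p.1).+1 == _) || _]orbC.
Qed.

Lemma adj_even (p q : vtx) : adjG p q -> evenp q = ~~ evenp p.
Proof. by rewrite /adjG /evenp; lia. Qed.

Lemma adj_hor k j : k < N -> j < k.*2.+2 -> adjG (vx k j) (vx k j.+1).
Proof. by move=> h1 h2; rewrite /adjG !vx_in ?vx1 ?vx2 //; lia. Qed.

Lemma adj_ver k i : 0 < k < N -> i <= k.*2 -> adjG (vx k.-1 i) (vx k i.+1).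
Proof.
move=> /andP[h0 h1] h2.
have h3 : k.-1 < N by lia.
by rewrite /adjG !vx_in ?vx1 ?vx2 //; lia.
Qed.

Lemma adjP (p q : vtx) : adjG p q ->
  (exists k j, [/\ k < N, j < k.*2.+2 & [\/ p = vx k j /\ q = vx k j.+1 | q = vx k j /\ p = vx k j.+1]]) \/
  (exists k i, [/\ 0 < k < N, i <= k.*2 &
    [\/ p = vx k.-1 i /\ q = vx k i.+1 | q = vx k.-1 i /\ p = vx k i.+1]]).
Proof.
case/and3P=> /in_vx[k [j [h1 h2 ->]]] /in_vx[k' [j' [h3 h4 ->]]].
rewrite !vx1 // !vx2 // => /orP[/andP[/eqP e]|/andP[/eqP e]].
  subst k'; rewrite -!addSn !eqn_add2r => /orP[]/eqP e; subst.
    by left; exists k, j; split=> //; left.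
  by left; exists k, j'; split=> //; right.
case/orP=> /eqP e'; subst; right.
  exists k.+1, j; have -> : j' = j.+1 by lia.
  by split=> //; left.
exists k'.+1, j'; have -> : j = j'.+1 by lia.
by split=> //; right.
Qed.

(** Left, upper, right and lower neighbour. Successive rows begin one column further left, so
    positions shift by one between rows. *)
Definition nbrs k j : seq vtx :=
  (if 0 < j then [:: vx k j.-1] else [::]) ++
  (if (0 < k) && (0 < j <= k.*2.+1) then [:: vx k.-1 j.-1] else [::]) ++
  (if j <= k.*2.+1 then [:: vx k j.+1] else [::]) ++
  (if k.+1 < N then [:: vx k.+1 j.+1] else [::]).

Lemma nbrs_uniq k j : k < N -> j <= k.*2.+2 -> uniq (nbrs k j).
Proof.
move=> h1 h2; have h3 : k.-1 < N by lia.
rewrite /nbrs; case: ifP => c1; case: ifP => c2; case: ifP => c3; case: ifP => c4 //=;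
  rewrite ?inE !vtx_eq ?vx1 ?vx2 //; lia.
Qed.

Lemma nbrs_adj k j q : k < N -> j <= k.*2.+2 -> adjG (vx k j) q -> q \in nbrs k j.
Proof.
move=> h1 h2 /adjP[[k' [j' [h3 h4 h5]]]|[k' [j' [/andP[h0 h3] h4 h5]]]].
  case: h5 => [[e ->]|[-> e]].
    have [e1 e2] := vx_inj h1 h2 h3 (ltnW h4) e; subst k' j'.
    by rewrite /nbrs !mem_cat [j <= _]h4 inE eqxx !orbT.
  have [e1 e2] := vx_inj h1 h2 h3 h4 e; subst k' j.
  by rewrite /nbrs mem_cat inE eqxx.
case: h5 => [[e ->]|[-> e]].
  have h6 : k'.-1 < N by lia.
  have h7 : j' <= k'.-1.*2.+2 by lia.
  have [e1 e2] := vx_inj h1 h2 h6 h7 e; subst k j'.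
  by rewrite /nbrs !mem_cat prednK // h3 inE eqxx !orbT.
have h6 : j' < k'.*2.+2 by lia.
have [e1 e2] := vx_inj h1 h2 h3 h6 e; subst k' j.
have h7 : 0 < j'.+1 <= k.*2.+1 by lia.
by rewrite /nbrs !mem_cat h0 h7 !inE eqxx !orbT.
Qed.

Lemma card_nbrs k j (P : pred vtx) : k < N -> j <= k.*2.+2 ->
  (forall q, P q -> adjG (vx k j) q) -> #|P| = count P (nbrs k j).
Proof.
move=> h1 h2 h; rewrite -size_filter -(card_uniqP (filter_uniq P (nbrs_uniq h1 h2))).
apply: eq_card => q; rewrite mem_filter unfold_in andb_idr // => hq.
exact: nbrs_adj (h q hq).
Qed.

Lemma Lv_vx (i : 'I_N) : Lv i = vx (N - i.+1) 0.
Proof.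
apply/eqP; rewrite vtx_eq; have := ltn_ord i => hi.
by rewrite vx1 ?vx2 /= ?inordK //; lia.
Qed.

Lemma Rv_vx (i : 'I_N) : Rv i = vx i i.*2.+2.
Proof.
apply/eqP; rewrite vtx_eq; have := ltn_ord i => hi.
by rewrite vx1 ?vx2 /= ?inordK //; lia.
Qed.

Lemma Bv_vx (i : 'I_N) : Bv i = vx N.-1 i.*2.+1.
Proof.
apply/eqP; rewrite vtx_eq; have := ltn_ord i => hi.
by rewrite vx1 ?vx2 /= ?inordK //; lia.
Qed.

Lemma boundary_vx k j : k < N -> j <= k.*2.+2 ->
  is_boundary (vx k j) = [|| j == 0, j == k.*2.+2 | (k == N.-1) && odd j].
Proof.
move=> h1 h2; apply/existsP/idP => [[i]|].
  have hi := ltn_ord i; rewrite Lv_vx Rv_vx Bv_vx !vtx_eq !vx1 ?vx2 //; lia.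
case/or3P=> [/eqP->|/eqP->|/andP[/eqP-> hj]].
- have hi : N - k.+1 < N by lia.
  exists (Ordinal hi); rewrite Lv_vx /=; have -> : N - (N - k.+1).+1 = k by lia.
  by rewrite eqxx.
- by exists (Ordinal h1); rewrite Rv_vx /= eqxx orbT.
have hi : j./2 < N by lia.
exists (Ordinal hi); rewrite Bv_vx /=; have -> : j./2.*2.+1 = j by lia.
by rewrite eqxx !orbT.
Qed.
End Graph.

(** With at most one predecessor per vertex, the descendants of a source [x] are closed under edges
    in both directions, hence are its whole component; a second source is not among them. *)
Lemma not_connect_sources (T : finType) (e : rel T) (x y : T) :
  (forall a b c, e a c -> e b c -> a = b) ->
  (forall a, ~~ e a x) -> (forall a, ~~ e a y) -> x != y ->
  ~~ connect [rel a b | e a b || e b a] x y.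
Proof.
move=> hi hx hy /negP hxy; apply/negP => hc.
have hcl : closed [rel a b | e a b || e b a] [pred z | connect e x z].
  apply: intro_closed; first by apply: sym_connect_sym => a b; rewrite /= orbC.
  move=> a b /=; rewrite !inE => /orP[h1 h2|h1 /connectP[p hp e1]].
    exact: connect_trans h2 (connect1 h1).
  move: hp e1; case/lastP: p => [_ /= e1|p c]; first by rewrite e1 (negPf (hx _)) in h1.
  rewrite rcons_path last_rcons => /andP[hp hl] e1; subst c.
  by rewrite (hi _ _ _ h1 hl); apply/connectP; exists p.
have := closed_connect hcl hc; rewrite !inE connect0 => /esym/connectP[p].
case/lastP: p => [_ /= e1|p c]; first by rewrite e1 eqxx in hxy.
by rewrite rcons_path last_rcons => /andP[_ + e1]; rewrite -e1 (negPf (hy _)).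
Qed.

(** * Arc sets as labellings: degree conditions in terms of labels *)

Section Labels.
Variables (N : nat) (A : arcs N).

(* an arc is labelled by the colour of its origin *)
Definition elab (p q : Vtx N) : lab :=
  if (p, q) \in A then Some (evenp p) else if (q, p) \in A then Some (evenp q) else N_.

Definition oriented := [forall a in A, adjG a.1 a.2] && [forall a in A, (a.2, a.1) \notin A].

Hypothesis hA : oriented.

Lemma arc_adj p q : (p, q) \in A -> adjG p q.
Proof. by case/andP: hA => /forall_inP h _ /h. Qed.

Lemma arc_anti p q : (p, q) \in A -> (q, p) \notin A.
Proof. by case/andP: hA => _ /forall_inP h /h. Qed.

Lemma elabC p q : elab p q = elab q p.
Proof.
rewrite /elab; case: ifP => h1; case: ifP => h2 //.
by rewrite (negPf (arc_anti h1)) in h2.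
Qed.

Lemma elab_out p q : ((p, q) \in A) = (elab p q == Some (evenp p)).
Proof.
rewrite /elab; case: ifP => [_|_]; first by rewrite eqxx.
case: ifP => // /arc_adj/adj_even ->; by case: (evenp q).
Qed.

Lemma elab_in p q : ((q, p) \in A) = (elab p q == Some (~~ evenp p)).
Proof.
rewrite elab_out elabC; case: (boolP (adjG p q)) => [/adj_even->//|h].
have -> : elab p q = N_; last by [].
rewrite /elab; case: ifP => [/arc_adj|_]; first by rewrite (negPf h).
by case: ifP => [/arc_adj|//]; rewrite adj_sym (negPf h).
Qed.

Lemma outdeg_card p : outdeg A p = #|[pred q | elab p q == Some (evenp p)]|.
Proof.
rewrite /outdeg -(card_imset (pred_of_simpl [pred q | elab p q == Some (evenp p)]) (f := fun q => (p, q))).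
  apply: eq_card => -[a b]; rewrite !inE /=; apply/andP/imsetP => [[h /eqP<-]|[q]].
    by exists b; rewrite // inE -elab_out.
  by rewrite inE -elab_out => h [-> ->].
by move=> a b [].
Qed.

Lemma indeg_card p : indeg A p = #|[pred q | elab p q == Some (~~ evenp p)]|.
Proof.
rewrite /indeg -(card_imset (pred_of_simpl [pred q | elab p q == Some (~~ evenp p)]) (f := fun q => (q, p))).
  apply: eq_card => -[a b]; rewrite !inE /=; apply/andP/imsetP => [[h /eqP<-]|[q]].
    by exists a; rewrite // inE -elab_in.
  by rewrite inE -elab_in => h [-> ->].
by move=> a b [].
Qed.

Definition hlab k j := elab (vx N k j) (vx N k j.+1).
Definition vlab k i := elab (vx N k.-1 i) (vx N k i.+1).

Definition ldeg (k j : nat) (x : lab) : nat :=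
  (if 0 < j then hlab k j.-1 == x : nat else 0) +
  (if (0 < k) && (0 < j <= k.*2.+1) then vlab k j.-1 == x : nat else 0) +
  (if j <= k.*2.+1 then hlab k j == x : nat else 0) +
  (if k.+1 < N then vlab k.+1 j == x : nat else 0).

Lemma ldegE k j b : k < N -> j <= k.*2.+2 ->
  #|[pred q | elab (vx N k j) q == Some b]| = ldeg k j (Some b).
Proof.
move=> h1 h2; rewrite (card_nbrs h1 h2) => [|q /=]; last first.
  rewrite /elab; case: ifP => [/arc_adj//|_].
  by case: ifP => // /arc_adj; rewrite adj_sym.
rewrite /nbrs !count_cat /ldeg /hlab /vlab !addnA.
congr (_ + _ + _ + _); case: ifP => //= c; rewrite addn0 //.
- by rewrite elabC prednK.
- case/and3P: c => _ c _; by rewrite elabC prednK.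
Qed.

Lemma outdeg_vx k j : k < N -> j <= k.*2.+2 -> outdeg A (vx N k j) = ldeg k j (Some (odd j)).
Proof. by move=> h1 h2; rewrite outdeg_card evenp_vx // ldegE. Qed.

Lemma indeg_vx k j : k < N -> j <= k.*2.+2 -> indeg A (vx N k j) = ldeg k j (Some (~~ odd j)).
Proof. by move=> h1 h2; rewrite indeg_card evenp_vx // ldegE. Qed.

Lemma deg_out p : ~~ in_G p -> indeg A p = 0 /\ outdeg A p = 0.
Proof.
move=> h; split; apply/eqP; rewrite cards_eq0 -subset0; apply/subsetP => -[a b];
  rewrite !inE /= => /andP[/arc_adj/and3P[h1 h2 _] /eqP e]; by rewrite -e ?h1 ?h2 in h.
Qed.

Variables u v w : N.-tuple bool.

(** Below the bottom row, [B_i] gets a fictitious edge continuing its path: with in-degree 1 it is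
    outgoing, so the letter 1 becomes [T_]. The [B_i] then satisfy [ok4] like inner vertices. *)
Definition flab k i : lab :=
  if k == 0 then N_ else if k == N then (if odd i then Some (nth false w i./2) else N_) else vlab k i.

Hypothesis N_gt0 : 0 < N.

Lemma ldeg_left k b : k < N -> ldeg k 0 (Some b) = (hlab k 0 == Some b) + (flab k.+1 0 == Some b).
Proof.
move=> hk; rewrite /ldeg /= andbF !add0n /flab /=; congr (_ + _).
case: (ltngtP k.+1 N) => h; rewrite ?h ?eqxx //; lia.
Qed.

Lemma ldeg_right k b : k < N ->
  ldeg k k.*2.+2 (Some b) = (hlab k k.*2.+1 == Some b) + (flab k.+1 k.*2.+2 == Some b).
Proof.
move=> hk; rewrite /ldeg /= ltnn andbF !addn0 /flab /= odd_double; congr (_ + _).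
case: (ltngtP k.+1 N) => h; rewrite ?h ?eqxx //; lia.
Qed.

Lemma ldeg_inner k j b : k < N -> j < k.*2.+1 ->
  count_mem (Some b) [:: hlab k j; flab k j; hlab k j.+1; flab k.+1 j.+1] =
  ldeg k j.+1 (Some b) + ((k.+1 == N) && (flab N j.+1 == Some b)).
Proof.
move=> hk hj; have hj' : j.+1 <= k.*2.+1 by [].
rewrite /ldeg /= hj' /= addn0 -!addnA; congr (_ + (_ + (_ + _))).
- rewrite /flab; case: (k) hk => [|k'] hk //=.
  by rewrite (negPf (_ : k'.+1 != N)) // neq_ltn hk.
case: (ltngtP k.+1 N) => h /=; [by rewrite addn0 /flab /= (negPf (_ : k.+1 != N)) // neq_ltn h | lia | by rewrite h].
Qed.

Lemma left_degs k : k < N ->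
  indeg A (vx N k 0) = (hlab k 0 == T_) + (flab k.+1 0 == T_) /\
  outdeg A (vx N k 0) = (hlab k 0 == F_) + (flab k.+1 0 == F_).
Proof. by move=> hk; rewrite indeg_vx // outdeg_vx // !ldeg_left. Qed.

Lemma right_degs k : k < N ->
  indeg A (vx N k k.*2.+2) = (hlab k k.*2.+1 == T_) + (flab k.+1 k.*2.+2 == T_) /\
  outdeg A (vx N k k.*2.+2) = (hlab k k.*2.+1 == F_) + (flab k.+1 k.*2.+2 == F_).
Proof. by move=> hk; rewrite indeg_vx // outdeg_vx //= odd_double !ldeg_right. Qed.

Lemma inner_degs k j : k < N -> j < k.*2.+1 ->
  ok4 (hlab k j) (flab k j) (hlab k j.+1) (flab k.+1 j.+1) =
  if (k == N.-1) && ~~ odd j then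
    (indeg A (vx N k j.+1) + ~~ nth false w j./2 == 1) && (outdeg A (vx N k j.+1) + nth false w j./2 == 1)
  else (indeg A (vx N k j.+1) == 1) && (outdeg A (vx N k j.+1) == 1).
Proof.
move=> hk hj; rewrite /ok4 !ldeg_inner // indeg_vx ?outdeg_vx //=; try lia.
have -> : (k == N.-1) = (k.+1 == N) by lia.
case: (k.+1 == N); last by rewrite !addn0 !andFb; case: (odd j) => //=; rewrite andbC.
have hN : (N == 0) = false by lia.
rewrite !andTb /flab hN eqxx /= uphalf_half.
case: (odd j) => /=; first by rewrite !addn0 andbC.
by rewrite add0n; case: (nth false w _).
Qed.

Lemma oTFPL_labelling : is_oTFPL A -> has_boundary A u v w -> labelling N u v w hlab flab.
Proof.
case/and5P=> _ _ /forallP h1 /forallP h2 /and3P[_ /forallP h3 /forallP h4] /forallP hb.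
split.
- by [].
- move=> k hk; have hi : N - k.+1 < N by lia.
  have := hb (Ordinal hi); have := h1 (Ordinal hi); have := h4 (Ordinal hi).
  rewrite Lv_vx /=; have -> : N - (N - k.+1).+1 = k by lia.
  have [e1 e2] := left_degs hk; rewrite /deg e1 e2 !(tnth_nth false) /=.
  move=> /andP[+ _] /and3P[+ _ _] /and3P[+ _ _].
  by rewrite /left_ok; case: (nth _ _ _); case: (hlab _ _) => [[]|]; case: (flab _ _) => [[]|].
- move=> k j hk hj; rewrite inner_degs //; case: ifP => [/andP[/eqP hk1 hj1]|hc].
    have hi : j./2 < N by lia.
    have := hb (Ordinal hi); have := h1 (Ordinal hi).
    rewrite Bv_vx /= -hk1; have -> : j./2.*2.+1 = j.+1 by lia.
    rewrite !(tnth_nth false) /= => /and3P[_ _ /eqP hd] /and3P[_ _ /eqP->].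
    by move: hd; rewrite /deg; case: eqP => /=; lia.
  have hin : in_G (vx N k j.+1) by apply: vx_in => //; lia.
  have := h2 (vx N k j.+1); rewrite hin boundary_vx //; last by lia.
  have -> : [|| j.+1 == 0, j.+1 == k.*2.+2 | (k == N.-1) && odd j.+1] = false.
    by rewrite /= hc orbF; lia.
  by move=> /= hd; have := h3 (vx N k j.+1); rewrite hd.
- move=> k hk; have := hb (Ordinal hk); have := h1 (Ordinal hk); have := h4 (Ordinal hk).
  rewrite Rv_vx /=.
  have [e1 e2] := right_degs hk; rewrite /deg e1 e2 !(tnth_nth false) /=.
  move=> /andP[_ +] /and3P[_ + _] /and3P[_ + _].
  by rewrite /right_ok; case: (nth _ _ _); case: (hlab _ _) => [[]|]; case: (flab _ _) => [[]|].
have hN : (N == 0) = false by lia.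
rewrite /flab hN eqxx; split=> i hi; first by rewrite odd_double.
by rewrite /= odd_double /= uphalf_double.
Qed.

Lemma labelling_oTFPL : labelling N u v w hlab flab -> is_oTFPL A && has_boundary A u v w.
Proof.
case=> _ hL hV hR _.
have hLv (i : 'I_N) : [/\ indeg A (Lv i) = 0 & outdeg A (Lv i) = tnth u i].
  have hi := ltn_ord i; rewrite Lv_vx; have hk : N - i.+1 < N by lia.
  have [-> ->] := left_degs hk; have := hL _ hk.
  have -> : N - (N - i.+1).+1 = i by lia.
  rewrite -(tnth_nth false) /left_ok.
  by case: (tnth _ _); case: (hlab _ _) => [[]|]; case: (flab _ _) => [[]|].
have hRv (i : 'I_N) : [/\ indeg A (Rv i) = ~~ tnth v i & outdeg A (Rv i) = 0].
  rewrite Rv_vx; have [-> ->] := right_degs (ltn_ord i); have := hR _ (ltn_ord i).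
  rewrite -(tnth_nth false) /right_ok.
  by case: (tnth _ _); case: (hlab _ _) => [[]|]; case: (flab _ _) => [[]|].
have hBv (i : 'I_N) : [/\ indeg A (Bv i) = tnth w i & outdeg A (Bv i) = ~~ tnth w i].
  rewrite Bv_vx; have hi := ltn_ord i; have hk : N.-1 < N by lia.
  have hj : i.*2 < N.-1.*2.+1 by lia.
  have := hV _ _ hk hj; rewrite inner_degs // eqxx odd_double doubleK -(tnth_nth false) /=.
  by case: (tnth w i) => /= /andP[/eqP h1 /eqP h2]; split; lia.
have hI p : in_G p -> ~~ is_boundary p -> indeg A p = 1 /\ outdeg A p = 1.
  move=> /in_vx[k [j [hk hj ->]]]; rewrite boundary_vx // !negb_or => /and3P[h1 h2 h3].
  case: j hj h1 h2 h3 => // j hj _ h2 h3.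
  have hj' : j < k.*2.+1 by lia.
  have := hV _ _ hk hj'; rewrite inner_degs //.
  by move: h3 => /= /negPf-> /andP[/eqP-> /eqP->].
(* In- and out-degrees are at most 1 everywhere, which serves the path condition for both families
   and the orientation at vertices of degree 2. *)
have hcase p : [\/ indeg A p = 0 /\ outdeg A p <= 1, indeg A p = 1 /\ outdeg A p = 0 |
                   indeg A p = 1 /\ outdeg A p = 1].
  case: (boolP (in_G p)) => [hp|/deg_out[-> ->]]; last by constructor 1.
  case: (boolP (is_boundary p)) => [/existsP[i]|hb]; last by constructor 3; exact: hI.
  case/orP=> [/orP[]|] /eqP->; [have [-> ->] := hLv i | have [-> ->] := hRv i | have [-> ->] := hBv i].
  - by constructor 1; case: (tnth _ _).
  - by case: (tnth _ _); [constructor 1 | constructor 2].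
  by case: (tnth _ _); [constructor 2 | constructor 1].
have hcol p q r : (q, p) \in A -> (r, p) \in A -> q = r.
  move=> h1 h2; have hle : indeg A p <= 1 by have [[->]|[->]|[->]] := hcase p.
  have := card_le1_eqP hle (q, p) (r, p); rewrite !inE /= eqxx !andbT => h.
  by have [] := h h1 h2.
have hrow p q r : (p, q) \in A -> (p, r) \in A -> q = r.
  move=> h1 h2; have hle : outdeg A p <= 1 by have [[_]|[_ ->]|[_ ->]] := hcase p.
  have := card_le1_eqP hle (p, q) (p, r); rewrite !inE /= eqxx !andbT => h.
  by have [] := h h1 h2.
apply/andP; split; last first.
  apply/forallP => i; have [e1 e2] := hLv i; have [e3 e4] := hRv i; have [e5 e6] := hBv i.
  rewrite /deg e1 e2 e3 e4 e5.
  by case: (tnth u i); case: (tnth v i); case: (tnth w i).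
case/andP: (hA) => ha1 ha2; apply/and5P; split=> //; [| |apply/and3P; split].
- apply/forallP => i; have [e1 e2] := hLv i; have [e3 e4] := hRv i; have [e5 e6] := hBv i.
  rewrite /deg e1 e2 e3 e4 e5 e6.
  by case: (tnth u i); case: (tnth v i); case: (tnth w i).
- by apply/forallP => p; apply/implyP => /andP[h1 h2]; rewrite /deg; have [-> ->] := hI p h1 h2.
- apply/'forall_forallP => i j; apply/implyP => hij; apply/andP; split.
    apply: (@not_connect_sources _ [rel a b | (a, b) \in A]).
    + by move=> a b c /=; apply: hcol.
    + move=> a /=; have [+ _] := hLv i; move/eqP; rewrite cards_eq0 => /eqP/setP/(_ (a, Lv i)).
      by rewrite !inE eqxx andbT => ->.
    + move=> a /=; have [+ _] := hLv j; move/eqP; rewrite cards_eq0 => /eqP/setP/(_ (a, Lv j)).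
      by rewrite !inE eqxx andbT => ->.
    apply: contra hij; rewrite !Lv_vx => /eqP/vx_inj e; apply/eqP/val_inj => /=.
    have [||||e1 _] := e; have := ltn_ord i; have := ltn_ord j; lia.
  (* The [R]s have no outgoing arc, so they are sources once all arcs are reversed. *)
  rewrite (eq_connect (e' := [rel a b | [rel b a | (a, b) \in A] a b || [rel b a | (a, b) \in A] b a])); last first.
    by move=> a b; rewrite /und /= orbC.
  apply: not_connect_sources.
  + by move=> a b c /=; apply: hrow.
  + move=> a /=; have [_] := hRv i; move/eqP; rewrite cards_eq0 => /eqP/setP/(_ (Rv i, a)).
    by rewrite !inE eqxx andbT => ->.
  + move=> a /=; have [_] := hRv j; move/eqP; rewrite cards_eq0 => /eqP/setP/(_ (Rv j, a)).
    by rewrite !inE eqxx andbT => ->.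
  apply: contra hij; rewrite !Rv_vx => /eqP/vx_inj e; apply/eqP/val_inj => /=.
  by have [||||] := e.
- apply/forallP => p; apply/implyP; rewrite /deg.
  by have [[-> h]|[-> ->]|[-> ->]] := hcase p; lia.
by apply/forallP => i; have [-> _] := hLv i; have [_ ->] := hRv i.
Qed.

End Labels.

Section OfLabels.
Variables (N : nat) (h f : nat -> nat -> lab).

(** A horizontal edge is indexed by its left end and a vertical one by its lower row, the row of
    larger number. *)
Definition lab_of (p q : Vtx N) : lab :=
  if val p.1 == val q.1 then h (val p.1) (minn (val p.2) (val q.2) - (N - (val p.1).+1))
  else f (maxn (val p.1) (val q.1)) (val p.2 - (N - maxn (val p.1) (val q.1))).

Definition arcs_of : arcs N :=
  [set a | adjG a.1 a.2 && (lab_of a.1 a.2 == Some (evenp a.1))].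

Lemma lab_ofC p q : adjG p q -> lab_of p q = lab_of q p.
Proof.
case/and3P=> _ _; rewrite /lab_of eq_sym minnC maxnC; case: eqP => [-> //|_].
by case/orP=> /andP[/eqP e] //; rewrite e.
Qed.

Lemma lab_of_hor k j : k < N -> j < k.*2.+2 -> lab_of (vx N k j) (vx N k j.+1) = h k j.
Proof.
by move=> hk hj; rewrite /lab_of !vx2 ?vx1 ?eqxx //=; [congr h |]; lia.
Qed.

Lemma lab_of_ver k i : 0 < k < N -> i <= k.*2 -> lab_of (vx N k.-1 i) (vx N k i.+1) = f k i.
Proof.
move=> /andP[h0 hk] hi; have hk1 : k.-1 < N by lia.
rewrite /lab_of vx2 ?vx1 //; try lia.
have -> : (k.-1 == k) = false by lia.
have -> : maxn k.-1 k = k by lia.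
by congr f; lia.
Qed.

Lemma arcs_of_oriented : oriented arcs_of.
Proof.
apply/andP; split; apply/forall_inP => -[p q]; rewrite !inE /= => /andP[ha] // /eqP e.
by rewrite adj_sym ha -lab_ofC // e (adj_even ha) /=; case: (evenp p).
Qed.

Lemma elab_arcs_of p q : adjG p q -> elab arcs_of p q = lab_of p q.
Proof.
move=> ha; rewrite /elab !inE /= [adjG q p]adj_sym ha -(lab_ofC ha) (adj_even ha) /=.
by case: (lab_of p q) => [[]|]; case: (evenp p).
Qed.

Lemma hlab_arcs_of k j : k < N -> j < k.*2.+2 -> hlab arcs_of k j = h k j.
Proof. by move=> hk hj; rewrite /hlab elab_arcs_of ?adj_hor // lab_of_hor. Qed.

Lemma vlab_arcs_of k i : 0 < k < N -> i <= k.*2 -> vlab arcs_of k i = f k i.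
Proof. by move=> hk hi; rewrite /vlab elab_arcs_of ?adj_ver // lab_of_ver. Qed.
End OfLabels.

Lemma oriented_inj N (A B : arcs N) : oriented A -> oriented B ->
  (forall k j, k < N -> j < k.*2.+2 -> hlab A k j = hlab B k j) ->
  (forall k i, 0 < k < N -> i <= k.*2 -> vlab A k i = vlab B k i) -> A = B.
Proof.
move=> hA hB hh hv.
have he p q : adjG p q -> elab A p q = elab B p q.
  move=> /adjP[[k [j [hk hj [[-> ->]|[-> ->]]]]]|[k [i [hk hi [[-> ->]|[-> ->]]]]]].
  - exact: hh.
  - by rewrite elabC // [RHS]elabC //; exact: hh.
  - exact: hv.
  - by rewrite elabC // [RHS]elabC //; exact: hv.
apply/setP => -[p q]; case: (boolP (adjG p q)) => [ha|ha].
  by rewrite !elab_out // he.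
by apply/idP/idP => /arc_adj h; rewrite h in ha.
Qed.

Theorem num_oTFPL_puz N (u v w : N.-tuple bool) : 0 < N -> dinv w = dinv u + dinv v ->
  num_oTFPL u v w = puz u v w.
Proof.
move=> hN hd; rewrite /puz -size_tilings.
pose S := [set A : arcs N | is_oTFPL A && has_boundary A u v w].
pose Phi A := trows N (hlab A) (flab A w).
have hu := size_tuple u; have hv := size_tuple v; have hw := size_tuple w.
have hS A : A \in S -> oriented A /\ tiling N u v w (hlab A) (flab A w).
  rewrite inE => /andP[h1 h2]; have ho : oriented A by case/and5P: h1 => ? ? *; apply/andP.
  by split=> //; apply: labelling_tiling => //; apply: oTFPL_labelling.
have hinj : {in S &, injective Phi}.
  move=> A B /hS[oA [tA _ _ _ _]] /hS[oB [tB _ _ _ _]] /trows_inj[e1 e2].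
  apply: oriented_inj => // k i /andP[h0 hk] hi.
  have hf (C : arcs N) j : flab C w k j = vlab C k j.
    by rewrite /flab (gtn_eqF h0) (ltn_eqF hk).
  (* Odd positions are recorded in [trows]; at even positions both tilings have [N_]. *)
  rewrite -!hf -(odd_double_half i); case: (boolP (odd i)) => hodd; rewrite ?add1n ?add0n.
    by apply: e2; lia.
  by rewrite tA ?tB //; lia.
rewrite /num_oTFPL -/S cardE -(size_map Phi); apply/perm_size/uniq_perm.
- rewrite map_inj_in_uniq ?enum_uniq // => A B; rewrite !mem_enum; exact: hinj.
- exact: tilings_uniq.
move=> s; apply/mapP/idP => [[A]|hs].
  rewrite mem_enum => /hS[oA tA] ->; apply/(tiling_trows hu hv hw) => //.
  by case: tA.
have [h [f [hf e]]] := tilings_trows hu hv hw hs.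
have ht : tiling N u v w h f by apply/(tiling_trows hu hv hw) => //; rewrite -e.
have [_ _ _ _ htN] := ht.
have oA : oriented (arcs_of N h f) := arcs_of_oriented N h f.
have eh k j : k < N -> j < k.*2.+2 -> hlab (arcs_of N h f) k j = h k j by exact: hlab_arcs_of.
have ef k i : 0 < k <= N -> i <= k.*2 -> flab (arcs_of N h f) w k i = f k i.
  move=> /andP[h0 hk] hi; rewrite /flab; have -> : (k == 0) = false by lia.
  case: eqP => [ek|nk]; last by apply: vlab_arcs_of => //; lia.
  subst k; rewrite -{3}(odd_double_half i); case: ifP => hodd; last by rewrite add0n hf //; lia.
  by rewrite add1n htN //; lia.
have eP : Phi (arcs_of N h f) = s.
  rewrite e /Phi /trows; apply/eq_in_map => m; rewrite mem_iota => hm.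
  congr (_, _); apply/eq_in_map => i; rewrite mem_iota => hi; [apply: eh | apply: ef]; lia.
exists (arcs_of N h f) => //; rewrite mem_enum inE; apply: labelling_oTFPL => //.
apply: tiling_labelling => //; apply/(tiling_trows hu hv hw) => [k i hk hi|].
  case: (posnP k) => [->|hk0]; first by [].
  by rewrite ef ?hf //; lia.
by rewrite -/(Phi _) eP.
Qed.

Theorem theorem5p6 (N : nat) (u v w : N.-tuple bool) :
  0 < N ->
  nzeros u = nzeros v -> nzeros v = nzeros w ->
  dinv w = dinv u + dinv v ->
  is_LR_coeff N (lam w) (lam u) (lam v) (Posz (num_oTFPL u v w)).
Proof.
move=> hN huv hvw hd; rewrite num_oTFPL_puz //.
by apply: puz_LR; rewrite ?size_tuple.
Qed.
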